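(* Suppose $u:\mathbb{R}^d\to\mathbb{R}$, $u\in C^2$, is such that there exist $L',l'>0$ with $$|\nabla u(x)-\nabla u(y)|\le L'(1+|x|+|y|)^{l'}|x-y|\quad\forall x,y\in\mathbb{R}^d,$$ and such that $$\langle\nabla u(x)-\nabla u(y),x-y\rangle\ge\big(c_1(|x|^{2r}+|y|^{2r})-c_2(|x|^l+|y|^l)-c_3\big)|x-y|^2\quad\forall x,y\in\mathbb{R}^d,$$ for some $c_1,c_2,c_3>0$ and $2r>l>0$. Then $\pi_\beta$ satisfies a Log-Sobolev inequality with constant independent of the dimension and exponential in $\beta$.
   Context: $\beta>0$ is the temperature parameter and $\pi_\beta$ is the probability measure on $\mathbb{R}^d$ with density $e^{-\beta u(x)}/\int_{\mathbb{R}^d}e^{-\beta u(y)}dy$. It satisfies a Log-Sobolev inequality (LSI) with constant $\alpha>0$ if for all probability measures $\nu\ll\pi_\beta$ with $f:=d\nu/d\pi_\beta\in H^1(\mathbb{R}^d)$, $$\int_{\mathbb{R}^d} f\log f\,d\pi_\beta\le\frac1{2\alpha}\int_{\mathbb{R}^d}\frac{\Gamma(f,f)}{f}\,d\pi_\beta,\qquad \Gamma(f,g)=\frac1\beta\langle\nabla f,\nabla g\rangle .$$ *)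

(* Defs.v *)
From HB Require Import structures.
From mathcomp Require Import all_boot all_order all_algebra.
From mathcomp Require Import all_classical all_reals all_analysis.

Set Implicit Arguments.
Unset Strict Implicit.
Unset Printing Implicit Defensive.

Import Order.TTheory GRing.Theory Num.Theory.
Import numFieldNormedType.Exports.

Local Open Scope classical_set_scope.
Local Open Scope ring_scope.

(* 'rV[R]_n carries the sigma-algebra generated by its coordinates, that is,
   the Borel sigma-algebra of R^n. *)
Definition rV_display : measure_display. Proof. exact: default_measure_display. Qed.

Section measurable_rV.
Variables (R : realType) (n : nat).

Definition rV_coord (i : 'I_n) (x : 'rV[R]_n) : measurableTypeR R := x ord0 i.

Let rV_set0 : g_sigma_preimage rV_coord set0.
Proof. exact: sigma_algebra0. Qed.

Let rV_setC A : g_sigma_preimage rV_coord A -> g_sigma_preimage rV_coord (~` A).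
Proof. exact: sigma_algebraC. Qed.

Let rV_bigcup (F : _^nat) : (forall i, g_sigma_preimage rV_coord (F i)) ->
  g_sigma_preimage rV_coord (\bigcup_i (F i)).
Proof. exact: sigma_algebra_bigcup. Qed.

HB.instance Definition _ := @isMeasurable.Build rV_display 'rV[R]_n
  (g_sigma_preimage rV_coord) rV_set0 rV_setC rV_bigcup.

Lemma measurable_rV_coord (i : 'I_n) : measurable_fun setT (rV_coord i).
Proof.
move=> _ Y mY; rewrite setTI; apply: sub_sigma_algebra.
by rewrite (bigD1 i)//=; left; exists Y => //; rewrite setTI.
Qed.

Lemma measurable_fun_rVP d (T : measurableType d) (f : T -> 'rV[R]_n) :
  (forall i, measurable_fun setT (rV_coord i \o f)) -> measurable_fun setT f.
Proof.
move=> mf; apply: (@measurability _ _ T 'rV[R]_n setT f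
  (\big[setU/set0]_(i < n)
     preimage_set_system setT (rV_coord i) measurable)) => //.
move=> _ [B + <-]; rewrite setTI; move: B.
elim/big_ind : _ => // [X Y IX IY B [/IX|/IY]//|i _ _ [A mA <-]].
by rewrite setTI -comp_preimage -[X in measurable X]setTI; exact: mf.
Qed.

End measurable_rV.

Section lebesgue_measure_rV.
Variable R : realType.

Definition cons_rV n (p : measurableTypeR R * 'rV[R]_n) : 'rV[R]_n.+1 :=
  row_mx (p.1 : R)%:M p.2.

Let uncons_rV n (x : 'rV[R]_n.+1) : measurableTypeR R * 'rV[R]_n :=
  (x ord0 ord0, \row_i x ord0 (lift ord0 i)).

Let cons_rVl n t (v : 'rV[R]_n) (i : 'I_1) :
  cons_rV (t, v) ord0 (lshift n i) = t.
Proof. by rewrite /cons_rV (row_mxEl (t : R)%:M) mxE (ord1 i) eqxx mulr1n. Qed.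

Let cons_rVr n t (v : 'rV[R]_n) i :
  cons_rV (t, v) ord0 (rshift 1 i) = v ord0 i.
Proof. by rewrite /cons_rV (row_mxEr (t : R)%:M). Qed.

Let cons_rV0 n t (v : 'rV[R]_n) : cons_rV (t, v) ord0 ord0 = t.
Proof.
by rewrite -[RHS](cons_rVl t v ord0); congr (cons_rV _ _ _); exact/val_inj.
Qed.

Let cons_rVS n t (v : 'rV[R]_n) i : cons_rV (t, v) ord0 (lift ord0 i) = v ord0 i.
Proof.
by rewrite -[RHS](cons_rVr t v i); congr (cons_rV _ _ _); exact/val_inj.
Qed.

Let cons_rVK n : cancel (@cons_rV n) (@uncons_rV n).
Proof.
move=> [t v]; congr pair; first exact: cons_rV0.
by apply/rowP => i; rewrite mxE cons_rVS.
Qed.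

Lemma measurable_cons_rV n : measurable_fun setT (@cons_rV n).
Proof.
apply: measurable_fun_rVP => i.
have [j ->|j ->] := @split_ordP 1 n i.
  rewrite (_ : _ \o _ = fst); first exact: measurable_fst.
  by apply/funext => -[t v]; exact: cons_rVl.
rewrite (_ : _ \o _ = rV_coord j \o snd).
  by apply: measurableT_comp; [exact: measurable_rV_coord|exact: measurable_snd].
by apply/funext => -[t v]; exact: cons_rVr.
Qed.

Lemma measurable_uncons_rV n : measurable_fun setT (@uncons_rV n).
Proof.
apply: measurable_fun_pair; first exact: (@measurable_rV_coord R n.+1 ord0).
apply: measurable_fun_rVP => i.
rewrite (_ : _ \o _ = rV_coord (lift ord0 i)); first exact: measurable_rV_coord.
by apply/funext => x; rewrite /rV_coord/= mxE.
Qed.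

Section step.
Variables (n : nat) (m : {sigma_finite_measure set 'rV[R]_n -> \bar R}).

Definition lebesgue_rV_step : set 'rV[R]_n.+1 -> \bar R :=
  pushforward (lebesgue_measure \x m)%E (@cons_rV n).

Let step0 : lebesgue_rV_step set0 = 0%E.
Proof. by rewrite /lebesgue_rV_step /pushforward preimage_set0 measure0. Qed.

Let step_ge0 A : (0 <= lebesgue_rV_step A)%E.
Proof. exact: (measure_ge0 (lebesgue_measure \x m)%E). Qed.

Let step_sigma_additive : semi_sigma_additive lebesgue_rV_step.
Proof.
have mc := @measurable_cons_rV n.
move=> F mF tF mUF; rewrite /lebesgue_rV_step /pushforward preimage_bigcup.
apply: measure_semi_sigma_additive.
- by move=> k; rewrite -[X in measurable X]setTI; exact: mc.
- apply/trivIsetP => /= i j _ _ ij; rewrite -preimage_setI.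
  by move/trivIsetP : tF => /(_ _ _ _ _ ij) ->//; rewrite preimage_set0.
- by rewrite -preimage_bigcup -[X in measurable X]setTI; exact: mc.
Qed.

HB.instance Definition _ := isMeasure.Build _ _ _ lebesgue_rV_step
  step0 step_ge0 step_sigma_additive.

Let step_sigma_finite : sigma_finite setT lebesgue_rV_step.
Proof.
have /sigma_finiteP[F [TF ndF Foo]] := sigma_finiteT (@lebesgue_measure R).
have /sigma_finiteP[G [TG ndG Goo]] := sigma_finiteT m.
exists (fun k => @uncons_rV n @^-1` (F k `*` G k)).
  rewrite -preimage_bigcup -[LHS](preimage_setT (@uncons_rV n)).
  congr (_ @^-1` _); rewrite -setXTT TF TG predeqE => -[x y]; split.
    move=> [/= [i _ Fix] [j _ Gjy]]; exists (maxn i j) => //; split.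
    - by move: x Fix; exact/subsetPset/ndF/leq_maxl.
    - by move: y Gjy; exact/subsetPset/ndG/leq_maxr.
  by move=> [i _ []/= ? ?]; split; exists i.
move=> k; have [mF Fk] := Foo k; have [mG Gk] := Goo k; split.
  by rewrite -[X in measurable X]setTI; apply: measurable_uncons_rV => //; exact: measurableX.
rewrite /lebesgue_rV_step /pushforward -comp_preimage.
rewrite (_ : _ \o _ = id); last by apply/funext => p /=; rewrite cons_rVK.
by rewrite preimage_id product_measure1E// lte_mul_pinfty// ge0_fin_numE.
Qed.

HB.instance Definition _ := @Measure_isSigmaFinite.Build _ _ _ lebesgue_rV_step
  step_sigma_finite.

End step.

(* Lebesgue measure on R^n, as an iterated product. *)
Fixpoint lebesgue_rV (n : nat) : {sigma_finite_measure set 'rV[R]_n -> \bar R} :=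
  if n is k.+1 then lebesgue_rV_step (lebesgue_rV k)
  else dirac (0 : 'rV[R]_0).

Lemma measurable_box n (A : 'I_n -> set (measurableTypeR R)) :
  (forall i, measurable (A i)) ->
  measurable [set x : 'rV[R]_n | forall i, A i (x ord0 i)].
Proof.
move=> mA; rewrite (_ : mkset _ = \bigcap_(i in setT) (rV_coord i @^-1` A i)).
  apply: fin_bigcap_measurable => // i _.
  by rewrite -[X in measurable X]setTI; exact: measurable_rV_coord.
by apply/seteqP; split => x /= xA i; [move=> _|]; exact: xA.
Qed.

Lemma lebesgue_rV_box n (A : 'I_n -> set (measurableTypeR R)) :
  (forall i, measurable (A i)) ->
  lebesgue_rV n [set x | forall i, A i (x ord0 i)] =
  (\prod_(i < n) lebesgue_measure (A i))%E.
Proof.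
elim: n A => [|n IH] A mA.
  by rewrite big_ord0 /= diracE mem_set// => -[].
rewrite big_ord_recl -IH//= /lebesgue_rV_step /pushforward.
rewrite -product_measure1E//; last first.
  exact: (@measurable_box n (fun i => A (lift ord0 i))).
congr (_ _); apply/seteqP; split => -[t v] /=.
  move=> tvA; split => [|i]; first by have := tvA ord0; rewrite cons_rV0.
  by have := tvA (lift ord0 i); rewrite cons_rVS.
move=> [tA vA] i; have [->|[j ->]] : i = ord0 \/ exists j, i = lift ord0 j.
- by case: (unliftP ord0 i) => [j ->|->]; [right; exists j|left].
- by rewrite cons_rV0.
- by rewrite cons_rVS.
Qed.

End lebesgue_measure_rV.

Section euclidean.
Variables (R : realType) (d : nat).
Implicit Types x y : 'rV[R]_d.

Definition dotp x y : R := \sum_i x ord0 i * y ord0 i.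

(* The library norm `|x| on 'rV[R]_d is the sup norm. *)
Definition enorm x : R := Num.sqrt (dotp x x).

Definition partial (i : 'I_d) (f : 'rV[R]_d -> R) : 'rV[R]_d -> R :=
  fun x => 'D_(delta_mx ord0 i) f x.

Definition grad (f : 'rV[R]_d -> R) x : 'rV[R]_d := \row_i partial i f x.

Fixpoint Ck (k : nat) (f : 'rV[R]_d -> R) : Prop :=
  continuous f /\
  if k is k'.+1 then
    forall i, (forall x, derivable f x (delta_mx ord0 i)) /\ Ck k' (partial i f)
  else True.

Definition test_function (phi : 'rV[R]_d -> R) : Prop :=
  (forall k, Ck k phi) /\ compact (closure [set x | phi x != 0]).

Definition square_integrable (f : 'rV[R]_d -> R) : Prop :=
  f \in Lfun (lebesgue_rV R d) 2%:E.

(* f is (a representative of) an element of H^1(R^d) with weak gradient G. *)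
Definition H1_with_gradient (f : 'rV[R]_d -> R) (G : 'rV[R]_d -> 'rV[R]_d) :=
  square_integrable f /\
  forall i, square_integrable (fun x => G x ord0 i) /\
    forall phi, test_function phi ->
      \int[lebesgue_rV R d]_x (f x * partial i phi x) =
      - \int[lebesgue_rV R d]_x (G x ord0 i * phi x).

End euclidean.

Section gibbs_lsi.
Variables (R : realType) (d : nat) (beta : R).

(* P has density e^{-beta u} / \int e^{-beta u}. As fine +oo = 0, a probability
   measure P with this property exists only if the normalizer is finite. *)
Definition is_gibbs (u : 'rV[R]_d -> R) (P : probability 'rV[R]_d R) : Prop :=
  let Z : \bar R := (\int[lebesgue_rV R d]_y (expR (- beta * u y))%:E)%E in
  forall A, measurable A ->
    P A = (\int[lebesgue_rV R d]_(x in A) (expR (- beta * u x) / fine Z)%:E)%E.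

(* The carre du champ Gamma(f, g) in terms of the gradients of f and g. *)
Definition Gamma (v w : 'rV[R]_d) : R := beta^-1 * dotp v w.

(* f is any real-valued version of dQ/dP. Since ln 0 = 0 and x / 0 = 0, both
   integrands vanish where f does; the weak gradient is a.e. zero there. *)
Definition log_sobolev (P : probability 'rV[R]_d R) (alpha : R) : Prop :=
  0 < alpha /\
  forall (Q : probability 'rV[R]_d R) (f : 'rV[R]_d -> R)
      (G : 'rV[R]_d -> 'rV[R]_d),
    Q `<< P ->
    (forall A, measurable A -> Q A = (\int[P]_(x in A) (f x)%:E)%E) ->
    H1_with_gradient f G ->
    (\int[P]_x (f x * ln (f x))%:E <=
     ((2 * alpha)^-1)%:E * \int[P]_x (Gamma (G x) (G x) / f x)%:E)%E.

End gibbs_lsi.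

(* Main.v *)
Require Import Defs.
From HB Require Import structures.
From mathcomp Require Import all_boot all_order all_algebra.
From mathcomp Require Import all_classical all_reals all_analysis.
From mathcomp Require Import measurable_realfun ring lra.
Import Order.TTheory GRing.Theory Num.Theory.
Import numFieldNormedType.Exports.
Local Open Scope classical_set_scope.
Local Open Scope ring_scope.

(** The monotonicity of the gradient of [u] can only fail on a ball whose radius
    does not depend on the dimension; adding to [u] a bounded radial well [W],
    chosen independently of the dimension as well, makes it uniformly convex.
    Thus the Gibbs measure is a bounded perturbation of a strongly log-concave
    measure. The latter satisfies a log-Sobolev inequality by the argument of
    Bobkov and Ledoux, based on the Prekopa-Leindler inequality, and the
    perturbation costs a factor [exp (beta * osc W)] (Holley-Stroock).
    These steps concern functions bounded above and away from [0] which admit a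
    quadratic expansion. An element of [H^1] is reached from [phi (F)], where [F]
    is a mollification and [phi x = x + s^2 / (x + s)]: the weight
    [phi'^2 / phi] is bounded, vanishes at [0] and is at most [4 / x]. *)

(** The well is added to [u] before the multiplication by [beta]: the convexity modulus is then
    proportional to [beta], the oscillation is [beta] times the depth of the well, and the factor
    [beta^-1] in [Gamma] cancels the modulus. Only an exponential of [beta] is left. In the
    Bobkov-Ledoux step the second-order constant [L] and the gradient bound [B] of the test function
    limit the size of [s], but they are absent from the final constant [1 / K]. This is what keeps
    the dimension out: [n] enters [L], [B] and error terms that vanish in a limit, and nothing else.
    Working with a fixed [s] instead of a derivative at [s = 0] costs a factor [2] against the
    optimal [1 / (2 * K)]. In the extension to [H^1] nothing should rest on the weak gradient
    vanishing where [f] does. The plain shift [f + s] would leave [|G|^2 / s] on that set, which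
    explodes as [s] tends to [0]. As [phi] has slope [0] at [0], the set contributes nothing, in
    accordance with [x / 0 = 0] in the statement. *)

Set Implicit Arguments.
Unset Strict Implicit.
Unset Printing Implicit Defensive.

(** * Integration on R^n *)

Section integration_rV.
Variable R : realType.
Local Notation leb := (@lebesgue_measure R).

Lemma cons_rV_lin n (a b : R) (x y : R) (v w : 'rV[R]_n) :
  cons_rV (a * x + b * y, a *: v + b *: w) =
  a *: cons_rV (x, v) + b *: cons_rV (y, w).
Proof.
apply/rowP => i; rewrite /cons_rV !mxE.
by case: splitP => j _; rewrite !mxE ?(ord1 j) ?eqxx ?mulr1n.
Qed.

Lemma cons_rVD n (x y : R) (v w : 'rV[R]_n) :
  cons_rV (x + y, v + w) = cons_rV (x, v) + cons_rV (y, w).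
Proof. by have := cons_rV_lin 1 1 x y v w; rewrite !mul1r !scale1r. Qed.

Lemma cons_rVE0 n (t : R) (v : 'rV[R]_n) : cons_rV (t, v) ord0 ord0 = t.
Proof.
rewrite /cons_rV !mxE; case: splitP => j //= _.
by rewrite !mxE (ord1 j) eqxx mulr1n.
Qed.

Lemma cons_rVES n (t : R) (v : 'rV[R]_n) i :
  cons_rV (t, v) ord0 (lift ord0 i) = v ord0 i.
Proof.
rewrite /cons_rV !mxE; case: splitP => j /=.
  by rewrite (ord1 j).
by rewrite /bump /= add1n => -[] /val_inj ->.
Qed.

Lemma rV_consE n (x : 'rV[R]_n.+1) :
  x = cons_rV (x ord0 ord0, \row_i x ord0 (lift ord0 i)).
Proof.
apply/rowP => i; case: (unliftP ord0 i) => [j ->|->].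
  by rewrite cons_rVES mxE.
by rewrite cons_rVE0.
Qed.

Lemma ge0_integral_rVS n (f : 'rV[R]_n.+1 -> \bar R) :
  measurable_fun setT f -> (forall x, 0 <= f x)%E ->
  (\int[lebesgue_rV R n.+1]_x f x =
   \int[leb]_t \int[lebesgue_rV R n]_v f (cons_rV (t, v)))%E.
Proof.
move=> mf f0.
rewrite (@ge0_integral_pushforward _ _ _ _ R _ (@measurable_cons_rV R n)
   (leb \x lebesgue_rV R n)%E setT f)//.
rewrite preimage_setT fubini_tonelli1//.
  by apply: measurableT_comp => //; exact: measurable_cons_rV.
by move=> x; exact: f0.
Qed.

Lemma integral_rV0 (f : 'rV[R]_0 -> \bar R) : measurable_fun setT f ->
  (\int[lebesgue_rV R 0]_x f x = f 0%R)%E.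
Proof. by move=> mf; rewrite [LHS]integral_dirac// diracT mul1e. Qed.

Lemma measurable_sub_cons n (f : 'rV[R]_n.+1 -> \bar R) t :
  measurable_fun setT f -> measurable_fun setT (fun v => f (cons_rV (t, v))).
Proof.
move=> mf; apply: measurableT_comp => //.
apply: (measurableT_comp (@measurable_cons_rV R n)).
exact: pair1_measurable.
Qed.

Lemma measurable_integral_cons n (f : 'rV[R]_n.+1 -> \bar R) :
  measurable_fun setT f -> (forall x, 0 <= f x)%E ->
  measurable_fun (setT : set (measurableTypeR R))
    (fun t => \int[lebesgue_rV R n]_v f (cons_rV (t, v)))%E.
Proof.
move=> mf f0.
apply: (@measurable_fun_fubini_tonelli_F _ _ _ _ _ (lebesgue_rV R n)
  (fun p => f (cons_rV p))) => //.
by apply: measurableT_comp => //; exact: measurable_cons_rV.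
Qed.

Lemma measurable_rVD d (T : measurableType d) n (f g : T -> 'rV[R]_n) :
  measurable_fun setT f -> measurable_fun setT g ->
  measurable_fun setT (fun x => f x + g x).
Proof.
move=> mf mg; apply: measurable_fun_rVP => i.
rewrite (_ : _ \o _ = fun x => (rV_coord i \o f) x + (rV_coord i \o g) x :> R);
  last by apply/funext => x; rewrite /= /rV_coord mxE.
by apply: measurable_funD; apply: measurableT_comp => //; exact: measurable_rV_coord.
Qed.

(** Lebesgue measure is determined by its values on half-open intervals, and there [a^-1] times its
    image under the affine map is computed directly. *)
Lemma lebesgue_measure_affine (a b : R) (A : set R) : 0 < a -> measurable A ->
  leb ((fun x => (x - b) / a) @^-1` A) = (a%:E * leb A)%E.
Proof.
move=> a0 mA.
pose phi : measurableTypeR R -> measurableTypeR R := fun x => (x - b) / a.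
have mphi : measurable_fun setT phi.
  by apply: measurable_funM => //; exact: measurable_funB.
pose c := NngNum (ltW (etrans (invr_gt0 a) a0)).
pose nu : {measure set (measurableTypeR R) -> \bar R} :=
  mscale c (pushforward leb phi).
have K : leb A = nu mphi A.
  apply: (@lebesgue_measure_unique R (nu mphi)) => //= _ [[x y]] _ <-.
  rewrite /mscale/= /pushforward.
  rewrite (_ : _ @^-1` _ = `]a * x + b, a * y + b]%classic); last first.
    apply/seteqP; split => z /=; rewrite !in_itv/= /phi ltr_pdivlMr// ler_pdivrMr//
      ltrBrDr lerBlDr ![_ * a]mulrC//.
  rewrite !lebesgue_measure_itv/= !lte_fin ltrD2r ltr_pM2l//.
  case: ifPn => _; last by rewrite mule0.
  by rewrite -!EFinB -EFinM; congr EFin; field; rewrite gt_eqF.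
rewrite K /nu /mscale/= /pushforward muleA -EFinM mulfV ?gt_eqF//.
by rewrite mul1e.
Qed.

Lemma ge0_integral_translation1 (b : R) (f : R -> \bar R) :
  measurable_fun (setT : set (measurableTypeR R)) f -> (forall x, 0 <= f x)%E ->
  (\int[leb]_x f (x + b)%R = \int[leb]_x f x)%E.
Proof.
move=> mf f0.
pose phi : measurableTypeR R -> measurableTypeR R := fun x => x + b.
have mphi : measurable_fun setT phi by exact: measurable_funD.
rewrite -(@ge0_integral_pushforward _ _ _ _ R _ mphi leb setT f)//.
apply: eq_measure_integral => //= A mA _.
rewrite /pushforward.
have := @lebesgue_measure_affine 1 (- b) A ltr01 mA.
rewrite mul1e => <-; congr (leb _).
by apply/seteqP; split => x /=; rewrite divr1 opprK.
Qed.

(** The iterated integral lets the first coordinate and the remaining ones be shifted separately. *)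
Lemma ge0_integral_translation n (h : 'rV[R]_n) (f : 'rV[R]_n -> \bar R) :
  measurable_fun setT f -> (forall x, 0 <= f x)%E ->
  (\int[lebesgue_rV R n]_x f (x + h)%R = \int[lebesgue_rV R n]_x f x)%E.
Proof.
elim: n h f => [|n IH] h f mf f0.
  by apply: eq_integral => x _; congr f; apply/rowP => -[].
have mfh : measurable_fun setT (fun x : 'rV[R]_n.+1 => f (x + h)).
  by apply: measurableT_comp => //; exact: measurable_rVD.
rewrite (ge0_integral_rVS mfh (fun x => f0 (x + h))) (ge0_integral_rVS mf f0).
have I0 (t : R) : (0 <= \int[lebesgue_rV R n]_v f (cons_rV (t, v)))%E by exact: integral_ge0.
rewrite -[RHS](ge0_integral_translation1 (h ord0 ord0) (measurable_integral_cons mf f0) I0).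
apply: eq_integral => t _.
rewrite -[RHS](IH (\row_i h ord0 (lift ord0 i)))//; last exact: measurable_sub_cons.
by apply: eq_integral => v _; rewrite cons_rVD -rV_consE.
Qed.

End integration_rV.

(** * The Prekopa-Leindler inequality *)

Section prekopa_leindler.
Variable R : realType.
Local Notation leb := (@lebesgue_measure R).

(** If all rays ending in [A] cut off less than [m], so do the rays ending at [u n], and continuity
    from below gives [leb A <= m]. The sequence [u] lets the unbounded case and that of an
    unattained supremum share this argument. *)
Lemma initial_segment_measure_seq (A : set R) (u : R^nat) (m : R) :
  measurable A -> nondecreasing_seq u -> (forall n, exists2 a, A a & u n <= a) ->
  (forall x, A x -> exists n, x <= u n) -> (m%:E < leb A)%E ->
  exists2 a, A a & (m%:E <= leb (A `&` `]-oo, a]))%E.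
Proof.
move=> mA ndu Au uA mlt; apply: contrapT => H.
have {}H a : A a -> (leb (A `&` `]-oo, a]) < m%:E)%E.
  by move=> Aa; rewrite ltNge; apply/negP => h; apply: H; exists a.
have mray (a : R) : measurable (A `&` `]-oo, a]).
  exact: measurableI.
have UA : \bigcup_n (A `&` `]-oo, u n]) = A.
  apply/seteqP; split => [x [n _ []]//|x Ax].
  by have [n xn] := uA _ Ax; exists n => //; split => //=; rewrite ?in_itv/=.
have cv : (leb (A `&` `]-oo, u n]) @[n --> \oo] --> leb A)%E.
  rewrite -[in X in _ --> X]UA; apply: (@nondecreasing_cvg_mu _ _ _ leb (fun n => A `&`
    `]-oo, u n])) => //.
  - by move=> n; exact: mray.
  - by rewrite UA.
  - move=> n k nk; apply/subsetPset => x [Ax /=]; rewrite ?in_itv/= => xn; split => //=.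
    by rewrite ?in_itv/= (le_trans xn)// ndu.
have : (leb A <= m%:E)%E.
  rewrite -(cvg_lim _ cv)//; apply: lime_le; first by apply/cvg_ex; exists (leb A).
  apply: nearW => n; have [a Aa una] := Au n.
  apply: le_trans (ltW (H _ Aa)); apply: le_measure; rewrite ?inE;
    [exact: mray|exact: mray|].
  by move=> x [Ax /=]; rewrite ?in_itv/= => xn; split => //=;
    rewrite ?in_itv/= (le_trans xn).
by rewrite leNgt mlt.
Qed.

(** The cut point has to belong to [A], since [brunn_minkowski1] adds it to the other set. A
    supremum that is attained cuts off nothing; otherwise [A] is exhausted from below by [n], or by
    [sup A - 1 / (n + 1)]. *)
Lemma initial_segment_measure (A : set R) (m : R) : measurable A -> A !=set0 ->
  (m%:E < leb A)%E -> exists2 a, A a & (m%:E <= leb (A `&` `]-oo, a]))%E.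
Proof.
move=> mA A0 mlt.
have [ubA|nubA] := pselect (has_ubound A); last first.
  apply: (@initial_segment_measure_seq A (fun n => n%:R)) => //.
  - by move=> n k nk; rewrite ler_nat.
  - move=> n; apply: contrapT => H; apply: nubA; exists n%:R => x Ax.
    by rewrite leNgt; apply/negP => nx; apply: H; exists x => //; exact: ltW.
  - move=> x _; exists (Num.truncn x).+1; exact/ltW/truncnS_gt.
have supA : has_sup A by split.
have [As|nAs] := pselect (A (sup A)).
  exists (sup A) => //; rewrite (_ : A `&` _ = A) ?ltW//.
  by apply/seteqP; split => x; [case|move=> Ax; split => //=; rewrite ?in_itv/=;
    exact: ub_le_sup].
apply: (@initial_segment_measure_seq A (fun n => sup A - n.+1%:R^-1)) => //.
- move=> n k nk; rewrite lerD2l lerN2 lef_pV2 ?posrE//; rewrite ler_nat ltnS//.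
- move=> n; have n0 : 0 < (n.+1%:R : R)^-1 by rewrite invr_gt0.
  have [a Aa sa] := sup_adherent n0 supA.
    by exists a => //; exact: ltW.
- move=> x Ax; have xs : x < sup A.
    by rewrite lt_neqAle ub_le_sup// andbT; apply: contra_notN nAs => /eqP <-.
  exists (Num.truncn (sup A - x)^-1); rewrite lerBrDr -lerBrDl.
  rewrite invf_ple ?posrE ?subr_gt0//; exact/ltW/truncnS_gt.
Qed.

Lemma final_segment_measure (A : set R) (m : R) : measurable A -> A !=set0 ->
  (m%:E < leb A)%E -> exists2 a, A a & (m%:E <= leb (A `&` `[a, +oo[))%E.
Proof.
move=> mA [a0 Aa0] mlt.
have mN (B : set R) : measurable B -> measurable (-%R @^-1` B).
  by move=> mB; rewrite -[X in measurable X]setTI; exact: oppr_measurable.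
have lN (B : set R) : measurable B -> leb (-%R @^-1` B) = leb B.
  by move=> mB; exact: lebesgue_measureN.
have [||a Aa ma] := @initial_segment_measure (-%R @^-1` A) m (mN _ mA).
- by exists (- a0); rewrite /= opprK.
- by rewrite lN.
exists (- a) => //; apply: (le_trans ma); rewrite -lN; last first.
  by apply: measurableI => //; exact: mN.
apply: le_measure; rewrite ?inE.
- by apply: (mN); apply: measurableI => //; exact: mN.
- exact: measurableI.
- move=> x [] /=; rewrite opprK => Ax; rewrite in_itv/= => xa.
  by split => //=; rewrite in_itv/= andbT lerNl.
Qed.

(** Reduces an inequality between possibly infinite measures to real numbers strictly below them. *)
Lemma lee_of_real_approx (t s : R) (a b c : \bar R) : 0 < t -> 0 < s ->
  (0 <= a)%E -> (0 <= b)%E -> (0 <= c)%E ->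
  (forall m n : R, (m%:E < a)%E -> (n%:E < b)%E -> ((t * m + s * n)%:E <= c)%E) ->
  (t%:E * a + s%:E * b <= c)%E.
Proof.
move=> t0 s0 a0 b0; case: c => [c _ H| _ _|//]; last by rewrite leey.
case: a a0 H => [a a0|a0|//] H; case: b b0 H => [b b0|b0|//] H.
- rewrite -!EFinM -EFinD lee_fin; apply/ler_addgt0Pl => e e0.
  have ets : 0 < e / (t + s) by rewrite divr_gt0// addr_gt0.
  have : t * (a - e / (t + s)) + s * (b - e / (t + s)) <= c.
    by rewrite -lee_fin; apply: H; rewrite lte_fin ltrBlDr ltrDl.
  rewrite (_ : t * _ + _ = t * a + s * b - e); first by rewrite lerBlDl.
  by field; rewrite gt_eqF// addr_gt0.
(* The real [-1] lies below any nonnegative quantity; the number below the infinite one is chosen to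
   make the left side equal to [c + 1]. *)
- exfalso; have : t * (-1) + s * ((c + 1 + t) / s) <= c.
    by rewrite -lee_fin; apply: H; rewrite ?ltry// (lt_le_trans _ a0)// lte_fin ltrN10.
  by rewrite [s * (_ / _)]mulrC divfK ?gt_eqF//; lra.
- exfalso; have : t * ((c + 1 + s) / t) + s * (-1) <= c.
    by rewrite -lee_fin; apply: H; rewrite ?ltry// (lt_le_trans _ b0)// lte_fin ltrN10.
  by rewrite mulrC divfK ?gt_eqF//; lra.
- exfalso; have : t * ((c + 1 + s) / t) + s * (-1) <= c.
    by rewrite -lee_fin; apply: H; rewrite ?ltry.
  by rewrite mulrC divfK ?gt_eqF//; lra.
Qed.

(** Cut [A] at the right end [a] and [B] at the left end [b]. Then [t * A1 + s * b] and
    [t * a + s * B1] lie in [C] on opposite sides of [c = t * a + s * b], so their measures add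
    up. *)
Lemma brunn_minkowski1 (t s : R) (A B C : set R) : 0 < t -> 0 < s ->
  measurable A -> measurable B -> measurable C -> A !=set0 -> B !=set0 ->
  (forall a b, A a -> B b -> C (t * a + s * b)) ->
  (t%:E * leb A + s%:E * leb B <= leb C)%E.
Proof.
move=> t0 s0 mA mB mC A0 B0 ABC.
apply: lee_of_real_approx => // m n mA' nB'.
have [a Aa ma] := initial_segment_measure mA A0 mA'.
have [b Bb nb] := final_segment_measure mB B0 nB'.
pose c := t * a + s * b.
pose A1 := A `&` `]-oo, a]; pose B1 := B `&` `[b, +oo[.
have mA1 : measurable A1.
  exact: measurableI.
have mB1 : measurable B1.
  exact: measurableI.
have mra (a' b' : R) (E : set R) : 0 < a' -> measurable E ->
    measurable ((fun x => (x - b') / a') @^-1` E).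
  move=> a'0 mE; rewrite -[X in measurable X]setTI.
  have mphi : measurable_fun setT (fun x : measurableTypeR R => ((x - b') / a' :
    measurableTypeR R)).
    by apply: measurable_funM => //; exact: measurable_funB.
  exact: mphi.
pose A2 := (fun x => (x - s * b) / t) @^-1` A1.
pose B2 := (fun x => (x - t * a) / s) @^-1` B1.
have mA2 : measurable A2 by exact: mra.
have mB2 : measurable B2 by exact: mra.
have A2C : A2 `<=` C `&` `]-oo, c].
  move=> x [/= Ax xa]; split.
    have := ABC _ _ Ax Bb; congr C; field; exact: lt0r_neq0.
  by move: xa => /=; rewrite ?in_itv/= ler_pdivrMr// lerBlDr /c mulrC.
have B2C : B2 `<=` C `&` `[c, +oo[.
  move=> x [/= Bx xa]; split.
    have := ABC _ _ Aa Bx; congr C; field; exact: lt0r_neq0.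
  by move: xa => /=; rewrite ?in_itv/= !andbT ler_pdivlMr// lerBrDr /c mulrC addrC.
have mc : measurable (C `&` `]-oo, c[).
  exact: measurableI.
have mc' : measurable (C `&` `[c, +oo[).
  exact: measurableI.
have -> : leb C = (leb (C `&` `]-oo, c[) + leb (C `&` `[c, +oo[))%E.
  rewrite -measureU//.
    congr (leb _); rewrite -setIUr (_ : _ `|` _ = setT) ?setIT//.
    by apply/seteqP; split => x // _ /=; rewrite ?in_itv/= andbT; case: (ltP x c) => /=;
      [left|right].
  by apply/seteqP; split => x //= [[_ /=]]; rewrite ?in_itv/= andbT => xc [_ cx];
    move: xc; rewrite ltNge cx.
rewrite EFinD; apply: leeD.
  (* [A2] may reach the point [c], which was given to the right half; adding this null point to the
     left half makes room for it. *)
  have -> : leb (C `&` `]-oo, c[) = leb ((C `&` `]-oo, c[) `|` [set c]).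
    by apply/esym/measureU0 => //; exact: lebesgue_measure_set1.
  apply: (@le_trans _ _ (leb A2)).
    by rewrite lebesgue_measure_affine// EFinM lee_pmul2l// lte_fin.
  apply: le_measure; rewrite ?inE//; first by apply: measurableU.
  move=> x /A2C[Cx /=]; rewrite ?in_itv/= le_eqVlt => /orP[/eqP ->|xc];
    [by right|by left; split => //=; rewrite ?in_itv].
apply: (@le_trans _ _ (leb B2)).
  by rewrite lebesgue_measure_affine// EFinM lee_pmul2l// lte_fin.
by apply: le_measure; rewrite ?inE.
Qed.

(** Tonelli for the region [0 <= tau < w x] under the graph, whose sections in one direction are
    intervals of length [w x] and in the other the level sets. *)
Lemma layer_cake (w : R -> \bar R) :
  measurable_fun (setT : set (measurableTypeR R)) w -> (forall x, 0 <= w x)%E ->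
  (\int[leb]_x w x = \int[leb]_(tau in `[0%R, +oo[) leb [set x | (tau%:E < w x)%E])%E.
Proof.
move=> mw w0.
pose S : set (measurableTypeR R * measurableTypeR R) :=
  [set p | 0 <= p.2 /\ (p.2%:E < w p.1)%E].
have mS : measurable S.
  rewrite (_ : S = (setT `&` [set p | (0%:E <= (p.2)%:E)%E]) `&` (setT `&` [set p |
    ((p.2)%:E < w p.1)%E])); last first.
    by rewrite !setTI; apply/seteqP; split => p /=; rewrite lee_fin.
  apply: measurableI.
    apply: measurable_lee => //.
    by apply/measurable_EFinP; exact: measurable_snd.
  apply: measurable_lte; first exact: measurableT.
    by apply/measurable_EFinP; exact: measurable_snd.
  by apply: (measurableT_comp mw); exact: measurable_fst.
pose f p : \bar R := (\1_S p)%:E.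
have mf : measurable_fun setT f by apply/measurable_EFinP; exact: measurable_indic.
have f0 p : (0 <= f p)%E by rewrite lee_fin.
have := @fubini_tonelli _ _ _ _ R leb leb f mf f0.
have -> : (\int[leb]_x fubini_F leb f x = \int[leb]_x w x)%E.
  apply: eq_integral => x _; rewrite /fubini_F /f.
  have mSx := @measurable_xsection _ _ _ _ _ x mS.
  have -> : (\int[leb]_y (\1_S (x, y))%:E = leb (xsection S x))%E.
    rewrite -[in RHS](setIT (xsection S x)) -integral_indic//.
    apply: eq_integral => y _; rewrite !indicE; congr (_%:R%:E).
    by rewrite mem_xsection.
  rewrite (_ : xsection S x = [set tau : R | 0 <= tau /\ (tau%:E < w x)%E]); last first.
    by apply/seteqP; split => y; rewrite /xsection/= inE.
  move: (w0 x); case: (w x) => [r|_|//]; last first.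
    rewrite (_ : mkset _ = `[0, +oo[%classic);
      first by rewrite lebesgue_measure_itv/= ltry.
    by apply/seteqP; split => y /=; rewrite in_itv/= andbT ltry; [case|move=> y0; split].
  rewrite lee_fin => r0.
  rewrite (_ : mkset _ = `[0, r[%classic).
    rewrite lebesgue_measure_itv/= lte_fin; case: ltP => [|r0'];
      first by rewrite oppr0 adde0.
    by congr EFin; apply/eqP; rewrite eq_le r0.
  by apply/seteqP; split => y /=; rewrite ?in_itv/= lte_fin => /andP.
move=> ->; rewrite [RHS]integral_mkcond; apply: eq_integral => tau _.
rewrite /fubini_G patchE mem_setE in_itv/= andbT; case: ifPn => tau0.
  have mStau := @measurable_ysection _ _ _ _ _ tau mS.
  rewrite (_ : [set x | _] = ysection S tau); last first.
    by apply/seteqP; split => y; rewrite /ysection/= inE//= => -[].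
  rewrite -[in RHS](setIT (ysection S tau)) -integral_indic//.
  apply: eq_integral => y _; rewrite /f !indicE; congr (_%:R%:E).
  by rewrite mem_ysection.
apply: integral0_eq => y _; rewrite /f indicE memNset//= => -[].
by move/negP : tau0.
Qed.

End prekopa_leindler.

Section prekopa_leindler.
Import HBSimple HBNNSimple.
Variable R : realType.
Local Notation leb := (@lebesgue_measure R).

Lemma weighted_amgm (t s p q : R) : 0 < t -> 0 < s -> t + s = 1 ->
  0 <= p -> 0 <= q -> p `^ t * q `^ s <= t * p + s * q.
Proof.
move=> t0 s0 ts p0 q0.
have := @conjugate_powR R (p `^ t) (q `^ s) t^-1 s^-1 (powR_ge0 _ _) (powR_ge0 _ _).
rewrite !invr_gt0 !invrK => /(_ t0 s0 ts).
rewrite -!powRrM !mulfV ?lt0r_neq0// !powRr1//.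
by rewrite (mulrC p) (mulrC q).
Qed.

(* The inequality [a ^ t * b ^ s <= c] for extended reals, without having to
   raise an infinite quantity to a power. *)
Definition geometric_mean_le (t s : R) (a b c : \bar R) :=
  forall p q : R, 0 <= p -> 0 <= q -> (p%:E < a)%E -> (q%:E < b)%E ->
    ((p `^ t * q `^ s)%:E <= c)%E.

(** Supplies bounded minorants with almost the same integral: [prekopa_leindler1] divides by
    suprema, which have to be finite. *)
Lemma lt_ge0_integral_simple d (T : measurableType d) (mu : {measure set T -> \bar R})
    (f : T -> \bar R) (p : \bar R) :
  (forall x, 0 <= f x)%E -> (p < \int[mu]_x f x)%E ->
  exists h : T -> R, exists M : R,
    [/\ measurable_fun setT h, (forall x, 0 <= h x <= M),
        (forall x, (h x)%:E <= f x)%E & (p < \int[mu]_x (h x)%:E)%E].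
Proof.
move=> f0; rewrite ge0_integralTE//= => /ereal_sup_gt[_ [h /= hf <-] ph].
have [M [_ hM]] := simple_bounded h.
exists h, (`|M| + 1); split => //.
- move=> x; rewrite fun_ge0/= (le_trans (ler_norm _))//.
  by apply: (hM (`|M| + 1)) => //; rewrite ltr_pwDr// ler_norm.
- by rewrite integralT_nnsfun.
Qed.

(** With [a] the supremum, the normalised function [u / a] has nonempty level sets at every height
    below [1], as [brunn_minkowski1] requires. *)
Lemma sup_level (u : R -> R) (M p : R) : (forall x, 0 <= u x <= M) -> 0 <= p ->
  (p%:E < \int[leb]_x (u x)%:E)%E ->
  exists a : R, [/\ 0 < a, (forall x, u x <= a) &
    forall tau : R, tau < 1 -> exists x, tau * a < u x].
Proof.
move=> uM p0 pu.
have su : has_sup (range u).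
  split; first by exists (u 0), 0.
  by exists M => _ [x _ <-]; case/andP: (uM x).
have ua x : u x <= sup (range u) by apply: ub_le_sup; [case: su|exists x].
have a0 : 0 < sup (range u).
  rewrite ltNge; apply/negP => a0; move: pu; rewrite integral0_eq ?lte_fin ?ltNge ?p0//.
  move=> x _; congr EFin; apply/eqP; rewrite eq_le (le_trans (ua x))//=.
  by case/andP: (uM x).
exists (sup (range u)); split => // tau tau1.
have e0 : 0 < (1 - tau) * sup (range u) by rewrite mulr_gt0// subr_gt0.
have [_ [x _ <-]] := sup_adherent e0 su.
by rewrite mulrBl mul1r opprB addrC subrK; exists x.
Qed.

(** After division of the two functions by their suprema [a], [b], and of [w] by
    [k = a ^ t * b ^ s], level sets at the same height are related as in [brunn_minkowski1].
    Integrating over the height bounds the arithmetic mean of the normalised integrals, and the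
    arithmetic-geometric inequality undoes the normalisation. *)
Lemma prekopa_leindler1 (t s : R) (u v w : R -> \bar R) :
  0 < t -> 0 < s -> t + s = 1 ->
  measurable_fun (setT : set (measurableTypeR R)) u ->
  measurable_fun (setT : set (measurableTypeR R)) v ->
  measurable_fun (setT : set (measurableTypeR R)) w ->
  (forall x, 0 <= u x)%E -> (forall x, 0 <= v x)%E -> (forall x, 0 <= w x)%E ->
  (forall x y, geometric_mean_le t s (u x) (v y) (w (t * x + s * y))) ->
  geometric_mean_le t s (\int[leb]_x u x) (\int[leb]_x v x) (\int[leb]_x w x).
Proof.
move=> t0 s0 ts mu mv mw u0 v0 w0 uvw p q p0 q0 pu qv.
have w'0 : (0 <= \int[leb]_x w x)%E by exact: integral_ge0.
have [p00|pn0] := eqVneq p 0; first by rewrite p00 powR0 ?mul0r ?lt0r_neq0.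
have [q00|qn0] := eqVneq q 0; first by rewrite q00 [X in _ * X]powR0 ?mulr0 ?lt0r_neq0.
have {pn0}p1 : 0 < p by rewrite lt0r pn0.
have {qn0}q1 : 0 < q by rewrite lt0r qn0.
have [f [M [mf fM fu pf]]] := @lt_ge0_integral_simple _ (measurableTypeR R) leb _ _ u0 pu.
have [g [N [mg gN gv qg]]] := @lt_ge0_integral_simple _ (measurableTypeR R) leb _ _ v0 qv.
have [a [a0 fa fta]] := sup_level fM p0 pf.
have [b [b0 gb gtb]] := sup_level gN q0 qg.
pose k := a `^ t * b `^ s.
have k0 : 0 < k by rewrite mulr_gt0// powR_gt0.
have fgw (tau : R) : 0 <= tau -> tau < 1 -> forall x y : R, tau < a^-1 * f x -> tau <
  b^-1 * g y ->
    (tau%:E < k^-1%:E * w (t * x + s * y)%R)%E.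
  move=> tau0 tau1 x y; rewrite ltr_pdivlMl// ltr_pdivlMl// => fx gy.
  (* A height strictly between: [geometric_mean_le] asks for strict inequalities, gives back a weak
     one, and the level set of [w] is strict. *)
  pose tau' : R := (tau + Num.min (a^-1 * f x) (b^-1 * g y)) / 2.
  have h : tau < Num.min (a^-1 * f x) (b^-1 * g y).
    by rewrite lt_min !ltr_pdivlMl// fx.
  have tt' : tau < tau' by rewrite /tau'; lra.
  have t'0 : 0 <= tau' by rewrite ltW// (le_lt_trans tau0).
  have t'm : tau' < Num.min (a^-1 * f x) (b^-1 * g y) by rewrite /tau'; lra.
  move: t'm; rewrite lt_min !ltr_pdivlMl// => /andP[t'f t'g].
  have h1 : ((a * tau')%:E < u x)%E by rewrite (lt_le_trans _ (fu x))// lte_fin.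
  have h2 : ((b * tau')%:E < v y)%E by rewrite (lt_le_trans _ (gv y))// lte_fin.
  have := uvw x y _ _ (mulr_ge0 (ltW a0) t'0) (mulr_ge0 (ltW b0) t'0) h1 h2.
  have -> : (a * tau') `^ t * (b * tau') `^ s = k * tau'.
    rewrite (powRM _ (ltW a0) t'0) (powRM _ (ltW b0) t'0) mulrACA -powRD ?ts ?powRr1//.
    by rewrite oner_eq0 implyFb.
  move: (w0 (t * x + s * y)); case: (w _) => [r|_ _|//].
    rewrite -EFinM lte_fin !lee_fin => _ kr; apply: (lt_le_trans tt').
    by rewrite ler_pdivlMl.
  by rewrite gt0_muley ?ltry// lte_fin invr_gt0.
have mf1 : measurable_fun (setT : set (measurableTypeR R)) (fun x => (a^-1 * f x)%:E).
  by apply/measurable_EFinP; exact: measurable_funM.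
have mg1 : measurable_fun (setT : set (measurableTypeR R)) (fun x => (b^-1 * g x)%:E).
  by apply/measurable_EFinP; exact: measurable_funM.
have mw1 : measurable_fun (setT : set (measurableTypeR R)) (fun x => k^-1%:E * w x)%E.
  exact: emeasurable_funM.
have f10 x : (0 <= (a^-1 * f x)%:E)%E.
  by rewrite lee_fin mulr_ge0 ?invr_ge0 ?(ltW a0)//; case/andP: (fM x).
have g10 x : (0 <= (b^-1 * g x)%:E)%E.
  by rewrite lee_fin mulr_ge0 ?invr_ge0 ?(ltW b0)//; case/andP: (gN x).
have w10 x : (0 <= k^-1%:E * w x)%E by rewrite mule_ge0// lee_fin invr_ge0 ltW.
have mlev (h : R -> \bar R) : measurable_fun (setT : set (measurableTypeR R)) h ->
    forall tau : R, measurable [set x | (tau%:E < h x)%E].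
  by move=> mh tau; have := emeasurable_fun_o_infty measurableT mh tau%:E; rewrite setTI.
have mlevel (h : R -> \bar R) : measurable_fun (setT : set (measurableTypeR R)) h ->
    measurable_fun (`[0%R, +oo[%classic : set (measurableTypeR R)) (fun tau : R => leb
      [set x | (tau%:E < h x)%E]).
  move=> mh.
  have mS : measurable [set p : measurableTypeR R * measurableTypeR R | (p.2%:E < h
    p.1)%E].
    rewrite -[X in measurable X]setTI; apply: measurable_lte; first exact: measurableT.
      by apply/measurable_EFinP; exact: measurable_snd.
    by apply: (measurableT_comp mh); exact: measurable_fst.
  apply: (@measurable_funS _ _ _ _ setT) => //.
  have := measurable_fun_ysection leb mS; congr measurable_fun.
  apply/funext => tau /=; congr (leb _).
  by apply/seteqP; split => y; rewrite /ysection/= inE.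
have key : (t%:E * \int[leb]_x (a^-1 * f x)%:E + s%:E * \int[leb]_x (b^-1 * g x)%:E <=
    \int[leb]_x (k^-1%:E * w x))%E.
  rewrite !layer_cake//.
  rewrite -!ge0_integralZl_EFin ?(ltW t0) ?(ltW s0)//; [|exact: mlevel|exact: mlevel].
  rewrite -ge0_integralD//; last 4 first.
  - by move=> x _; rewrite mule_ge0// lee_fin ltW.
  - by apply: emeasurable_funM => //; exact: mlevel.
  - by move=> x _; rewrite mule_ge0// lee_fin ltW.
  - by apply: emeasurable_funM => //; exact: mlevel.
  apply: ge0_le_integral => //.
  - by move=> x _; rewrite adde_ge0// mule_ge0// lee_fin ltW.
  - by apply: emeasurable_funD; apply: emeasurable_funM => //; exact: mlevel.
  - exact: mlevel.
  move=> tau /=; rewrite in_itv/= andbT => tau0.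
  (* From height [1] on, the level sets of the normalised [f] and [g] are empty; below it they are
     not. *)
  have [tau1|tau1] := ltP tau 1; last first.
    rewrite (_ : [set x | _] = set0) ?measure0; last first.
      apply/seteqP; split => x //=; rewrite lte_fin ltr_pdivlMl// ltNge.
      by rewrite (le_trans (fa x))// ler_peMr ?(ltW a0).
    rewrite (_ : [set x | (_ < (_ * g _)%:E)%E] = set0) ?measure0; last first.
      apply/seteqP; split => x //=; rewrite lte_fin ltr_pdivlMl// ltNge.
      by rewrite (le_trans (gb x))// ler_peMr ?(ltW b0).
    by rewrite !mule0 adde0.
  apply: brunn_minkowski1 => //; try exact: mlev.
  - by have [x fx] := fta _ tau1; exists x => /=; rewrite lte_fin ltr_pdivlMl// mulrC.
  - by have [x fx] := gtb _ tau1; exists x => /=; rewrite lte_fin ltr_pdivlMl// mulrC.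
  - by move=> x y /=; rewrite !lte_fin; exact: fgw.
have mf' : measurable_fun (setT : set (measurableTypeR R)) (fun x => (f x)%:E).
  exact/measurable_EFinP.
have mg' : measurable_fun (setT : set (measurableTypeR R)) (fun x => (g x)%:E).
  exact/measurable_EFinP.
have : ((t * (a^-1 * p) + s * (b^-1 * q))%:E <= k^-1%:E * \int[leb]_x w x)%E.
  rewrite -ge0_integralZl_EFin// ?invr_ge0 ?(ltW k0)//.
  apply: le_trans key; rewrite EFinD; apply: leeD.
    rewrite EFinM lee_pmul2l// ?lte_fin//.
    under eq_integral do rewrite EFinM.
    rewrite ge0_integralZl_EFin//; last 2 first.
    - by move=> x _; rewrite lee_fin; case/andP: (fM x).
    - by rewrite invr_ge0 ltW.
    by rewrite EFinM lee_pmul2l// ?lte_fin ?invr_gt0// ltW.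
  rewrite EFinM lee_pmul2l// ?lte_fin//.
  under eq_integral do rewrite EFinM.
  rewrite ge0_integralZl_EFin//; last 2 first.
  - by move=> x _; rewrite lee_fin; case/andP: (gN x).
  - by rewrite invr_ge0 ltW.
  by rewrite EFinM lee_pmul2l// ?lte_fin ?invr_gt0// ltW.
have amgm : p `^ t * q `^ s <= k * (t * (a^-1 * p) + s * (b^-1 * q)).
  apply: le_trans (_ : k * ((a^-1 * p) `^ t * (b^-1 * q) `^ s) <= _).
    rewrite /k mulrACA -!powRM ?(ltW a0) ?(ltW b0) ?mulr_ge0 ?invr_ge0 ?(ltW a0) ?(ltW
      b0)//.
    by rewrite !mulrA !mulfV ?lt0r_neq0// !mul1r.
  rewrite ler_pM2l//; apply: weighted_amgm => //.
    by rewrite mulr_ge0// invr_ge0 ltW.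
  by rewrite mulr_ge0// invr_ge0 ltW.
move: w'0; case: (\int[leb]_x w x)%E => [r|_ _|//]; last by rewrite leey.
rewrite !lee_fin => _ h; apply: (le_trans amgm).
by rewrite -ler_pdivlMl.
Qed.

(** For fixed first coordinates, the inequality for the slices is the hypothesis of the
    one-dimensional inequality for the marginals. In dimension [0] the integral is an evaluation. *)
Lemma prekopa_leindler n (t s : R) (u v w : 'rV[R]_n -> \bar R) :
  0 < t -> 0 < s -> t + s = 1 ->
  measurable_fun setT u -> measurable_fun setT v -> measurable_fun setT w ->
  (forall x, 0 <= u x)%E -> (forall x, 0 <= v x)%E -> (forall x, 0 <= w x)%E ->
  (forall x y, geometric_mean_le t s (u x) (v y) (w (t *: x + s *: y))) ->
  geometric_mean_le t s (\int[lebesgue_rV R n]_x u x) (\int[lebesgue_rV R n]_x v x)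
    (\int[lebesgue_rV R n]_x w x).
Proof.
move=> t0 s0 ts; elim: n u v w => [|n IH] u v w mu mv mw u0 v0 w0 uvw.
  rewrite !integral_rV0//; have := uvw 0 0; congr (geometric_mean_le t s _ _ (w _)).
  by rewrite !scaler0 addr0.
rewrite !ge0_integral_rVS//; apply: prekopa_leindler1 => //.
- exact: measurable_integral_cons.
- exact: measurable_integral_cons.
- exact: measurable_integral_cons.
- by move=> x; exact: integral_ge0.
- by move=> x; exact: integral_ge0.
- by move=> x; exact: integral_ge0.
move=> x y; apply: IH.
- exact: measurable_sub_cons.
- exact: measurable_sub_cons.
- exact: measurable_sub_cons.
- by [].
- by [].
- by [].
by move=> x' y'; rewrite cons_rV_lin; exact: uvw.
Qed.

End prekopa_leindler.

(** * Strongly log-concave measures *)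

Section bounded_integrals.
Context d (T : measurableType d) (R : realType).

Lemma bounded_integrable (P : {finite_measure set T -> \bar R}) (f : T -> R) (M : R) :
  measurable_fun setT f -> (forall x, `|f x| <= M) ->
  P.-integrable setT (EFin \o f).
Proof.
move=> mf fM; apply: measurable_bounded_integrable => //.
- by rewrite ltey_eq fin_num_measure.
- by exists M; split; [exact: num_real|move=> y My x _;
  exact: (le_trans (fM x) (ltW My))].
Qed.

Lemma integrable_EFinD (mu : {measure set T -> \bar R}) (f g : T -> R) :
  mu.-integrable setT (EFin \o f) -> mu.-integrable setT (EFin \o g) ->
  mu.-integrable setT (EFin \o (fun x => f x + g x)).
Proof. by move=> fi gi; exact: (integrableD _ fi gi). Qed.

Lemma integrable_EFinB (mu : {measure set T -> \bar R}) (f g : T -> R) :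
  mu.-integrable setT (EFin \o f) -> mu.-integrable setT (EFin \o g) ->
  mu.-integrable setT (EFin \o (fun x => f x - g x)).
Proof. by move=> fi gi; exact: (integrableB _ fi gi). Qed.

Lemma integrable_EFinZ (mu : {measure set T -> \bar R}) (k : R) (f : T -> R) :
  mu.-integrable setT (EFin \o f) ->
  mu.-integrable setT (EFin \o (fun x => k * f x)).
Proof. by move=> fi; exact: (integrableZl _ k fi). Qed.

Lemma EFin_Rintegral (mu : {measure set T -> \bar R}) (f : T -> R) :
  mu.-integrable setT (EFin \o f) ->
  ((\int[mu]_x f x)%:E = \int[mu]_x (f x)%:E)%E.
Proof. by move=> fi; rewrite /Rintegral fineK// integrable_fin_num. Qed.

(** [rho] has the same integrals as the Radon-Nikodym derivative, hence equals it almost everywhere,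
    and the change of variables for the latter applies. *)
Lemma integral_density (P : {finite_measure set T -> \bar R})
    (mu : {sigma_finite_measure set T -> \bar R}) (rho F : T -> \bar R) :
  measurable_fun setT rho -> (forall x, 0 <= rho x)%E ->
  (forall A, measurable A -> P A = \int[mu]_(x in A) rho x)%E ->
  measurable_fun setT F -> (forall x, 0 <= F x)%E ->
  (\int[P]_x F x = \int[mu]_x (F x * rho x))%E.
Proof.
move=> mrho rho0 PE mF F0.
have Pmu : P `<< mu.
  apply/null_content_dominatesP => A mA muA.
  by rewrite PE// null_set_integral//; exact: measurable_funTS.
have RNi := Radon_Nikodym_SigmaFinite.f_integrable Pmu.
have mRN : measurable_fun setT (Radon_Nikodym_SigmaFinite.f P mu).
  exact: measurable_int RNi.
rewrite -(Radon_Nikodym_SigmaFinite.change_of_variables Pmu)//.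
apply: ge0_ae_eq_integral => //.
- exact: emeasurable_funM.
- exact: emeasurable_funM.
- by move=> x _; rewrite mule_ge0// Radon_Nikodym_SigmaFinite.f_ge0.
- by move=> x _; rewrite mule_ge0.
have : ae_eq mu setT (Radon_Nikodym_SigmaFinite.f P mu) rho.
  apply: integral_ae_eq => // E _ mE.
  by rewrite -Radon_Nikodym_SigmaFinite.f_integral// PE.
by apply: filterS => x /(_ I) E _; rewrite E.
Qed.

End bounded_integrals.

(** * Entropy from a power-mean inequality *)

Section entropy.
Context d (T : measurableType d) (R : realType) (P : probability T R).
Local Notation "\E f" := (Rintegral P setT f) (at level 10).

Lemma Rintegral_prob_cst (c : R) : \E (fun=> c) = c.
Proof. by rewrite Rintegral_cst//= [X in fine X](@probability_setT _ _ _ P) mulr1. Qed.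

Lemma expR_le_linear (y : R) : 0 <= y <= 1 / 3 -> expR y <= 1 + 3 / 2 * y.
Proof.
move=> /andP[y0 y1]; have := expR_ge1Dx (- y); rewrite expRN => h.
have y2 : 0 < 1 - y by lra.
have : expR y <= (1 - y)^-1.
  by rewrite -[expR _]invrK lef_pV2// ?posrE// invr_gt0 expR_gt0.
move=> /le_trans; apply; rewrite -[_^-1]mul1r ler_pdivrMr//; nra.
Qed.

Lemma measurable_bounded_expR (g : T -> R) (M : R) : measurable_fun setT g ->
  (forall x, `|g x| <= M) -> P.-integrable setT (EFin \o (fun x => expR (g x))).
Proof.
move=> mg gM; apply: (@bounded_integrable _ _ _ _ _ (expR M)).
  exact: (measurableT_comp (@measurable_expR R)).
by move=> x; rewrite ger0_norm ?expR_ge0// ler_expR (le_trans (ler_norm _)).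
Qed.

(** A comparison at first order in [s]: both sides of the hypothesis equal the mean [m] of [exp g]
    up to terms of order [s], the entropy being the coefficient on the left. Convexity bounds the
    left side from below by its expansion, and smallness of [q] bounds the right side from above. *)
Lemma entropy_le_of_power_mean (s M : R) (g q : T -> R) :
  0 < s -> s < 1 -> measurable_fun setT g -> measurable_fun setT q ->
  (forall x, `|g x| <= M) -> (forall x, 0 <= q x <= 1 / 3) ->
  (\E (fun x => expR (g x / (1 - s)))) `^ (1 - s) <=
    \E (fun x => expR (g x + q x)) ->
  s * (\E (fun x => expR (g x) * g x) -
       \E (fun x => expR (g x)) * ln (\E (fun x => expR (g x)))) <=
  3 / 2 * \E (fun x => expR (g x) * q x).
Proof.
move=> s0 s1 mg mq gM q13 H.
set t := 1 - s in H *; have t0 : 0 < t by rewrite /t subr_gt0.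
have mX : measurable_fun setT (fun x => expR (g x)).
  exact: (measurableT_comp (@measurable_expR R)).
have iX := measurable_bounded_expR mg gM.
have XM x : expR (g x) <= expR M by rewrite ler_expR (le_trans (ler_norm _)).
have iXg : P.-integrable setT (EFin \o (fun x => expR (g x) * g x)).
  apply: (@bounded_integrable _ _ _ _ _ (expR M * M)); first exact: measurable_funM.
  by move=> x; rewrite normrM ler_pM// ger0_norm ?expR_ge0.
have iXq : P.-integrable setT (EFin \o (fun x => expR (g x) * q x)).
  apply: (@bounded_integrable _ _ _ _ _ (expR M * (1/3))); first exact: measurable_funM.
  move=> x; have /andP[q0 q1] := q13 x.
  by rewrite normrM ler_pM// ger0_norm ?expR_ge0.
have iXt : P.-integrable setT (EFin \o (fun x => expR (g x / t))).
  apply: (@measurable_bounded_expR _ (M / t)); first exact: measurable_funM.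
  by move=> x; rewrite normrM (gtr0_norm (_ : 0 < t^-1)) ?invr_gt0// ler_pM2r ?invr_gt0.
have iXpq : P.-integrable setT (EFin \o (fun x => expR (g x + q x))).
  apply: (@measurable_bounded_expR _ (M + 1 / 3)); first exact: measurable_funD.
  move=> x; have /andP[q0 q1] := q13 x.
  by rewrite (le_trans (ler_normD _ _))// lerD// ger0_norm.
set m := \E (fun x => expR (g x)); set E := \E (fun x => expR (g x) * g x).
have m0 : 0 < m.
  apply: (@lt_le_trans _ _ (expR (- M))); first exact: expR_gt0.
  rewrite -(Rintegral_prob_cst (expR (-M))); apply: le_Rintegral => //.
    exact: finite_measure_integrable_cst.
  by move=> x _; rewrite ler_expR lerNl (le_trans _ (gM x))// -normrN ler_norm.
(* Since [1 / t = 1 + eta], the bound [J] is Jensen's inequality for [exp (eta * g)] under the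
   probability proportional to [exp g]; it is proved with the tangent of the exponential at the mean
   [y0]. *)
pose eta := s / t.
pose y0 := eta * (E / m).
have J : m * expR y0 <= \E (fun x => expR (g x / t)).
  have -> : m * expR y0 = \E (fun x => expR y0 * ((1 - y0) * expR (g x) + eta * (expR (g
    x) * g x))).
    rewrite RintegralZl//; last first.
      by apply: integrable_EFinD => //; apply: integrable_EFinZ.
    rewrite RintegralD//; try exact: integrable_EFinZ.
    rewrite !RintegralZl// -/m -/E mulrC /y0; congr (_ * _).
    by field; rewrite lt0r_neq0.
  apply: le_Rintegral => //.
    apply: integrable_EFinZ => //.
    by apply: integrable_EFinD => //; apply: integrable_EFinZ.
  move=> x _.
  have -> : g x / t = y0 + g x + (eta * g x - y0).
    rewrite /eta /t; field; rewrite subr_eq0 gt_eqF//.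
  rewrite !expRD -mulrA ler_pM2l ?expR_gt0//.
  rewrite (_ : _ + _ = expR (g x) * (1 + (eta * g x - y0))); last by ring.
  by rewrite -expRD ler_pM2l ?expR_gt0// expR_ge1Dx.
have W : \E (fun x => expR (g x + q x)) <= m + 3 / 2 * \E (fun x => expR (g x) * q x).
  rewrite -RintegralZl// -RintegralD//; last exact: integrable_EFinZ.
  apply: le_Rintegral => //.
    by apply: integrable_EFinD => //; apply: integrable_EFinZ.
  move=> x _; have /andP[q0 q1] := q13 x.
  rewrite expRD (_ : _ + _ = expR (g x) * (1 + 3 / 2 * q x)); last by ring.
  rewrite ler_pM2l ?expR_gt0//.
  exact: expR_le_linear.
(* Raising [J] to the power [t] turns the right side into [m * exp (s * (E / m - ln m))], and
   [1 + y <= exp y] linearises it. *)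
have B : m + s * (E - m * ln m) <= (\E (fun x => expR (g x / t))) `^ t.
  apply: (@le_trans _ _ ((m * expR y0) `^ t)); last first.
    have my0 : 0 <= m * expR y0 by apply: mulr_ge0; [exact: ltW|exact: expR_ge0].
    apply: ge0_ler_powR; [exact: ltW|by rewrite nnegrE| |exact: J].
    by rewrite nnegrE; exact: le_trans J.
  rewrite powRM ?expR_ge0 ?(ltW m0)//.
  have -> : m `^ t * expR y0 `^ t = m * expR (s * (E / m - ln m)).
    rewrite -expRM /powR gt_eqF// -{2}(lnK (_ : m \is Num.pos)) ?posrE//.
    by rewrite -!expRD; congr expR; rewrite /y0 /eta /t; field; rewrite subr_eq0 !gt_eqF.
  apply: (@le_trans _ _ (m * (1 + s * (E / m - ln m)))).
    by rewrite le_eqVlt; apply/orP; left; apply/eqP; field; rewrite lt0r_neq0.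
  by rewrite ler_pM2l// expR_ge1Dx.
rewrite -(lerD2l m); exact: (le_trans B (le_trans H W)).
Qed.

End entropy.

Section dotp.
Variables (R : realType) (n : nat).
Implicit Types x y z : 'rV[R]_n.

Lemma dotpC x y : dotp x y = dotp y x.
Proof. by apply: eq_bigr => i _; rewrite mulrC. Qed.

Lemma dotpDl x y z : dotp (x + y) z = dotp x z + dotp y z.
Proof. by rewrite -big_split; apply: eq_bigr => i _; rewrite mxE mulrDl. Qed.

Lemma dotpZl (a : R) x y : dotp (a *: x) y = a * dotp x y.
Proof. by rewrite mulr_sumr; apply: eq_bigr => i _; rewrite mxE mulrA. Qed.

Lemma dotpDr x y z : dotp z (x + y) = dotp z x + dotp z y.
Proof. by rewrite dotpC dotpDl !(dotpC z). Qed.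

Lemma dotpZr (a : R) x y : dotp x (a *: y) = a * dotp x y.
Proof. by rewrite dotpC dotpZl dotpC. Qed.

Lemma dotpNl x y : dotp (- x) y = - dotp x y.
Proof. by rewrite -scaleN1r dotpZl mulN1r. Qed.

Lemma dotpNr x y : dotp x (- y) = - dotp x y.
Proof. by rewrite dotpC dotpNl dotpC. Qed.

Lemma dotp_ge0 x : 0 <= dotp x x.
Proof. by apply: sumr_ge0 => i _; rewrite -expr2 sqr_ge0. Qed.

Lemma sqr_enorm x : enorm x ^+ 2 = dotp x x.
Proof. by rewrite /enorm sqr_sqrtr// dotp_ge0. Qed.

Lemma enorm_ge0 x : 0 <= enorm x. Proof. exact: sqrtr_ge0. Qed.

Lemma dotp_young (c : R) x y : 0 < c ->
  dotp x y <= c * dotp x x + (4 * c)^-1 * dotp y y.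
Proof.
move=> c0; have := dotp_ge0 ((2 * c) *: x - y).
rewrite !(dotpDl, dotpDr, dotpZl, dotpZr, dotpNl, dotpNr) (dotpC y x) => h.
rewrite -(ler_pM2l (_ : 0 < 4 * c)); last by rewrite mulr_gt0.
rewrite mulrDr mulrA mulVKf ?mulf_neq0 ?gt_eqF//.
by nra.
Qed.

Lemma dotp_cauchy x y : `|dotp x y| <= enorm x * enorm y.
Proof.
rewrite -(@ler_pXn2r _ 2)// ?nnegrE ?mulr_ge0 ?enorm_ge0//.
rewrite exprMn !sqr_enorm -normrX ger0_norm ?sqr_ge0//.
have [y0|y0] := eqVneq (dotp y y) 0; last first.
  have := dotp_ge0 (dotp y y *: x - dotp x y *: y).
  rewrite !(dotpDl, dotpDr, dotpZl, dotpZr, dotpNl, dotpNr) (dotpC y x) => h.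
  have yp : 0 < dotp y y by rewrite lt0r y0 dotp_ge0.
  rewrite -(ler_pM2l yp); nra.
rewrite (_ : dotp x y = 0); first by rewrite expr0n/= mulr_ge0// dotp_ge0.
rewrite /dotp big1// => i _.
have : y ord0 i * y ord0 i == 0.
  have /eqP := y0; rewrite /dotp psumr_eq0; last by move=> j _; rewrite -expr2 sqr_ge0.
  by move=> /allP/(_ i (mem_index_enum _)).
by rewrite mulf_eq0 orbb => /eqP ->; rewrite mulr0.
Qed.

Lemma enormD x y : enorm (x + y) <= enorm x + enorm y.
Proof.
rewrite -(@ler_pXn2r _ 2)// ?nnegrE ?addr_ge0 ?enorm_ge0//.
rewrite sqrrD !sqr_enorm dotpDl !dotpDr (dotpC y x).
have := le_trans (ler_norm _) (dotp_cauchy x y); lra.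
Qed.

Lemma enormN x : enorm (- x) = enorm x.
Proof. by rewrite /enorm dotpNl dotpNr opprK. Qed.

Lemma measurable_dotp d (T : measurableType d) (f g : T -> 'rV[R]_n) :
  measurable_fun setT f -> measurable_fun setT g ->
  measurable_fun setT (fun t : T => dotp (f t) (g t)).
Proof.
move=> mf mg; apply: measurable_sum => i; apply: measurable_funM.
  exact: (measurableT_comp (@measurable_rV_coord R n i) mf).
exact: (measurableT_comp (@measurable_rV_coord R n i) mg).
Qed.

End dotp.

Section strongly_convex.
Variable R : realType.

Lemma geometric_mean_le_fin (t s a b c : R) : 0 < t -> 0 < s ->
  a `^ t * b `^ s <= c -> geometric_mean_le t s a%:E b%:E c%:E.
Proof.
move=> t0 s0 abc p q p0 q0; rewrite !lte_fin lee_fin => pa qb.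
apply: le_trans abc; apply: ler_pM; rewrite ?powR_ge0//.
  by rewrite ge0_ler_powR ?nnegrE ?(ltW t0) ?(ltW pa)// (le_trans p0) ?ltW.
by rewrite ge0_ler_powR ?nnegrE ?(ltW s0) ?(ltW qb)// (le_trans q0) ?ltW.
Qed.

(** The strict inequalities in the hypothesis are met by [th * a] and [th * b] with [th < 1]. The
    choice [th = (c + k) / (2 * k)] makes [th * k] the midpoint of [c] and [k], which exceeds [c] if
    [c < k]. *)
Lemma geometric_mean_le_finP (t s a b c : R) : 0 < t -> 0 < s -> t + s = 1 ->
  0 < a -> 0 < b -> geometric_mean_le t s a%:E b%:E c%:E ->
  a `^ t * b `^ s <= c.
Proof.
move=> t0 s0 ts a0 b0 H; rewrite leNgt; apply/negP; set k := _ * _ => ck.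
have k0 : 0 < k by rewrite mulr_gt0// powR_gt0.
have c0 : 0 <= c.
  have := H 0 0 (lexx _) (lexx _); rewrite !lte_fin lee_fin => /(_ a0 b0).
  by rewrite powR0 ?mul0r// lt0r_neq0.
pose th := (c + k) / (2 * k).
have th0 : 0 < th by apply: divr_gt0; [exact: ltr_wpDl|rewrite mulr_gt0].
have k2 : 0 < 2 * k by rewrite mulr_gt0.
have th1 : th < 1 by rewrite /th ltr_pdivrMr// mul1r; lra.
have := H _ _ (mulr_ge0 (ltW th0) (ltW a0)) (mulr_ge0 (ltW th0) (ltW b0)).
rewrite !lte_fin lee_fin !gtr_pMl// => /(_ th1 th1).
rewrite (powRM _ (ltW th0) (ltW a0)) (powRM _ (ltW th0) (ltW b0)) mulrACA.
rewrite -powRD ?ts ?oner_eq0 ?implyFb// powRr1 ?(ltW th0)// -/k.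
have -> : th * k = (c + k) / 2 by rewrite /th; field; rewrite gt_eqF.
lra.
Qed.

Definition strongly_convex n (K : R) (V : 'rV[R]_n -> R) :=
  forall t s x y, 0 < t -> 0 < s -> t + s = 1 ->
    K / 2 * (t * s) * dotp (x - y) (x - y) <=
    t * V x + s * V y - V (t *: x + s *: y).

(* Bobkov-Ledoux: the Prekopa-Leindler inequality is applied to
   [exp (g / t - V)] and [exp (- V)] with [t = 1 - s], for a small fixed [s]. *)
Lemma tilted_power_mean n (P : probability 'rV[R]_n R) (V g : 'rV[R]_n -> R)
    (G : 'rV[R]_n -> 'rV[R]_n) (K L M B s : R) :
  0 < K -> 0 <= L -> 0 < s -> s < 1 -> s * (K / 2 + L) <= K / 8 ->
  measurable_fun setT V -> strongly_convex K V ->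
  (forall A, measurable A -> P A = (\int[lebesgue_rV R n]_(x in A) (expR (- V x))%:E)%E)
    ->
  measurable_fun setT g -> measurable_fun setT G ->
  (forall x, `|g x| <= M) -> (forall x, dotp (G x) (G x) <= B) ->
  (forall z h, g (z + h) <= g z + dotp (G z) h + L * dotp h h) ->
  (\int[P]_x expR (g x / (1 - s))) `^ (1 - s) <=
    \int[P]_x expR (g x + s * (2 / (3 * K)) * dotp (G x) (G x)).
Proof.
move=> K0 L0 s0 s1 sK mV cV PE mg mG gM GB gG.
set t := 1 - s; have t0 : 0 < t by rewrite subr_gt0.
have ts : t + s = 1 by rewrite /t subrK.
(* The weight of Young's inequality. It spends [(4 * a)^-1 = 3 * K / 8] of the convexity [K / 2],
   and the remaining [K / 8] pays for the terms of order [s ^ 2]. In the end [3 / 2 * a = 1 / K]. *)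
pose a := 2 / (3 * K); have a0 : 0 < a by rewrite divr_gt0// mulr_gt0.
pose q := fun x : 'rV[R]_n => expR (g x + s * a * dotp (G x) (G x)).
have sa0 : 0 < s * a by exact: mulr_gt0.
rewrite -/a -[leRHS]/(Rintegral P setT q).
have mQ : measurable_fun setT (fun x => dotp (G x) (G x)) by exact: measurable_dotp.
have mV' : measurable_fun setT (fun x => (expR (- V x))%:E).
  apply/measurable_EFinP; apply: (measurableT_comp (@measurable_expR R)).
  exact: measurable_funN.
have mgt : measurable_fun setT (fun x => g x / t) by exact: measurable_funM.
have mgq : measurable_fun setT (fun x => g x + s * a * dotp (G x) (G x)).
  by apply: measurable_funD => //; exact: measurable_funM.
have i1 : P.-integrable setT (EFin \o (fun x => expR (g x / t))).
  apply: (@measurable_bounded_expR _ _ _ _ _ (M / t)) => //.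
  by move=> x; rewrite normrM (gtr0_norm (_ : 0 < t^-1)) ?invr_gt0// ler_pM2r ?invr_gt0.
have i2 : P.-integrable setT (EFin \o q).
  apply: (@measurable_bounded_expR _ _ _ _ _ (M + s * a * B)) => //.
  move=> x; rewrite (le_trans (ler_normD _ _))// lerD//.
  rewrite ger0_norm; last exact: (mulr_ge0 (ltW sa0) (dotp_ge0 _)).
  exact: (ler_wpM2l (ltW sa0)).

have dens (F : 'rV[R]_n -> R) : measurable_fun setT F ->
    (\int[P]_x (expR (F x))%:E = \int[lebesgue_rV R n]_x ((expR (F x))%:E * (expR (- V
      x))%:E))%E.
  move=> mF; apply: (integral_density mV') => //.
  by apply/measurable_EFinP; exact: (measurableT_comp (@measurable_expR R)).
have := @prekopa_leindler R n t s
  (fun x => (expR (g x / t))%:E * (expR (- V x))%:E)%E (fun x => (expR (- V x))%:E)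
  (fun x => (q x)%:E * (expR (- V x))%:E)%E t0 s0 ts.
have Z1 : (\int[lebesgue_rV R n]_x (expR (- V x))%:E = 1%:E)%E.
  by rewrite -PE// [LHS](@probability_setT _ _ _ P).
rewrite Z1 -!dens// -!EFin_Rintegral//.
have I0 : 0 < \int[P]_x expR (g x / t).
  apply: (@lt_le_trans _ _ (expR (- (M / t)))); first exact: expR_gt0.
  rewrite -[X in X <= _](Rintegral_prob_cst P); apply: le_Rintegral => //.
    exact: finite_measure_integrable_cst.
  move=> x _; rewrite ler_expR -mulNr ler_pM2r ?invr_gt0// lerNl.
  by rewrite (le_trans _ (gM x))// -normrN ler_norm.
move=> H; have := @geometric_mean_le_finP t s _ 1 _ t0 s0 ts I0 ltr01.
rewrite powR1 mulr1; apply; apply: H.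
- by apply: emeasurable_funM => //; apply/measurable_EFinP;
  exact: (measurableT_comp (@measurable_expR R)).
- by [].
- by apply: emeasurable_funM => //; apply/measurable_EFinP;
  exact: (measurableT_comp (@measurable_expR R)).
- by move=> x; rewrite -EFinM lee_fin mulr_ge0 ?expR_ge0.
- by move=> x; rewrite lee_fin expR_ge0.
- by move=> x; rewrite -EFinM lee_fin mulr_ge0 ?expR_ge0.
move=> x y; rewrite -!EFinM; apply: geometric_mean_le_fin => //.
rewrite /q -!expRD -!expRM -expRD ler_expR.
set z := t *: x + s *: y.
(* The displacement from [z] to [x] has order [s], so the quadratic remainder of [g] has order
   [s ^ 2]. *)
have xz : x = z + s *: (x - y).
  by rewrite /z scalerBr -addrA [s *: y + _]addrC subrK -scalerDl ts scale1r.
have := gG z (s *: (x - y)); rewrite -xz => h1.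
have := cV t s x y t0 s0 ts; rewrite -/z => h2.
have := dotp_young (G z) (x - y) a0 => h3.
have a4 : (4 * a)^-1 = 3 / 8 * K by rewrite /a; field; rewrite gt_eqF.
move: h1 h2 h3; rewrite a4 dotpZl !dotpZr.
set k := dotp (x - y) _; set Gk := dotp (G z) (x - y).
have k0 : 0 <= k by exact: dotp_ge0.
set GG := dotp (G z) (G z).
have -> : g x / t + - V x = (g x / t - V x) by [].
move=> h1 h2 h3.
rewrite mulrBl divfK ?gt_eqF//.
have h4 : s * (3 / 8 * K * k) + L * (s * (s * k)) <= K / 2 * (t * s) * k.
  rewrite -subr_ge0 (_ : _ - _ = s * k * (K / 8 - s * (K / 2 + L))).
    by rewrite mulr_ge0 ?mulr_ge0 ?(ltW s0)// subr_ge0.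
  by rewrite /t; field.
have h5 : s * Gk <= s * (a * GG + 3 / 8 * K * k) by rewrite ler_pM2l.
rewrite mulrDr in h5; lra.
Qed.

(** One value of [s], small enough in terms of [K], [L] and [B], is enough: after division by [s]
    neither [L] nor [B] is left. *)
Lemma lsi_strongly_convex n (P : probability 'rV[R]_n R) (V g : 'rV[R]_n -> R)
    (G : 'rV[R]_n -> 'rV[R]_n) (K L M B : R) :
  0 < K -> 0 <= L ->
  measurable_fun setT V -> strongly_convex K V ->
  (forall A, measurable A -> P A = (\int[lebesgue_rV R n]_(x in A) (expR (- V x))%:E)%E)
    ->
  measurable_fun setT g -> measurable_fun setT G ->
  (forall x, `|g x| <= M) -> (forall x, dotp (G x) (G x) <= B) ->
  (forall z h, g (z + h) <= g z + dotp (G z) h + L * dotp h h) ->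
  \int[P]_x (expR (g x) * g x) - \int[P]_x expR (g x) * ln (\int[P]_x expR (g x)) <=
  K^-1 * \int[P]_x (expR (g x) * dotp (G x) (G x)).
Proof.
move=> K0 L0 mV cV PE mg mG gM GB gG.
have B0 : 0 <= B by rewrite (le_trans _ (GB 0))// dotp_ge0.
(* The summand [8 * L / K], with a part of [6], gives [s * (K / 2 + L) <= K / 8]; the summand
   [2 * B / K] gives [s * a * B <= 1 / 3]. *)
pose D := 6 + 8 * L / K + 2 * B / K.
have L1 : 0 <= 8 * L / K by rewrite mulr_ge0 ?mulr_ge0// invr_ge0 ltW.
have B1 : 0 <= 2 * B / K by rewrite mulr_ge0 ?mulr_ge0// invr_ge0 ltW.
have D0 : 0 < D by rewrite /D; lra.
pose s := D^-1; have s0 : 0 < s by rewrite invr_gt0.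
have s1 : s < 1 by rewrite invf_lt1//; rewrite /D; lra.
have mQ : measurable_fun setT (fun x => dotp (G x) (G x)) by exact: measurable_dotp.
pose a := 2 / (3 * K); have a0 : 0 < a by rewrite divr_gt0// mulr_gt0.
have sa0 : 0 < s * a by exact: mulr_gt0.
have saB : s * a * B <= 1 / 3.
  rewrite (_ : _ * B = (2 * B / K) / 3 / D); last by rewrite /s /a; field;
    rewrite !gt_eqF.
  by rewrite ler_pdivrMr//; rewrite /D; lra.
have sKL : s * (K / 2 + L) <= K / 8.
  rewrite mulrC ler_pdivrMr// /D (_ : K / 8 * _ = K / 2 + L + (K / 4 + B / 4)).
    by rewrite lerDl addr_ge0// divr_ge0// ltW.
  by field; rewrite gt_eqF.
have := tilted_power_mean K0 L0 s0 s1 sKL mV cV PE mg mG gM GB gG.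
move=> /(@entropy_le_of_power_mean _ _ _ P s M g (fun x => s * a * dotp (G x) (G x)) s0
  s1 mg).
move=> /(_ (measurable_funM _ mQ) gM) H.
have iXG : P.-integrable setT (EFin \o (fun x => expR (g x) * dotp (G x) (G x))).
  apply: (@bounded_integrable _ _ _ _ _ (expR M * B)).
    by apply: measurable_funM => //; exact: (measurableT_comp (@measurable_expR R)).
  move=> x; rewrite normrM (ger0_norm (expR_ge0 _)) (ger0_norm (dotp_ge0 _)).
  by rewrite ler_pM ?expR_ge0 ?dotp_ge0// ler_expR (le_trans (ler_norm _)).
rewrite -(ler_pM2l s0); apply: le_trans (H _ _) _ => //.
  move=> x; rewrite mulr_ge0 ?dotp_ge0 ?(ltW sa0)//=.
  by rewrite (le_trans _ saB)// ler_pM2l.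
under eq_Rintegral do rewrite mulrCA.
rewrite RintegralZl// /a le_eqVlt; apply/orP; left; apply/eqP.
by field; rewrite gt_eqF.
Qed.

End strongly_convex.

(** * Measurability of continuous functions *)

Section continuous_rV.
Variables (R : realType) (n : nat).

Lemma continuous_rVP (f : 'rV[R]_n -> R) : continuous f <->
  forall (x : 'rV[R]_n) (e : R), 0 < e -> exists2 r : R, 0 < r &
    forall y : 'rV[R]_n, (forall i, `|x ord0 i - y ord0 i| < r) -> `|f x - f y| < e.
Proof.
split=> [cf x e e0|H x].
  have /cvgrPdist_lt/(_ _ e0) := cf x.
  move=> /nbhs_ballP[r /= r0 rx]; exists r => // y xy; apply: rx; split => // i j.
  by rewrite (ord1 i); exact: xy.
have xF : Filter (nbhs x) by exact: (@nbhs_filter 'rV[R]_n x).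
apply/cvgrPdist_lt => e e0; have [r r0 xr] := H x e e0.
suff : nbhs (x : 'rV[R]_n) [set y | `|f x - f y| < e] by [].
by apply/nbhs_ballP; exists r => //= y [_ xy]; apply: xr => i; exact: xy.
Qed.

(** Rounding down to a grid makes any function constant on countably many boxes, so its preimages
    are countable unions of boxes. *)
Lemma measurable_discretized (k : nat) (f : 'rV[R]_n -> R) :
  measurable_fun setT
    (fun x : 'rV[R]_n => f (\row_i ((Num.floor (k.+1%:R * x ord0 i))%:~R / k.+1%:R))).
Proof.
move=> _ Y mY; rewrite setTI.
pose pt (m : 'rV[int]_n) : 'rV[R]_n := \row_i ((m ord0 i)%:~R / k.+1%:R).
pose A (m : 'rV[int]_n) : set 'rV[R]_n :=
  [set x | forall i, Num.floor (k.+1%:R * x ord0 i) = m ord0 i].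
pose F (j : nat) : set 'rV[R]_n :=
  if @unpickle 'rV[int]_n j is Some m then
    if f (pt m) \in Y then A m else set0
  else set0.
have mA m : measurable (A m).
  have k0 : 0 < (k.+1%:R : R) by rewrite ltr0n.
  have -> : A m = [set x : 'rV[R]_n | forall i,
      `[(m ord0 i)%:~R / k.+1%:R, (m ord0 i + 1)%:~R / k.+1%:R[%classic (x ord0 i)].
    apply/seteqP; split => x /=.
      move=> H i; rewrite /= in_itv/= ler_pdivrMr// ltr_pdivlMr// [_ * k.+1%:R]mulrC.
      by rewrite -(H i) floor_le floorD1_gt.
    move=> H i; have := H i.
    rewrite /= in_itv/= ler_pdivrMr// ltr_pdivlMr// [_ * k.+1%:R]mulrC => h.
    exact: floor_def.
  exact: (@measurable_box R n (fun i => `[(m ord0 i)%:~R / k.+1%:R, (m ord0 i + 1)%:~R /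
    k.+1%:R[%classic)).
rewrite (_ : _ @^-1` _ = \bigcup_j F j).
  apply: bigcupT_measurable => j; rewrite /F; case: unpickle => [m|//].
  by case: ifPn => // _; exact: mA.
apply/seteqP; split => x /=.
  move=> Yx; exists (pickle (\row_i Num.floor (k.+1%:R * x ord0 i) : 'rV[int]_n)) => //.
  rewrite /F pickleK /=; case: ifPn => [_ i|/negP]; first by rewrite mxE.
  case; rewrite inE; move: Yx; congr Y; congr f; apply/rowP => i; by rewrite !mxE.
move=> [j _]; rewrite /F; case: unpickle => [m|//]; case: ifPn => //; rewrite inE => Ym H.
move: Ym; congr Y; congr f; apply/rowP => i; by rewrite !mxE H.
Qed.

(** The sigma-algebra is generated by the coordinates and not by the open sets; a continuous
    function is nevertheless the pointwise limit of its discretisations on finer and finer grids. *)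
Lemma continuous_measurable_rV (f : 'rV[R]_n -> R) :
  continuous f -> measurable_fun setT f.
Proof.
move=> /continuous_rVP cf.
apply: (@measurable_fun_cvg _ _ _ setT (fun k (x : 'rV[R]_n) =>
  f (\row_i ((Num.floor (k.+1%:R * x ord0 i))%:~R / k.+1%:R)))).
  by move=> k; exact: measurable_discretized.
move=> x _; apply/cvgrPdist_lt => e e0; have [r r0 xr] := cf x e e0.
near=> k; apply: xr => i; rewrite mxE.
have k0 : 0 < (k.+1%:R : R) by rewrite ltr0n.
rewrite -(ltr_pM2l k0) -{1}(gtr0_norm k0) -normrM mulrBr [_ * (_ / _)]mulrC divfK
  ?gt_eqF//.
have h1 := floor_le (k.+1%:R * x ord0 i); have h2 := floorD1_gt (k.+1%:R * x ord0 i).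
rewrite ger0_norm ?subr_ge0//.
apply: (@lt_le_trans _ _ 1); first by rewrite ltrBlDl; move: h2; rewrite intrD.
rewrite -ler_pdivrMr// mul1r.
apply: le_trans (_ : (Num.truncn r^-1).+1%:R <= _); first exact/ltW/truncnS_gt.
by rewrite ler_nat ltnS; near: k; exact: nbhs_infty_ge.
Unshelve. all: by end_near. Qed.

End continuous_rV.

(** * Bounded perturbations *)

Section density_probability.
Variables (R : realType) (n : nat) (rho : 'rV[R]_n -> R).
Hypothesis mrho : measurable_fun setT rho.
Hypothesis rho0 : forall x, 0 <= rho x.
Hypothesis rho1 : (\int[lebesgue_rV R n]_x (rho x)%:E = 1)%E.

Let mE : measurable_fun setT (fun x => (rho x)%:E).
Proof. exact/measurable_EFinP. Qed.

(** The hypotheses are arguments, so that the measure and probability structures declared below can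
    recover them from the term itself. *)
Definition density_measure of measurable_fun setT rho & (forall x, 0 <= rho x) &
    (\int[lebesgue_rV R n]_x (rho x)%:E = 1)%E : set 'rV[R]_n -> \bar R :=
  fun A => (\int[lebesgue_rV R n]_(x in A) (rho x)%:E)%E.
Local Notation mu := (density_measure mrho rho0 rho1).

Let mu0 : mu set0 = 0%E. Proof. exact: integral_set0. Qed.

Let mu_ge0 A : (0 <= mu A)%E.
Proof. by apply: integral_ge0 => x _; rewrite lee_fin. Qed.

Let mu_sigma_additive : semi_sigma_additive mu.
Proof.
move=> F mF tF mUF; rewrite /density_measure ge0_integral_bigcup//.
- by apply: is_cvg_ereal_nneg_natsum_cond => k _ _; exact: mu_ge0.
- exact: measurable_funTS.
- by move=> x _; rewrite lee_fin.
Qed.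

HB.instance Definition _ := isMeasure.Build _ _ _ mu mu0 mu_ge0 mu_sigma_additive.

Let muT : mu setT = 1%E. Proof. exact: rho1. Qed.

HB.instance Definition _ := Measure_isProbability.Build _ _ _ mu muT.

Definition density_probability : probability 'rV[R]_n R := mu.

End density_probability.

(** * Gaussian integrals and finite partition functions *)

Section gaussian.
Variable R : realType.
Local Notation leb := (@lebesgue_measure R).

Lemma gaussian_lty1 (c : R) : 0 < c -> (\int[leb]_x (expR (- (c * (x * x))))%:E < +oo)%E.
Proof.
(* The standard deviation for which the normal density is proportional to [exp (- c * x ^ 2)]. *)
move=> c0; pose s := Num.sqrt (2 * c)^-1.
have s2 : s ^+ 2 *+ 2 = c^-1.
  rewrite /s sqr_sqrtr ?invr_ge0 ?mulr_ge0 ?(ltW c0)// -mulr_natl.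
  by field; rewrite gt_eqF.
have s0 : s != 0 by rewrite gt_eqF// sqrtr_gt0 invr_gt0 mulr_gt0.
have := @integral_normal_pdf R 0 s; rewrite normal_pdfE// => H.
have p0 := normal_peak_gt0 s0.
have mE : measurable_fun (setT : set (measurableTypeR R)) (fun x => (expR (- (c * (x *
  x))))%:E).
  apply/measurable_EFinP; apply: (measurableT_comp (@measurable_expR R)).
  by apply: measurable_funN; apply: measurable_funM => //; exact: measurable_funM.
have : ((normal_peak s)%:E * \int[leb]_x (expR (- (c * (x * x))))%:E = 1%:E)%E.
  rewrite -ge0_integralZl_EFin ?(ltW p0)//.
  rewrite -[RHS]H; apply: eq_integral => x _; rewrite /normal_fun.
  by rewrite subr0 s2 invrK expr2 mulNr mulrC.
case: (\int[leb]_x _)%E => [r _||]; rewrite ?ltry//.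
by rewrite gt0_muley ?lte_fin.
Qed.

Lemma dotp_cons n (t : R) (v : 'rV[R]_n) :
  dotp (cons_rV (t, v)) (cons_rV (t, v)) = t * t + dotp v v.
Proof.
rewrite /dotp big_ord_recl cons_rVE0; congr (_ + _).
by apply: eq_bigr => i _; rewrite cons_rVES.
Qed.

Lemma gaussian_lty n (c : R) : 0 < c ->
  (\int[lebesgue_rV R n]_x (expR (- (c * dotp x x)))%:E < +oo)%E.
Proof.
move=> c0; have mE m : measurable_fun setT (fun x : 'rV[R]_m => (expR (- (c * dotp x
  x)))%:E).
  apply/measurable_EFinP; apply: (measurableT_comp (@measurable_expR R)).
  by apply: measurable_funN; apply: measurable_funM => //; exact: measurable_dotp.
elim: n => [|n IH]; first by rewrite integral_rV0// ltry.
rewrite ge0_integral_rVS//.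
have -> : (\int[leb]_t \int[lebesgue_rV R n]_v
    (expR (- (c * dotp (cons_rV (t, v)) (cons_rV (t, v)))))%:E =
   \int[leb]_t ((expR (- (c * (t * t))))%:E * \int[lebesgue_rV R n]_v (expR (- (c * dotp
     v v)))%:E))%E.
  apply: eq_integral => t _; rewrite -ge0_integralZl_EFin ?expR_ge0//; last exact: mE.
  by apply: eq_integral => v _; rewrite -EFinM -expRD dotp_cons mulrDr opprD.
rewrite ge0_integralZr//.
- rewrite lte_mul_pinfty ?ge0_fin_numE ?gaussian_lty1 ?integral_ge0// => x _.
- apply/measurable_EFinP; apply: (measurableT_comp (@measurable_expR R)).
  by apply: measurable_funN; apply: measurable_funM => //; exact: measurable_funM.
- exact: integral_ge0.
Qed.

Lemma lebesgue_rV_setT_gt0 n : (0 < lebesgue_rV R n setT)%E.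
Proof.
pose A (i : 'I_n) : set (measurableTypeR R) := `[0, 1]%classic.
have mA i : measurable (A i) by exact: measurable_itv.
apply: (@lt_le_trans _ _ (lebesgue_rV R n [set x | forall i, A i (x ord0 i)])).
  rewrite lebesgue_rV_box// big1// => i _.
  by rewrite /A lebesgue_measure_itv/= lte_fin ltr01 oppr0 adde0.
by apply: le_measure; rewrite ?inE//; exact: measurable_box.
Qed.

(** A Gaussian dominates the integrand. Were the integral zero, the positive integrand would vanish
    almost everywhere, although the whole space is not null. *)
Lemma partition_function_finite n (U : 'rV[R]_n -> R) (a c : R) :
  measurable_fun setT U -> 0 < c -> (forall x, a + c * dotp x x <= U x) ->
  exists2 Z : R, 0 < Z & (\int[lebesgue_rV R n]_x (expR (- U x))%:E = Z%:E)%E.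
Proof.
move=> mU c0 aU.
have mE : measurable_fun setT (fun x => (expR (- U x))%:E).
  apply/measurable_EFinP; apply: (measurableT_comp (@measurable_expR R)).
  exact: measurable_funN.
have mG : measurable_fun setT (fun x : 'rV[R]_n => (expR (- (c * dotp x x)))%:E).
  apply/measurable_EFinP; apply: (measurableT_comp (@measurable_expR R)).
  by apply: measurable_funN; apply: measurable_funM => //; exact: measurable_dotp.
have : (\int[lebesgue_rV R n]_x (expR (- U x))%:E < +oo)%E.
  apply: (@le_lt_trans _ _ (\int[lebesgue_rV R n]_x ((expR (- a))%:E * (expR (- (c * dotp
    x x)))%:E))%E).
    apply: ge0_le_integral => //.
      exact: emeasurable_funM.
    move=> x _; rewrite -EFinM lee_fin -expRD ler_expR.
    by rewrite -opprD lerN2.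
  rewrite ge0_integralZl_EFin ?expR_ge0//.
  by rewrite lte_mul_pinfty ?lee_fin ?expR_ge0// gaussian_lty.
have : (0 < \int[lebesgue_rV R n]_x (expR (- U x))%:E)%E.
  rewrite lt_neqAle integral_ge0 ?andbT; last by move=> x _; rewrite lee_fin expR_ge0.
  apply/eqP => I0.
  have : (\int[lebesgue_rV R n]_x `|(expR (- U x))%:E| = 0)%E.
    by rewrite I0; apply: eq_integral => x _; rewrite abse_EFin ger0_norm ?expR_ge0.
  move=> /(ae_eq_integral_abs _ measurableT mE)[N [mN N0 sub]].
  have := lebesgue_rV_setT_gt0 n.
  rewrite (_ : setT = N) ?N0 ?ltxx//; apply/seteqP; split => // x _.
  by apply: sub => /= /(_ I)[] /eqP; rewrite gt_eqF// expR_gt0.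
case: (\int[lebesgue_rV R n]_x _)%E => [z|//|//]; rewrite lte_fin => z0 _.
by exists z.
Qed.

End gaussian.

Section perturbation.
Context d (T : measurableType d) (R : realType).

Lemma Rintegral_density_le (P P0 : probability T R)
    (mu : {sigma_finite_measure set T -> \bar R}) (rho rho0 F : T -> R) (a M : R) :
  measurable_fun setT rho -> measurable_fun setT rho0 ->
  (forall x, 0 <= rho x) -> (forall x, 0 <= rho0 x) ->
  (forall A, measurable A -> P A = \int[mu]_(x in A) (rho x)%:E)%E ->
  (forall A, measurable A -> P0 A = \int[mu]_(x in A) (rho0 x)%:E)%E ->
  0 <= a -> (forall x, rho x <= a * rho0 x) ->
  measurable_fun setT F -> (forall x, 0 <= F x <= M) ->
  \int[P]_x F x <= a * \int[P0]_x F x.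
Proof.
move=> mr mr0 r0 r00 PE P0E a0 ra mF FM.
have F0 x : 0 <= F x by case/andP: (FM x).
have FM' x : `|F x| <= M by rewrite ger0_norm//; case/andP: (FM x).
have iP := bounded_integrable P mF FM'.
have iP0 := bounded_integrable P0 mF FM'.
rewrite -lee_fin EFinM !EFin_Rintegral//.
have mr' : measurable_fun setT (fun x => (rho x)%:E) by exact/measurable_EFinP.
have mr0' : measurable_fun setT (fun x => (rho0 x)%:E) by exact/measurable_EFinP.
have mF' : measurable_fun setT (fun x => (F x)%:E) by exact/measurable_EFinP.
rewrite (integral_density mr' _ PE mF')//.
rewrite (integral_density mr0' _ P0E mF')//.
rewrite -ge0_integralZl_EFin//; last 2 first.
- by move=> x _; rewrite -EFinM lee_fin mulr_ge0.
- exact: emeasurable_funM.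
apply: ge0_le_integral => //.
- by move=> x _; rewrite -EFinM lee_fin mulr_ge0.
- exact: emeasurable_funM.
- by apply: emeasurable_funM => //; exact: emeasurable_funM.
by move=> x _; rewrite -!EFinM lee_fin mulrCA ler_wpM2l.
Qed.

(** The entropy of [X] is the minimum over [c] of the mean of [X * ln X - X * ln c - X + c]. This
    integrand is nonnegative, unlike [X * ln X], so its means under [P] and [P0] can be compared. *)
Lemma holley_stroock (P P0 : probability T R) (a b C M N : R) (g q : T -> R) :
  0 <= a -> 0 <= b -> 0 <= C ->
  (forall (F : T -> R) (N : R), measurable_fun setT F -> (forall x, 0 <= F x <= N) ->
    \int[P]_x F x <= a * \int[P0]_x F x) ->
  (forall (F : T -> R) (N : R), measurable_fun setT F -> (forall x, 0 <= F x <= N) ->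
    \int[P0]_x F x <= b * \int[P]_x F x) ->
  measurable_fun setT g -> (forall x, `|g x| <= M) ->
  measurable_fun setT q -> (forall x, 0 <= q x <= N) ->
  \int[P0]_x (expR (g x) * g x) - \int[P0]_x expR (g x) * ln (\int[P0]_x expR (g x)) <=
    C * \int[P0]_x (expR (g x) * q x) ->
  \int[P]_x (expR (g x) * g x) - \int[P]_x expR (g x) * ln (\int[P]_x expR (g x)) <=
    a * b * C * \int[P]_x (expR (g x) * q x).
Proof.
move=> a0 b0 C0 PP0 P0P mg gM mq qN H.
have mX : measurable_fun setT (fun x => expR (g x)).
  exact: (measurableT_comp (@measurable_expR R)).
have XM x : expR (g x) <= expR M by rewrite ler_expR (le_trans (ler_norm _)).
have mXg : measurable_fun setT (fun x => expR (g x) * g x) by exact: measurable_funM.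
have bXg x : `|expR (g x) * g x| <= expR M * M.
  by rewrite normrM ler_pM// ger0_norm ?expR_ge0.
have iX (Q : probability T R) := measurable_bounded_expR Q mg gM.
have iXg (Q : probability T R) := bounded_integrable Q mXg bXg.
have m0 (Q : probability T R) : 0 < \int[Q]_x expR (g x).
  apply: (@lt_le_trans _ _ (expR (- M))); first exact: expR_gt0.
  rewrite -(Rintegral_prob_cst Q (expR (-M))); apply: le_Rintegral => //.
  - exact: finite_measure_integrable_cst.
  - exact: iX.
  by move=> x _; rewrite ler_expR lerNl (le_trans _ (gM x))// -normrN ler_norm.
(* The minimiser for [P0]: with it the [P0]-mean of [F] is exactly the entropy under [P0]. *)
pose c := \int[P0]_x expR (g x); have c0 : 0 < c by exact: m0.
pose F x := expR (g x) * g x - ln c * expR (g x) - expR (g x) + c.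
have IF (Q : probability T R) : \int[Q]_x F x =
    \int[Q]_x (expR (g x) * g x) - ln c * \int[Q]_x expR (g x) - \int[Q]_x expR (g x) + c.
  have iXQ := iX Q; have iXgQ := iXg Q.
  have i1 := integrable_EFinZ (ln c) iXQ.
  have i2 := integrable_EFinB (iXg Q) i1.
  have i3 := integrable_EFinB i2 (iX Q).
  rewrite RintegralD//; last exact: finite_measure_integrable_cst.
  by rewrite Rintegral_prob_cst RintegralB// RintegralB// RintegralZl.
have mF : measurable_fun setT F.
  apply: measurable_funD => //; apply: measurable_funB => //.
  by apply: measurable_funB => //; exact: measurable_funM.
have F0 x : 0 <= F x.
  have := expR_ge1Dx (ln c - g x); rewrite expRB lnK ?posrE// => h.
  have : expR (g x) * (1 + (ln c - g x)) <= c.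
    by rewrite mulrC -ler_pdivlMr ?expR_gt0.
  rewrite /F -subr_ge0; lra.
have FN x : 0 <= F x <= expR M * M + `|ln c| * expR M + c.
  rewrite F0/= /F lerD2r -addrA lerD//.
    by rewrite (le_trans (ler_norm _)).
  rewrite (@le_trans _ _ (- (ln c * expR (g x))))//.
    by rewrite gerDl oppr_le0 expR_ge0.
  rewrite (le_trans (ler_norm _))// normrN normrM ler_pM//.
  by rewrite ger0_norm ?expR_ge0.
have PF := PP0 F _ mF FN; rewrite !IF in PF.
have mXq : measurable_fun setT (fun x => expR (g x) * q x) by exact: measurable_funM.
have bXq x : 0 <= expR (g x) * q x <= expR M * N.
  by have /andP[q0 q1] := qN x; rewrite mulr_ge0 ?expR_ge0//= ler_pM ?expR_ge0.
have PXq := P0P _ _ mXq bXq.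
set m := \int[P]_x expR (g x) in PF *.
(* For [P] the value [c] need not be optimal, which only increases the mean of [F] above the
   entropy. *)
have mc : m * ln c - m * ln m <= c - m.
  rewrite -mulrBr -ln_div ?posrE ?m0//.
  have cm0 : 0 < c / m by rewrite divr_gt0 ?m0.
  have := le_ln1Dx (x := c / m - 1); rewrite addrCA subrr addr0 => h.
  have : ln (c / m) <= c / m - 1 by apply: h; lra.
  rewrite -(ler_pM2l (m0 P)) => /le_trans; apply.
  by rewrite mulrBr mulr1 mulrCA mulfV ?mulr1// gt_eqF ?m0.
apply: (@le_trans _ _ (a * (C * \int[P0]_x (expR (g x) * q x)))).
  apply: (@le_trans _ _ (a * (\int[P0]_x (expR (g x) * g x) - c * ln c))); last first.
    by rewrite ler_wpM2l.
  move: PF; rewrite -/c; set A := \int[P]_x _; set B := \int[P0]_x _ => PF.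
  have -> : B - c * ln c = B - ln c * c - c + c by ring.
  by apply: le_trans PF; move: mc; lra.
rewrite [leRHS](_ : _ = a * (C * (b * \int[P]_x (expR (g x) * q x)))); last by ring.
by rewrite ler_wpM2l// ler_wpM2l.
Qed.

End perturbation.

Section perturbed_lsi.
Variables (R : realType) (n : nat).

Lemma strongly_convexD (K c : R) (V : 'rV[R]_n -> R) :
  strongly_convex K V -> strongly_convex K (fun x => V x + c).
Proof.
move=> cV t s x y t0 s0 ts; rewrite (le_trans (cV t s x y t0 s0 ts))// le_eqVlt;
  apply/orP; left; apply/eqP.
have -> : t = 1 - s by rewrite -ts addrK.
ring.
Qed.

(** The two density ratios are bounded by [Z0 / Z] and [exp D * Z / Z0]. In the product required by
    [holley_stroock] the normalisers cancel, so no estimate of them is needed. *)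
Lemma lsi_perturbed (P : probability 'rV[R]_n R) (U V g : 'rV[R]_n -> R)
    (G : 'rV[R]_n -> 'rV[R]_n) (K L M B D Z Z0 : R) :
  0 < K -> 0 <= L -> 0 < Z -> 0 < Z0 ->
  measurable_fun setT U -> measurable_fun setT V -> strongly_convex K V ->
  (\int[lebesgue_rV R n]_x (expR (- V x))%:E = Z0%:E)%E ->
  (forall A, measurable A ->
    P A = (\int[lebesgue_rV R n]_(x in A) (expR (- U x) / Z)%:E)%E) ->
  (forall x, V x <= U x <= V x + D) ->
  measurable_fun setT g -> measurable_fun setT G ->
  (forall x, `|g x| <= M) -> (forall x, dotp (G x) (G x) <= B) ->
  (forall z h, g (z + h) <= g z + dotp (G z) h + L * dotp h h) ->
  \int[P]_x (expR (g x) * g x) - \int[P]_x expR (g x) * ln (\int[P]_x expR (g x)) <=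
  expR D / K * \int[P]_x (expR (g x) * dotp (G x) (G x)).
Proof.
move=> K0 L0 Zp Z0p mU mV cV VZ PE VU mg mG gM GB gG.
have mexp (W : 'rV[R]_n -> R) : measurable_fun setT W -> measurable_fun setT (fun x =>
  expR (- W x)).
  by move=> mW; apply: (measurableT_comp (@measurable_expR R)); exact: measurable_funN.
(* Absorbing the normaliser into the potential keeps strong convexity and makes [exp (- V0)] a
   probability density. *)
pose V0 x := V x + ln Z0.
have V0E x : expR (- V0 x) = Z0^-1 * expR (- V x).
  by rewrite /V0 opprD expRD [expR (- ln _)]expRN lnK ?posrE// mulrC.
have mV0 : measurable_fun setT V0 by exact: measurable_funD.
have V01 : (\int[lebesgue_rV R n]_x (expR (- V0 x))%:E = 1)%E.
  under eq_integral do rewrite V0E EFinM.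
  rewrite ge0_integralZl_EFin ?invr_ge0 ?(ltW Z0p)//; last first.
    by apply/measurable_EFinP; exact: mexp.
  by rewrite VZ -EFinM mulVf ?gt_eqF.
pose P0 := density_probability (mexp _ mV0) (fun x => expR_ge0 _) V01.
have P0E A : measurable A -> P0 A = (\int[lebesgue_rV R n]_(x in A) (expR (- V0 x))%:E)%E
  by [].
have lsi0 := lsi_strongly_convex K0 L0 mV0 (strongly_convexD (ln Z0) cV) P0E mg mG gM GB
  gG.
have mrho : measurable_fun setT (fun x => expR (- U x) / Z).
  by apply: measurable_funM => //; exact (mexp _ mU).
have rho0 x : 0 <= expR (- U x) / Z by rewrite divr_ge0 ?expR_ge0 ?ltW.
have := @holley_stroock _ _ R P P0 (Z0 / Z) (expR D * Z / Z0) K^-1 M B g (fun x => dotp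
  (G x) (G x)).
rewrite (_ : Z0 / Z * _ * _ = expR D / K); last by field; rewrite !gt_eqF.
apply => //.
- by rewrite divr_ge0// ltW.
- by rewrite divr_ge0 ?mulr_ge0 ?expR_ge0// ltW.
- by rewrite invr_ge0 ltW.
- move=> F N mF FN; apply: (Rintegral_density_le (M := N) mrho (mexp _ mV0) rho0 _ PE
  P0E) => //.
  + by rewrite divr_ge0// ltW.
  + move=> x; rewrite V0E mulrA -[_ / _ * _^-1]mulrA [Z^-1 * _]mulrC mulrA mulfV
    ?gt_eqF// mul1r mulrC.
    by rewrite ler_pM2l ?invr_gt0// ler_expR lerN2; case/andP: (VU x).
- move=> F N mF FN; apply: (Rintegral_density_le (M := N) (mexp _ mV0) mrho _ rho0 P0E
  PE) => //.
  + by rewrite divr_ge0 ?mulr_ge0 ?expR_ge0// ltW.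
  + move=> x; rewrite V0E.
    rewrite (_ : expR D * Z / Z0 * (expR (- U x) / Z) = Z0^-1 * (expR D * expR (- U x)));
      last by field; rewrite !gt_eqF.
    rewrite ler_pM2l ?invr_gt0// -expRD ler_expR.
    have /andP[_] := VU x; lra.
- exact: measurable_dotp.
- by move=> x; rewrite dotp_ge0/=.
Qed.

End perturbed_lsi.

(** * Convexification of the potential *)

Section one_variable.
Variable R : realType.
Implicit Types f df : R -> R.

Lemma is_derive_eps f (t l : R) :
  (forall e : R, 0 < e -> exists2 r : R, 0 < r & forall h : R, `|h| < r ->
    `|f (t + h) - f t - l * h| <= e * `|h|) -> is_derive t 1 f l.
Proof.
move=> H; have cv : h^-1 *: ((f \o shift t) (h *: 1) - f t) @[h --> 0^'] --> l.
  apply/cvgrPdist_le => e e0; have [r r0 hr] := H e e0.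
  near=> h.
  have h0 : h != 0 by near: h; exact: nbhs_dnbhs_neq.
  have hlt : `|h| < r by near: h; exact: dnbhs0_lt.
  rewrite /= /shift /= -(ler_pM2r (_ : 0 < `|h|)) ?normr_gt0// -normrM.
  rewrite mulrBl [_^-1 *: _]mulrC -mulrA mulVf// mulr1 distrC [h *: 1]mulr1 (addrC h).
  exact: hr.
apply: DeriveDef; first by apply/cvg_ex; exists l.
exact: cvg_lim cv.
Unshelve. all: by end_near. Qed.

Lemma mean_value f df (a b : R) : (forall x : R, is_derive x 1 f (df x)) ->
  exists2 c, `|c - a| <= `|b - a| /\ (Num.min a b <= c <= Num.max a b) &
    f b - f a = df c * (b - a).
Proof.
move=> fdf.
have cf x : {for x, continuous f}.
  by apply: differentiable_continuous; apply/derivable1_diffP; exact: ex_derive.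
have [ab|ba|ab] := ltgtP a b.
- have [|c cab E] := MVT ab (fun x _ => fdf x).
    by apply: continuous_subspaceT.
  exists c => //; move: cab; rewrite in_itv/= => /andP[ac cb].
  by split; [rewrite !ger0_norm; lra|rewrite ?ltW].
- have [|c cab E] := MVT ba (fun x _ => fdf x).
    by apply: continuous_subspaceT.
  exists c; last by rewrite -opprB E; ring.
  move: cab; rewrite in_itv/= => /andP[ac cb].
  by split; [rewrite !ler0_norm; lra|rewrite ?ltW].
- exists a; last by rewrite -ab !subrr mulr0.
  by rewrite -ab !subrr !lexx.
Qed.

(** Subtracting [k / 2 * x ^ 2] leaves a function with nondecreasing derivative; mean values on
    [[0, t]] and on [[t, 1]] are then compared. *)
Lemma strong_convexity1 f df (k t s : R) : (forall x : R, is_derive x 1 f (df x)) ->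
  (forall a b : R, a <= b -> k * (b - a) <= df b - df a) ->
  0 < t -> 0 < s -> t + s = 1 -> k / 2 * (t * s) <= t * f 1 + s * f 0 - f t.
Proof.
move=> fdf kdf t0 s0 ts.
pose g x := f x + (- (k / 2)) * (x * x).
have gdg (x : R) : is_derive x 1 g (df x - k * x).
  apply: is_derive_eq.
  by rewrite /GRing.scale/=; field.
have [c1 [_ /andP[]]] := mean_value 0 t gdg.
have [c2 [_ /andP[]]] := mean_value t 1 gdg.
have t1 : t < 1 by lra.
rewrite (min_l (ltW t1)) (max_r (ltW t1)) (min_l (ltW t0)) (max_r (ltW t0)).
move=> tc2 c21 E2 c10 c1t E1.
have := kdf c1 c2 (le_trans c1t tc2) => h.
rewrite -subr_ge0 (_ : _ - _ = t * s * ((df c2 - k * c2) - (df c1 - k * c1))); last first.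
  have -> : t * f 1 + s * f 0 - f t = t * (f 1 - f t) - s * (f t - f 0).
    have e1 : f t = (t + s) * f t by rewrite ts mul1r.
    by rewrite {1}e1; ring.
  have -> : f 1 - f t = (df c2 - k * c2) * (1 - t) + k / 2 * (1 - t * t).
    by rewrite -E2 /g; field.
  have -> : f t - f 0 = (df c1 - k * c1) * t + k / 2 * (t * t).
    by move: E1; rewrite subr0 => <-; rewrite /g; field.
  have -> : s = 1 - t by rewrite -ts addrAC subrr add0r.
  by field.
by rewrite mulr_ge0 ?mulr_ge0 ?(ltW t0) ?(ltW s0)//; lra.
Qed.

Lemma tangent_bound1 f df (k : R) : (forall x : R, is_derive x 1 f (df x)) ->
  (forall a b : R, a <= b -> k * (b - a) <= df b - df a) ->
  f 0 + df 0 + k / 2 <= f 1.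
Proof.
move=> fdf kdf.
pose g x := f x + (- (k / 2)) * (x * x).
have gdg (x : R) : is_derive x 1 g (df x - k * x).
  apply: is_derive_eq.
  by rewrite /GRing.scale/=; field.
have [c [_ /andP[]]] := mean_value 0 1 gdg.
rewrite min_l// max_r// => c0 c1 E.
have := kdf 0 c c0; rewrite subr0 => h.
move: E; rewrite /g; lra.
Qed.

End one_variable.

(** * Differentiability from continuous partial derivatives *)

Section C1.
Variables (R : realType) (n : nat).

Lemma is_derive_line (f : 'rV[R]_n -> R) (v x : 'rV[R]_n) (c : R) :
  derivable f (x + c *: v) v ->
  is_derive c 1 (fun c => f (x + c *: v)) ('D_v f (x + c *: v)).
Proof.
move=> fd.
have E : (fun h : R => h^-1 *: (((fun c => f (x + c *: v)) \o shift c) (h *: 1) - f (x +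
  c *: v))) =
         (fun h : R => h^-1 *: ((f \o shift (x + c *: v)) (h *: v) - f (x + c *: v))).
  apply/funext => h; congr (_ *: (f _ - _)).
  by rewrite /shift/= [h *: 1]mulr1 scalerDl addrCA.
apply: DeriveDef; first by rewrite /derivable E.
by rewrite /derive E.
Qed.

Definition truncate_row (k : nat) (h : 'rV[R]_n) : 'rV[R]_n :=
  \row_i (if (i < k)%N then h ord0 i else 0).

Lemma truncate_row0 h : truncate_row 0 h = 0.
Proof. by apply/rowP => i; rewrite !mxE. Qed.

Lemma truncate_rowT h : truncate_row n h = h.
Proof. by apply/rowP => i; rewrite !mxE ltn_ord. Qed.

Lemma truncate_rowS (k : 'I_n) h :
  truncate_row k.+1 h = truncate_row k h + h ord0 k *: delta_mx ord0 k.
Proof.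
apply/rowP => i; rewrite !mxE eqxx/= ltnS leq_eqVlt -val_eqE/=.
have [ik|ik] := boolP (val i == val k); last by rewrite /= mulr0 addr0.
have -> : i = k by exact/val_inj/eqP.
by rewrite /= ltnn mulr1 add0r.
Qed.

(** [grad] collects partial derivatives only. The point [x + h] is reached from [x] by changing one
    coordinate at a time, with a mean value on each segment; the increments telescope. *)
Lemma C1_expansion (f : 'rV[R]_n -> R) :
  (forall i x, derivable f x (delta_mx ord0 i)) ->
  (forall i, continuous (partial i f)) ->
  forall (x : 'rV[R]_n) (e : R), 0 < e -> exists2 r : R, 0 < r &
    forall h : 'rV[R]_n, (forall i, `|h ord0 i| < r) ->
      `|f (x + h) - f x - dotp (grad f x) h| <= e * \sum_i `|h ord0 i|.
Proof.
move=> fd cf x e e0.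
have /choice[r rP] : forall i : 'I_n, exists r : R, 0 < r /\
    forall y : 'rV[R]_n, (forall j, `|x ord0 j - y ord0 j| < r) ->
      `|partial i f x - partial i f y| < e.
  by move=> i; have /continuous_rVP/(_ x e e0)[r r0 rP] := cf i; exists r.
exists (\big[Num.min/1]_i r i); first by apply: lt_bigmin => // i _; case: (rP i).
move=> h hr.
have hri i j : `|h ord0 j| < r i by rewrite (lt_le_trans (hr j))// bigmin_le_cond.
have step (k : 'I_n) : `|f (x + truncate_row k.+1 h) - f (x + truncate_row k h)
    - partial k f x * h ord0 k| <= e * `|h ord0 k|.
  rewrite truncate_rowS addrA; set p := x + truncate_row k h.
  have [c [+ _] E] := @mean_value R (fun c => f (p + c *: delta_mx ord0 k))
    (fun c => partial k f (p + c *: delta_mx ord0 k)) 0 (h ord0 k)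
    (fun c => is_derive_line (fd k _)).
  rewrite !subr0 => ch; move: E; rewrite scale0r addr0 subr0 => ->.
  rewrite -mulrBl normrM ler_wpM2r// distrC ltW//.
  apply: (rP k).2 => j; rewrite /p !mxE eqxx/= -addrA opprD addNKr normrN.
  have [jk|jk] := ltnP j k.
    by have -> : (j == k) = false by [rewrite -val_eqE/= ltn_eqF]; rewrite mulr0 addr0.
  rewrite add0r; have [_|_] := eqVneq j k; last by rewrite mulr0 normr0 (rP k).1.
  by rewrite mulr1 (le_lt_trans ch).
pose S k := f (x + truncate_row k h).
have tel : f (x + h) - f x = \sum_(k < n) (S k.+1 - S k).
  by rewrite -(big_mkord xpredT (fun k => S k.+1 - S k)) telescope_sumr// /S
    truncate_row0 truncate_rowT addr0.
rewrite tel /dotp -sumrB mulr_sumr (le_trans (ler_norm_sum _ _ _))//.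
by apply: ler_sum => k _; rewrite /grad mxE; exact: step.
Qed.

Lemma C1_is_derive_line (f : 'rV[R]_n -> R) (x v : 'rV[R]_n) (c : R) :
  (forall i x, derivable f x (delta_mx ord0 i)) ->
  (forall i, continuous (partial i f)) ->
  is_derive c 1 (fun c => f (x + c *: v)) (dotp (grad f (x + c *: v)) v).
Proof.
move=> fd cf; apply: is_derive_eps => e e0.
pose B := 1 + \sum_i `|v ord0 i|.
have B0 : 0 < B by rewrite ltr_pwDl// sumr_ge0.
have [r r0 rP] := C1_expansion fd cf (x + c *: v) (divr_gt0 e0 B0).
exists (r / B); first exact: divr_gt0.
move=> h hr; rewrite scalerDl addrA.
have := rP (h *: v); rewrite dotpZr [h * _]mulrC => /(_ _)/le_trans; apply.
  move=> i; rewrite mxE normrM; apply: le_lt_trans (_ : `|h| * B < r).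
    rewrite ler_wpM2l// /B (bigD1 i)//= addrCA lerDl addr_ge0// sumr_ge0//.
  by rewrite -ltr_pdivlMr.
under eq_bigr do rewrite mxE normrM.
rewrite -mulr_sumr mulrCA mulrC ler_wpM2r// mulrAC ler_pdivrMr// ler_wpM2l ?(ltW e0)//.
by rewrite /B lerDr.
Qed.

End C1.

(** * The radial correction, in terms of norms *)

Section radial.
Variable R : realType.

(** For [p] the squared norm of [x], the gradient of [radial_well] at [x] is this number times
    [x]. *)
Definition radial_slope (a lam p : R) : R := a / (1 + lam * p) ^+ 2.

(** [A] and [B] stand for two norms, [k] for the squared distance. With [X = 1 + lam * A ^ 2] and
    [Y = 1 + lam * B ^ 2], the right side is [- a * lam * (A ^ 2 - B ^ 2) ^ 2 * (X + Y) / (2 * (X *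
    Y) ^ 2)]; the bound follows from [X + Y = 2 + Q], [X * Y >= 1 + Q] and
    [(A + B) ^ 2 <= 2 * (A ^ 2 + B ^ 2)]. *)
Lemma radial_interaction (a lam A B k : R) : 0 < a -> 0 < lam -> 0 <= A -> 0 <= B ->
  (A - B) ^+ 2 <= k -> forall Q : R, Q = lam * (A ^+ 2 + B ^+ 2) ->
  - (a * k * (Q * (2 + Q) / (1 + Q) ^+ 2)) <=
  (radial_slope a lam (A ^+ 2) - radial_slope a lam (B ^+ 2)) * (A ^+ 2 - B ^+ 2) / 2.
Proof.
move=> a0 lam0 A0 B0 ABk Q Qdef.
have k0 : 0 <= k by rewrite (le_trans _ ABk)// sqr_ge0.
pose X := 1 + lam * A ^+ 2; pose Y := 1 + lam * B ^+ 2.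
have lA : 0 <= lam * A ^+ 2 by rewrite mulr_ge0 ?sqr_ge0 ?ltW.
have lB : 0 <= lam * B ^+ 2 by rewrite mulr_ge0 ?sqr_ge0 ?ltW.
have X0 : 0 < X by rewrite /X; lra.
have Y0 : 0 < Y by rewrite /Y; lra.
have QE : Q = lam * A ^+ 2 + lam * B ^+ 2 by rewrite Qdef mulrDr.
have Q0 : 0 <= Q by rewrite QE addr_ge0.
have XY : 1 + Q <= X * Y.
  rewrite /X /Y QE; have := mulr_ge0 lA lB; lra.
have Q1 : 0 < 1 + Q by lra.
have -> : (radial_slope a lam (A ^+ 2) - radial_slope a lam (B ^+ 2)) * (A ^+ 2 - B ^+ 2)
  / 2 =
  - (a * (lam * (A - B) ^+ 2 * (A + B) ^+ 2 * (2 + Q) / 2 / (X * Y) ^+ 2)).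
  rewrite /radial_slope QE -/X -/Y /X /Y; field.
  by rewrite !gt_eqF.
rewrite lerN2 -[leRHS]mulrA ler_pM2l//.
have h1 : lam * (A - B) ^+ 2 * (A + B) ^+ 2 / 2 <= k * Q.
  apply: (@le_trans _ _ (lam * k * (2 * (A ^+ 2 + B ^+ 2)) / 2)); last first.
    by rewrite le_eqVlt; apply/orP; left; apply/eqP; rewrite Qdef; field.
  rewrite ler_pM2r ?invr_gt0//; apply: ler_pM.
  - by rewrite mulr_ge0 ?sqr_ge0 ?ltW.
  - by rewrite sqr_ge0.
  - by rewrite ler_pM2l.
  - have := sqr_ge0 (A - B); rewrite !expr2; lra.
rewrite (_ : _ * _ * _ * _ / 2 / _ = lam * (A - B) ^+ 2 * (A + B) ^+ 2 / 2 * ((2 + Q) /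
  (X * Y) ^+ 2)); last first.
  by field; rewrite !gt_eqF.
rewrite (_ : k * (_ / _) = k * Q * ((2 + Q) / (1 + Q) ^+ 2)); last by field;
  rewrite gt_eqF.
apply: ler_pM => //.
- rewrite divr_ge0// mulr_ge0 ?sqr_ge0// mulr_ge0 ?sqr_ge0//; exact: ltW.
- by rewrite divr_ge0 ?sqr_ge0//; lra.
rewrite ler_pM2l; last by lra.
rewrite lef_pV2 ?posrE ?exprn_gt0 ?mulr_gt0//.
by rewrite ler_pXn2r// nnegrE; [exact: ltW|rewrite mulr_ge0// ltW].
Qed.

(** [S] is the inner product of the difference of two well gradients with the difference of the
    points. As [Q * (2 + Q) / (1 + Q) ^ 2] is at most [1], the loss never exceeds [a * k]. For
    [Q <= 1 / 8] that fraction is at most [1 / 4] while the slopes are at least [3 / 4 * a], so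
    [a / 2] is gained. *)
Lemma radial_monotone (a lam A B k : R) : 0 < a -> 0 < lam -> 0 <= A -> 0 <= B ->
  (A - B) ^+ 2 <= k -> forall S : R,
  S = (radial_slope a lam (A ^+ 2) + radial_slope a lam (B ^+ 2)) / 2 * k +
    (radial_slope a lam (A ^+ 2) - radial_slope a lam (B ^+ 2)) * (A ^+ 2 - B ^+ 2) / 2 ->
  - a * k <= S /\ (lam * (A ^+ 2 + B ^+ 2) <= 1 / 8 -> a / 2 * k <= S).
Proof.
move=> a0 lam0 A0 B0 ABk S SE.
have k0 : 0 <= k by rewrite (le_trans _ ABk)// sqr_ge0.
set Q := lam * (A ^+ 2 + B ^+ 2).
have := radial_interaction a0 lam0 A0 B0 ABk (erefl Q) => H.
have lA : 0 <= lam * A ^+ 2 by rewrite mulr_ge0 ?sqr_ge0 ?ltW.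
have lB : 0 <= lam * B ^+ 2 by rewrite mulr_ge0 ?sqr_ge0 ?ltW.
have QE : Q = lam * A ^+ 2 + lam * B ^+ 2 by rewrite /Q mulrDr.
have Q0 : 0 <= Q by rewrite QE addr_ge0.
have Q1 : 0 < 1 + Q by lra.
have s0 p : 0 <= lam * p -> 0 <= radial_slope a lam p.
  by move=> p0; rewrite divr_ge0 ?sqr_ge0 ?ltW.
have sp p : 0 <= lam * p -> lam * p <= 1 / 8 -> 3 / 4 * a <= radial_slope a lam p.
  move=> p0 p1; rewrite /radial_slope ler_pdivlMr ?exprn_gt0//; last by lra.
  rewrite mulrAC -[X in _ <= X]mul1r ler_pM2r// expr2; nra.
have frac : Q * (2 + Q) / (1 + Q) ^+ 2 <= 1.
  by rewrite ler_pdivrMr ?exprn_gt0// mul1r expr2; lra.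
split.
  have h1 : a * k * (Q * (2 + Q) / (1 + Q) ^+ 2) <= a * k * 1.
    by rewrite ler_wpM2l// mulr_ge0// ltW.
  have h2 : 0 <= (radial_slope a lam (A ^+ 2) + radial_slope a lam (B ^+ 2)) / 2 * k.
    by rewrite mulr_ge0// divr_ge0// addr_ge0 ?s0.
  rewrite SE; lra.
move=> Q8.
have frac2 : Q * (2 + Q) / (1 + Q) ^+ 2 <= 1 / 4.
  rewrite ler_pdivrMr ?exprn_gt0// expr2; nra.
have h1 : a * k * (Q * (2 + Q) / (1 + Q) ^+ 2) <= a * k * (1 / 4).
  by rewrite ler_wpM2l// mulr_ge0// ltW.
have h2 : 3 / 4 * a * k <= (radial_slope a lam (A ^+ 2) + radial_slope a lam (B ^+ 2)) /
  2 * k.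
  rewrite ler_wpM2r//.
  have lA8 : lam * A ^+ 2 <= 1 / 8 by lra.
  have lB8 : lam * B ^+ 2 <= 1 / 8 by lra.
  have := sp _ lA lA8; have := sp _ lB lB8; lra.
rewrite SE; lra.
Qed.

(** The two powers cross at [A0]: beyond it the left side is below [c1 * A ^ e], before it below its
    value at [A0]. *)
Lemma powR_growth (c1 c2 e l : R) : 0 < c1 -> 0 < c2 -> 0 < l -> l < e ->
  exists2 M, 0 <= M & forall A, 0 <= A -> c2 * A `^ l <= c1 * A `^ e + M.
Proof.
move=> c10 c20 l0 le.
pose A0 := (c2 / c1) `^ (e - l)^-1.
have el : 0 < e - l by rewrite subr_gt0.
have A00 : 0 < A0 by rewrite powR_gt0// divr_gt0.
exists (c2 * A0 `^ l); first by rewrite mulr_ge0 ?powR_ge0// ltW.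
move=> A An.
have [AA0|AA0] := leP A A0.
  rewrite ler_wpDl ?mulr_ge0 ?powR_ge0 ?(ltW c10)// ler_pM2l//.
  by rewrite ge0_ler_powR ?nnegrE ?(ltW l0)// ltW.
rewrite ler_wpDr ?mulr_ge0 ?powR_ge0 ?(ltW c20)//.
have -> : e = l + (e - l) by rewrite addrC subrK.
have Ap : 0 < A by rewrite (lt_trans A00).
rewrite powRD; last by rewrite (gt_eqF Ap) implybT.
rewrite mulrCA mulrC ler_wpM2l ?powR_ge0// mulrC -ler_pdivrMr//.
have -> : c2 / c1 = A0 `^ (e - l).
  by rewrite /A0 -powRrM mulVf ?gt_eqF// powRr1// divr_ge0// ltW.
by rewrite ge0_ler_powR ?nnegrE ?(ltW el) ?(ltW A00)// ltW.
Qed.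

Lemma powR_unbounded (c e N : R) : 0 < c -> 0 < e -> 0 < N ->
  exists2 R0, 0 < R0 & forall A, R0 <= A -> N <= c * A `^ e.
Proof.
move=> c0 e0 N0; exists ((N / c) `^ e^-1); first by rewrite powR_gt0// divr_gt0.
move=> A AR; have Np : 0 <= N / c by rewrite divr_ge0// ltW.
rewrite mulrC -ler_pdivrMr// -[X in X <= _](@powRr1 _ (N / c))//.
rewrite -(mulVf (_ : e != 0)) ?gt_eqF// powRrM ge0_ler_powR ?nnegrE ?powR_ge0 ?(ltW e0)//.
by rewrite (le_trans _ AR)// powR_ge0.
Qed.

(* Monotonicity of the gradient can only fail on a ball [A, B <= R0], where the
   radial term supplies it; it costs at most [a] elsewhere, uniformly in [R0]. *)
Lemma radial_correction (c1 c2 c3 e l : R) : 0 < c1 -> 0 < c2 -> 0 < c3 ->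
  0 < l -> l < e -> exists a lam : R, [/\ 0 < a, 0 < lam &
    forall A B k, 0 <= A -> 0 <= B -> (A - B) ^+ 2 <= k ->
    k <= (c1 * (A `^ e + B `^ e) - c2 * (A `^ l + B `^ l) - c3) * k +
     ((radial_slope a lam (A ^+ 2) + radial_slope a lam (B ^+ 2)) / 2 * k +
    (radial_slope a lam (A ^+ 2) - radial_slope a lam (B ^+ 2)) * (A ^+ 2 - B ^+ 2) / 2)].
Proof.
move=> c10 c20 c30 l0 le.
(* One half of [c1] absorbs the lower powers up to the constant [M]; the other half provides growth
   at infinity. *)
have c12 : 0 < c1 / 2 by rewrite divr_gt0.
have [M M0 HM] := powR_growth c12 c20 l0 le.
(* Near the origin the well gains [a / 2], which exceeds the worst deficit [2 * M + c3] by the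
   modulus [1]. Beyond [R0] the factor of [k] is at least [1 + a], enough to pay for the loss
   [a]. *)
pose a := 2 * (2 * M + c3 + 1); have a0 : 0 < a by rewrite /a; lra.
have [R0 R00 HR] := @powR_unbounded (c1 / 2) e (1 + 2 * M + c3 + a) c12 (lt_trans l0 le)
  ltac:(lra).
(* For [A] and [B] below [R0] this gives [lam * (A ^ 2 + B ^ 2) <= 1 / 8], the range in which the
   well is convexifying. *)
pose lam := (16 * R0 ^+ 2)^-1.
have lam0 : 0 < lam by rewrite invr_gt0 mulr_gt0// exprn_gt0.
exists a, lam; split => // A B k A0 B0 ABk.
have k0 : 0 <= k by rewrite (le_trans _ ABk)// sqr_ge0.
have := radial_monotone a0 lam0 A0 B0 ABk.
set S := _ + _ / 2 => /(_ S erefl)[S1 S2].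
set q := c1 * _ - _ - _.
have qA := HM A A0; have qB := HM B B0.
have eA : 0 <= c1 / 2 * A `^ e by rewrite mulr_ge0 ?powR_ge0// ltW.
have eB : 0 <= c1 / 2 * B `^ e by rewrite mulr_ge0 ?powR_ge0// ltW.
have qE : c1 / 2 * A `^ e + c1 / 2 * B `^ e - 2 * M - c3 <= q by rewrite /q; lra.
have far : 1 + a <= q -> k <= q * k + S.
  move=> h; have : (1 + a) * k <= q * k by rewrite ler_wpM2r.
  lra.
have [AR|AR] := leP R0 A; first by apply: far; have := HR A AR; lra.
have [BR|BR] := leP R0 B; first by apply: far; have := HR B BR; lra.
have : a / 2 * k <= S.
  apply: S2; rewrite /lam mulrC ler_pdivrMr ?mulr_gt0 ?exprn_gt0//.
  have : A ^+ 2 <= R0 ^+ 2 by rewrite !expr2; apply: ler_pM => //; exact: ltW.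
  have : B ^+ 2 <= R0 ^+ 2 by rewrite !expr2; apply: ler_pM => //; exact: ltW.
  lra.
have : (- (2 * M + c3)) * k <= q * k by rewrite ler_wpM2r//; lra.
have -> : a / 2 * k = (2 * M + c3) * k + k by rewrite /a; field.
lra.
Qed.

End radial.

Section convexification.
Variables (R : realType) (n : nat).

(** Half the primitive of [radial_slope] in the squared norm that vanishes at infinity; it is
    bounded because the slope decays like the inverse square of its argument. *)
Definition radial_well (a lam : R) (x : 'rV[R]_n) : R :=
  - (a / (2 * lam)) / (1 + lam * dotp x x).

Lemma radial_well_bounds (a lam : R) x : 0 < a -> 0 < lam ->
  - (a / (2 * lam)) <= radial_well a lam x <= 0.
Proof.
move=> a0 lam0; rewrite /radial_well !mulNr oppr_le0 lerN2.
have D0 : 1 <= 1 + lam * dotp x x by rewrite lerDl mulr_ge0 ?dotp_ge0 ?ltW.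
have c0 : 0 <= a / (2 * lam) by rewrite divr_ge0 ?mulr_ge0 ?ltW.
rewrite divr_ge0// ?andbT; last by rewrite (le_trans _ D0).
by rewrite ler_pdivrMr ?(lt_le_trans _ D0)// ler_peMr.
Qed.

Lemma is_derive_radial_well (a lam : R) (y v : 'rV[R]_n) (c : R) : 0 < lam ->
  is_derive c 1 (fun c => radial_well a lam (y + c *: v))
    (dotp (radial_slope a lam (dotp (y + c *: v) (y + c *: v)) *: (y + c *: v)) v).
Proof.
move=> lam0.
pose p (c : R) := 1 + lam * (dotp y y + (2 * dotp y v) * c + dotp v v * (c * c)).
have pE (c' : R) : 1 + lam * dotp (y + c' *: v) (y + c' *: v) = p c'.
  rewrite /p !(dotpDl, dotpDr, dotpZl, dotpZr) (dotpC v y); ring.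
have p0 c' : 0 < p c' by rewrite -pE ltr_pwDl// mulr_ge0 ?dotp_ge0 ?ltW.
have -> : (fun c => radial_well a lam (y + c *: v)) = (fun c => (- (a / (2 * lam))) * (p
  c)^-1).
  by apply/funext => c'; rewrite /radial_well pE.
have pc : p c != 0 by rewrite gt_eqF.
have dp : is_derive c 1 p (lam * (2 * dotp y v + 2 * dotp v v * c)).
  by apply: is_derive_eq; rewrite /GRing.scale/=; ring.
have dpV := is_deriveV pc dp.
apply: is_derive_eq.
rewrite /radial_slope pE dotpZl dotpDl dotpZl /GRing.scale/=.
by field; rewrite pc gt_eqF.
Qed.

Variables (u : 'rV[R]_n -> R) (a lam beta : R) (e l c1 c2 c3 : R).
Hypothesis u2 : Ck 2 u.
Hypothesis a0 : 0 < a.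
Hypothesis lam0 : 0 < lam.
Hypothesis beta0 : 0 < beta.
Hypothesis rad : forall A B k : R, 0 <= A -> 0 <= B -> (A - B) ^+ 2 <= k ->
    k <= (c1 * (A `^ e + B `^ e) - c2 * (A `^ l + B `^ l) - c3) * k +
     ((radial_slope a lam (A ^+ 2) + radial_slope a lam (B ^+ 2)) / 2 * k +
    (radial_slope a lam (A ^+ 2) - radial_slope a lam (B ^+ 2)) * (A ^+ 2 - B ^+ 2) / 2).
Hypothesis mon : forall x y, dotp (grad u x - grad u y) (x - y) >=
  (c1 * (enorm x `^ e + enorm y `^ e)
   - c2 * (enorm x `^ l + enorm y `^ l) - c3) * enorm (x - y) ^+ 2.

Definition convexified (x : 'rV[R]_n) : R := beta * (u x + radial_well a lam x).

Let G x := beta *: (grad u x + radial_slope a lam (dotp x x) *: x).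

(** The inner product of [hx *: x - hy *: y] with [x - y] depends only on the two norms and the
    distance, and the triangle inequality is the one relation between these that [rad] asks for. *)
Let G_monotone x y : beta * dotp (x - y) (x - y) <= dotp (G x - G y) (x - y).
Proof.
rewrite /G -scalerBr dotpZl ler_pM2l//.
rewrite opprD addrACA [leRHS]dotpDl.
set hx := radial_slope _ _ _; set hy := radial_slope _ _ _.
have -> : dotp (hx *: x - hy *: y) (x - y) = (hx + hy) / 2 * dotp (x - y) (x - y) +
    (hx - hy) * (dotp x x - dotp y y) / 2.
  by rewrite !(dotpDl, dotpDr, dotpZl, dotpZr, dotpNl, dotpNr) (dotpC y x); field.
have ABk : (enorm x - enorm y) ^+ 2 <= enorm (x - y) ^+ 2.
  rewrite -[X in X <= _]real_normK ?num_real// ler_pXn2r ?nnegrE ?enorm_ge0//.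
  rewrite ler_norml; apply/andP; split.
    rewrite lerNl opprB lerBlDl -(enormN (x - y)) opprB.
    by have := enormD x (y - x); rewrite addrC subrK.
  by rewrite lerBlDl; have := enormD y (x - y); rewrite addrC subrK.
have := rad (enorm_ge0 x) (enorm_ge0 y) ABk.
rewrite !sqr_enorm -/hx -/hy => h; have := mon x y; rewrite sqr_enorm; lra.
Qed.

Let u_derivable i x : derivable u x (delta_mx ord0 i).
Proof. by case: u2 => _ /(_ i)[+ _]; exact. Qed.

Let u_C1 i : continuous (partial i u).
Proof. by case: u2 => _ /(_ i)[_ []]. Qed.

Let convexified_line y v (c : R) :
  is_derive c 1 (fun c => convexified (y + c *: v)) (dotp (G (y + c *: v)) v).
Proof.
have d1 := C1_is_derive_line y v c u_derivable u_C1.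
have d2 := is_derive_radial_well a y v c lam0.
rewrite /convexified; apply: is_derive_eq.
by rewrite /G [RHS]dotpZl [in RHS]dotpDl.
Qed.

Let line_monotone y v (s t : R) : s <= t ->
  beta * dotp v v * (t - s) <= dotp (G (y + t *: v)) v - dotp (G (y + s *: v)) v.
Proof.
rewrite le_eqVlt => /predU1P[->|st]; first by rewrite !subrr mulr0.
have ts0 : 0 < t - s by rewrite subr_gt0.
have := G_monotone (y + t *: v) (y + s *: v).
have -> : y + t *: v - (y + s *: v) = (t - s) *: v.
  by rewrite opprD addrACA subrr add0r scalerBl.
rewrite !dotpZr dotpZl dotpDl dotpNl mulrCA ler_pM2l// mulrCA mulrC.
by [].
Qed.

(** A statement about a line: along [y + c *: (x - y)] the derivative grows at rate at least
    [beta * |x - y| ^ 2]. *)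
Lemma strongly_convex_convexified : strongly_convex beta convexified.
Proof.
move=> t s x y t0 s0 ts.
have := strong_convexity1 (convexified_line y (x - y)) (@line_monotone y (x - y)) t0 s0
  ts.
rewrite scale1r scale0r addr0 [y + (x - y)]addrC subrK.
have -> : y + t *: (x - y) = t *: x + s *: y.
  have -> : s = 1 - t by rewrite -ts addrAC subrr add0r.
  by rewrite scalerBr scalerBl scale1r addrCA.
by move=> h; apply: le_trans h; rewrite le_eqVlt; apply/orP; left; apply/eqP; ring.
Qed.

(** The tangent at [0] leaves [beta / 2 * |x| ^ 2]; Young's inequality spends half of it on the
    linear term. This makes the partition functions finite. *)
Lemma convexified_lower_bound : exists b c : R, 0 < c /\
  forall x, b + c * dotp x x <= convexified x.
Proof.
exists (convexified 0 - beta^-1 * dotp (G 0) (G 0)), (beta / 4); split.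
  by rewrite divr_gt0.
move=> x; have := tangent_bound1 (convexified_line 0 x) (@line_monotone 0 x).
rewrite scale1r scale0r !add0r.
have := dotp_young (- G 0) x (_ : 0 < beta^-1); rewrite invr_gt0 => /(_ beta0).
rewrite !dotpNl dotpNr opprK.
have -> : (4 * beta^-1)^-1 = beta / 4 by field; rewrite gt_eqF.
lra.
Qed.

Lemma continuous_u : continuous u. Proof. by case: u2. Qed.

Lemma measurable_radial_well : measurable_fun setT (radial_well a lam).
Proof.
apply: measurable_funM => //.
rewrite (_ : (fun x => _) = (fun x : 'rV[R]_n => (1 + lam * dotp x x) `^ (-1))).
  apply: (measurableT_comp (@measurable_powR R _)).
  apply: measurable_funD => //; apply: measurable_funM => //.
  exact: measurable_dotp.
apply/funext => x; rewrite powR_inv1// addr_ge0// mulr_ge0 ?dotp_ge0//.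
exact: ltW.
Qed.

End convexification.

(** * Continuity of translations in L^2 *)

Section translation.
Variable R : realType.
Local Notation leb := (@lebesgue_measure R).

Lemma ge0_cvge0P (u : nat -> \bar R) : (forall k, 0 <= u k)%E ->
  u @ \oo --> (0 : \bar R)%E <->
  forall e : R, 0 < e -> \forall k \near \oo, (u k <= e%:E)%E.
Proof.
move=> u0; split=> [cu e e0|H].
  have /fine_cvgP[fu /cvgrPdist_le/(_ e e0)] := cu.
  move: fu; apply: filterS2 => k /fineK <-.
  by rewrite sub0r normrN /= ger0_norm ?fine_ge0.
apply/fine_cvgP; split.
  have := H 1 ltr01; apply: filterS => k uk.
  by rewrite ge0_fin_numE// (le_lt_trans uk)// ltry.
apply/cvgrPdist_le => e e0; have := H e e0; apply: filterS => k uk.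
have fk : u k \is a fin_num by rewrite ge0_fin_numE// (le_lt_trans uk)// ltry.
by rewrite sub0r normrN /= ger0_norm ?fine_ge0// -lee_fin fineK.
Qed.

Lemma measurable_translation1 (f : R -> R) (a : R) :
  measurable_fun (setT : set (measurableTypeR R)) f ->
  measurable_fun (setT : set (measurableTypeR R)) (fun x : R => f (x + a)).
Proof.
move=> mf; apply: (measurableT_comp mf).
exact: (@measurable_funD _ (measurableTypeR R)).
Qed.

(** Dominated convergence: [q] is a continuous function cut off outside [[-N, N]], so the integrand
    tends to [0] except where [q] may jump, and shifts by at most [1] keep it supported in
    [[-(N + 1), N + 1]]. *)
Lemma translation_truncated (N M : R) (g q : R -> R) (h : nat -> R) :
  continuous g -> (forall x, `|x| <= N -> `|g x| <= M) ->
  (forall x, `|x| <= N -> q x = g x) -> (forall x, N < `|x| -> q x = 0) ->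
  measurable_fun (setT : set (measurableTypeR R)) q ->
  h @ \oo --> (0 : R) -> (forall k, `|h k| <= 1) ->
  (\int[leb]_x `|q (x + h k) - q x|%:E)%E @[k --> \oo] --> (0 : \bar R)%E.
Proof.
move=> cg gM qg q0 mq h0 h1.
pose D : set (measurableTypeR R) := `[- (N + 1), N + 1]%classic.
have mD : measurable D by exact: measurable_itv.
have M0 x : `|q x| <= `|M|.
  have [xN|xN] := leP `|x| N; last by rewrite q0// normr0.
  by rewrite qg// (le_trans (gM _ xN))// ler_norm.
have mF k : measurable_fun (setT : set (measurableTypeR R)) (fun x => `|q (x + h k) - q
  x|%:E).
  apply/measurable_EFinP; apply: measurableT_comp => //.
  by apply: measurable_funB => //; exact: measurable_translation1.
have := @dominated_convergence _ _ _ leb setT measurableT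
  (fun k (x : measurableTypeR R) => `|q (x + h k) - q x|%:E) (fun=> 0%E)
  (fun x => (2 * `|M| * \1_D x)%:E) mF (measurable_cst _).
move=> /(_ _ _ _)[].
(* The two points where the cut-off may create a jump. *)
- exists [set - N; N]; split.
  + by apply: measurableU; exact: measurable_set1.
  + apply/eqP; rewrite -measure_le0; apply: (le_trans (measureU2 _ _ _));
    try exact: measurable_set1.
    have eN (a : measurableTypeR R) : leb [set a] = 0%E by exact: lebesgue_measure_set1.
    by rewrite -[leRHS]adde0; apply: leeD; rewrite le_eqVlt; apply/orP; left; apply/eqP;
      exact: eN.
  move=> x /= Hx; apply: contrapT => xN; apply: Hx => _.
  have xN' : `|x| != N.
    apply/eqP => E; apply: xN; case: (ger0P x) => x0.
      by right; rewrite -E ger0_norm.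
    by left; rewrite -E ltr0_norm// opprK.
  apply/fine_cvgP; split; first exact: nearW.
  rewrite /comp/= -(normr0 R); apply: cvg_norm; rewrite -(subrr (q x)); apply: cvgB;
    last exact: cvg_cst.
  have hx : x + h k @[k --> \oo] --> x.
    by rewrite -[X in _ --> X]addr0; apply: cvgD => //; exact: cvg_cst.
  have [xltN|] := ltP `|x| N.
    have nearN : \forall k \near \oo, `|x + h k| <= N.
      have /cvgrPdist_le/(_ (N - `|x|)) := h0; rewrite subr_gt0 => /(_ xltN).
      apply: filterS => k; rewrite sub0r normrN => hk.
      by rewrite (le_trans (ler_normD _ _))// addrC -lerBrDr.
    rewrite qg ?(ltW xltN)//; apply: cvg_trans (cvg_comp _ _ hx (cg x)).
    by apply: near_eq_cvg; move: nearN; apply: filterS => k hk; rewrite /= qg.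
  rewrite le_eqVlt eq_sym (negbTE xN')/= => Nx.
  rewrite (q0 x)//; apply: cvg_near_cst.
  have /cvgrPdist_lt/(_ (`|x| - N)) := h0; rewrite subr_gt0 => /(_ Nx).
  apply: filterS => k; rewrite sub0r normrN => hk; rewrite q0//.
  have := lerB_normD x (h k); lra.
- have i1 := @integrable_indic_itv R (- (N + 1)) (N + 1) true false.
  exact: (integrable_EFinZ (2 * `|M|) i1).
- apply: aeW => x k _; rewrite abse_EFin lee_fin normr_id.
  have [xD|xD] := pselect (D x).
    rewrite indicE mem_set// mulr1 (le_trans (ler_normB _ _))// mulr_natl mulr2n.
    exact: lerD.
  have Nx : N + 1 < `|x|.
    rewrite ltNge; apply/negP => xN; apply: xD.
    by rewrite /D/= in_itv/= -ler_norml.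
  rewrite indicE memNset// mulr0 q0; last first.
    have := lerB_normD x (h k); have := h1 k; lra.
  rewrite q0 ?subrr ?normr0//; lra.
by move=> _ _; rewrite integral0.
Qed.

(** An integrable function is close in [L^1] to a truncated continuous one, and the error is not
    changed by a translation. *)
Lemma translation_continuous1 (f : R -> R) (h : nat -> R) :
  leb.-integrable setT (EFin \o f) -> h @ \oo --> (0 : R) ->
  (\int[leb]_x `|f (x + h k) - f x|%:E)%E @[k --> \oo] --> (0 : \bar R)%E.
Proof.
move=> fi h0.
have mf : measurable_fun (setT : set (measurableTypeR R)) f.
  by apply/measurable_EFinP; exact: measurable_int fi.
pose E (N : nat) : set (measurableTypeR R) := `[- N%:R, N%:R]%classic.
have mE N : measurable (E N) by exact: measurable_itv.
have cut : (\int[leb]_x `|(f x * \1_(E N) x)%:E - (f x)%:E|)%E @[N --> \oo] --> (0 : \bar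
  R)%E.
  have [] // := @dominated_convergence _ _ _ leb setT measurableT
    (fun N (x : measurableTypeR R) => (f x * \1_(E N) x)%:E) (EFin \o f)
    (fun x => `|(f x)%:E|%E).
  - by move=> N; apply/measurable_EFinP; apply: measurable_funM => //;
    exact: measurable_indic.
  - exact/measurable_EFinP.
  - apply: aeW => x _; apply: cvg_near_cst.
    exists (Num.truncn `|x|).+1 => // N /= xN.
    rewrite indicE mem_set ?mulr1// /E /= in_itv/= -ler_norml.
    by rewrite (le_trans (ltW (truncnS_gt _)))// ler_nat.
  - exact: integrable_abse.
  - apply: aeW => x N _; rewrite !abse_EFin lee_fin normrM ler_piMr//.
    by rewrite indicE; case: (_ \in _); rewrite ?normr1 ?normr0.
apply/ge0_cvge0P => [k|e e0]; first by apply: integral_ge0.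
(* The distance from [f] to [q] costs two fifths, once shifted and once not; the translation of [q]
   costs the last one. *)
have e50 : 0 < e / 5 by rewrite divr_gt0.
have : \forall N \near \oo, (\int[leb]_x `|(f x * \1_(E N) x)%:E - (f x)%:E| <= (e /
  5)%:E)%E.
  by apply: ((ge0_cvge0P _).1 cut) => // k; exact: integral_ge0.
move=> [N _ /(_ N (leqnn N))/= fN].
have [||g_ [cg_ ig_ /ge0_cvge0P cvg_]] := @approximation_continuous_integrable R (E N) f
  (mE N).
- have H := @lebesgue_measure_itv R `[- N%:R, N%:R].
  apply: (@le_lt_trans _ _ (if ((- N%:R)%:E < N%:R%:E :> \bar R)%E then N%:R%:E - (-
    N%:R)%:E else 0)%E).
    by rewrite le_eqVlt; apply/orP; left; apply/eqP; exact: H.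
  by case: ifP => _; rewrite -?EFinB ltry.
- exact: integrableS fi.
have {cvg_}/(_ _ (e / 5) e50) := cvg_.
move=> /(_ (fun k => integral_ge0 _ (fun x _ => abse_ge0 _)))[n _ /(_ n (leqnn n))/= fg].
set g := g_ n in fg; have cg : continuous g by exact: cg_.
have mg : measurable_fun (setT : set (measurableTypeR R)) g.
  exact: continuous_measurable_fun.
pose q x := g x * \1_(E N) x.
have mq : measurable_fun (setT : set (measurableTypeR R)) q.
  by apply: measurable_funM => //; exact: measurable_indic.
have EE x : E N x <-> `|x| <= N%:R by rewrite /E /= in_itv/= -ler_norml.
have [M gM] : exists M, forall x, `|x| <= N%:R -> `|g x| <= M.
  have : bounded_set (g @` (E N : set R)).
    apply: compact_bounded; apply: continuous_compact; last exact: segment_compact.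
    exact: continuous_subspaceT.
  move=> [M [_ HM]]; exists (M + 1) => x /EE xN.
  by apply: (HM (M + 1)); [rewrite ltrDl|exists x].
have qE x : `|x| <= N%:R -> q x = g x.
  by move=> /EE xN; rewrite /q indicE mem_set// mulr1.
have q0 x : N%:R < `|x| -> q x = 0.
  by move=> xN; rewrite /q indicE memNset ?mulr0// => /EE; rewrite leNgt xN.
have fq : (\int[leb]_x `|f x - q x|%:E <= (2 * (e / 5))%:E)%E.
  apply: (@le_trans _ _ (\int[leb]_x (`|(f x * \1_(E N) x)%:E - (f x)%:E| +
     `|f x * \1_(E N) x - q x|%:E))%E).
    apply: ge0_le_integral => //.
    - by apply/measurable_EFinP; apply: measurableT_comp => //; exact: measurable_funB.
    - apply: emeasurable_funD.
        apply: measurableT_comp => //; apply: emeasurable_funB;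
          apply/measurable_EFinP => //.
        by apply: measurable_funM => //; exact: measurable_indic.
      apply/measurable_EFinP; apply: measurableT_comp => //; apply: measurable_funB => //.
      by apply: measurable_funM => //; exact: measurable_indic.
    move=> x _; rewrite -EFinB abse_EFin -EFinD lee_fin.
    rewrite (distrC _ (f x)) (le_trans _ (ler_normD _ _))//.
    by rewrite le_eqVlt; apply/orP; left; apply/eqP; congr (`|_|); ring.
  rewrite ge0_integralD//; last 2 first.
  - apply: measurableT_comp => //; apply: emeasurable_funB; apply/measurable_EFinP => //.
    by apply: measurable_funM => //; exact: measurable_indic.
  - apply/measurable_EFinP; apply: measurableT_comp => //; apply: measurable_funB => //.
    by apply: measurable_funM => //; exact: measurable_indic.
  rewrite mulr_natl mulr2n EFinD; apply: leeD => //.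
  apply: le_trans fg; rewrite [leRHS]integral_mkcond le_eqVlt; apply/orP; left; apply/eqP.
  apply: eq_integral => x _; rewrite patchE.
  rewrite /q indicE; case: (x \in E N); first by rewrite !mulr1.
  by rewrite !mulr0 subrr normr0.
have [K _ hK] : \forall k \near \oo, `|h k| <= 1.
  by have /cvgrPdist_le/(_ 1 ltr01) := h0; apply: filterS => k; rewrite sub0r normrN.
have := @translation_truncated N%:R M g q (fun k => h (k + K)%N) cg gM qE q0 mq.
rewrite cvg_shiftn => /(_ h0) => /(_ (fun k => hK _ (leq_addl k K))).
rewrite (cvg_shiftn K (fun k => \int[leb]_x `|q (x + h k) - q x|%:E)%E).
move=> cvq.
have nnI k : (0 <= \int[leb]_x `|q (x + h k) - q x|%:E)%E.
  by apply: integral_ge0 => x _; rewrite lee_fin.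
have := (ge0_cvge0P nnI).1 cvq (e / 5) e50; apply: filterS => k qk.
have mfk := measurable_translation1 (h k) mf.
have mqk := measurable_translation1 (h k) mq.
apply: (@le_trans _ _ (\int[leb]_x (`|f (x + h k) - q (x + h k)|%:E +
   (`|q (x + h k) - q x|%:E + `|f x - q x|%:E)))%E).
  apply: ge0_le_integral => //.
  - by apply/measurable_EFinP; apply: measurableT_comp => //; exact: measurable_funB.
  - apply: emeasurable_funD; last apply: emeasurable_funD;
      by apply/measurable_EFinP; apply: measurableT_comp => //; exact: measurable_funB.
  move=> x _; rewrite -!EFinD lee_fin (distrC (f x)).
  have -> : f (x + h k) - f x = (f (x + h k) - q (x + h k)) + ((q (x + h k) - q x) + (q x
    - f x)) by ring.
  by rewrite (le_trans (ler_normD _ _))// lerD2l ler_normD.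
have mfq : measurable_fun (setT : set (measurableTypeR R)) (fun x => `|f x - q x|%:E).
  by apply/measurable_EFinP; apply: measurableT_comp => //; exact: measurable_funB.
have m1 : measurable_fun (setT : set (measurableTypeR R)) (fun x => `|f (x + h k) - q (x
  + h k)|%:E).
  by apply/measurable_EFinP; apply: measurableT_comp => //; exact: measurable_funB.
have m2 : measurable_fun (setT : set (measurableTypeR R)) (fun x => `|q (x + h k) - q
  x|%:E).
  by apply/measurable_EFinP; apply: measurableT_comp => //; exact: measurable_funB.
rewrite (ge0_integralD leb measurableT (fun _ _ => normr_ge0 _ : (0 <= _%:E)%E) m1 (fun _
  _ => adde_ge0 (normr_ge0 _ : (0 <= _%:E)%E) (normr_ge0 _ : (0 <= _%:E)%E))
    (emeasurable_funD m2 mfq)).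
rewrite (ge0_integralD leb measurableT (fun _ _ => normr_ge0 _ : (0 <= _%:E)%E) m2 (fun _
  _ => normr_ge0 _ : (0 <= _%:E)%E) mfq).
rewrite (ge0_integral_translation1 (h k) (f := fun x => `|f x - q x|%:E))//.
have -> : e%:E = ((2 * (e / 5))%:E + ((e / 5)%:E + (2 * (e / 5))%:E))%E.
  by rewrite -!EFinD; congr EFin; field.
by apply: leeD => //; apply: leeD.
Qed.

End translation.

Section dominated.
Context d (T : measurableType d) (R : realType) (mu : {measure set T -> \bar R}).

(** The dominating function may take the value [+oo]; there no convergence is asked for. This suits
    slices, of which only almost all are integrable. *)
Lemma ge0_dominated_cvg0 (G : nat -> T -> \bar R) (g : T -> \bar R) :
  (forall k, measurable_fun setT (G k)) -> (forall k x, 0 <= G k x)%E ->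
  measurable_fun setT g -> (\int[mu]_x g x < +oo)%E ->
  (forall k x, G k x <= g x)%E ->
  (forall x, (g x < +oo)%E -> G^~ x @ \oo --> (0 : \bar R)%E) ->
  (\int[mu]_x G k x)%E @[k --> \oo] --> (0 : \bar R)%E.
Proof.
move=> mG G0 mg goo Gg cv.
have g0 x : (0 <= g x)%E by exact: le_trans (G0 0%N x) (Gg 0%N x).
have ig : mu.-integrable setT g.
  apply/integrableP; split => //.
  by under eq_integral do rewrite gee0_abs//.
have [] // := @dominated_convergence _ _ _ mu setT measurableT G (fun=> 0%E) g.
- have := integrable_ae measurableT ig; apply: filterS => x /(_ I) gx _.
  by apply: cv; rewrite -ge0_fin_numE.
- by apply: aeW => x k _; rewrite gee0_abs.
by move=> _ _; rewrite integral0.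
Qed.

End dominated.

Section translation_rV.
Variable R : realType.
Local Notation leb := (@lebesgue_measure R).

Lemma measurable_translation n (f : 'rV[R]_n -> R) (h : 'rV[R]_n) :
  measurable_fun setT f -> measurable_fun setT (fun x : 'rV[R]_n => f (x + h)).
Proof. by move=> mf; apply: (measurableT_comp mf); exact: measurable_rVD. Qed.

Lemma measurable_translation_diff n (f : 'rV[R]_n -> R) (h : 'rV[R]_n) :
  measurable_fun setT f ->
  measurable_fun setT (fun x : 'rV[R]_n => `|f (x + h) - f x|%:E).
Proof.
move=> mf; apply/measurable_EFinP; apply: measurableT_comp => //.
by apply: measurable_funB => //; exact: measurable_translation.
Qed.

Lemma integral_norm_diff_le d (T : measurableType d) (mu : {measure set T -> \bar R})
    (f g : T -> R) : measurable_fun setT f -> measurable_fun setT g ->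
  (\int[mu]_x `|f x|%:E = \int[mu]_x `|g x|%:E)%E ->
  (\int[mu]_x `|f x - g x|%:E <= 2%:E * \int[mu]_x `|g x|%:E)%E.
Proof.
move=> mf mg fg.
have mf' : measurable_fun setT (fun x => `|f x|%:E).
  by apply/measurable_EFinP; exact: measurableT_comp.
have mg' : measurable_fun setT (fun x => `|g x|%:E).
  by apply/measurable_EFinP; exact: measurableT_comp.
apply: (@le_trans _ _ (\int[mu]_x (`|f x|%:E + `|g x|%:E))%E).
  apply: ge0_le_integral => //.
  - apply/measurable_EFinP; apply: measurableT_comp => //; exact: measurable_funB.
  - exact: emeasurable_funD.
  - by move=> x _; rewrite -EFinD lee_fin ler_normB.
rewrite ge0_integralD// fg -[X in (X + X)%E]mul1e -ge0_muleDl//.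
Qed.

Lemma mul2_lty (x : \bar R) : (2%:E * x < +oo -> x < +oo)%E.
Proof. by case: x => [r _||//]; rewrite ?ltry// gt0_muley// lte_fin. Qed.

(** The shift is split into one of the first coordinate and one of the others. Each is treated on
    slices, where the difference is at most twice the slice norm, and integrated by dominated
    convergence. *)
Lemma translation_continuous_L1 n (f : 'rV[R]_n -> R) (h : nat -> 'rV[R]_n) :
  (lebesgue_rV R n).-integrable setT (EFin \o f) ->
  (forall i, h k ord0 i @[k --> \oo] --> (0 : R)) ->
  (\int[lebesgue_rV R n]_x `|f (x + h k) - f x|%:E)%E @[k --> \oo] --> (0 : \bar R)%E.
Proof.
elim: n f h => [|n IH] f h fi h0.
  apply: cvg_near_cst; apply: nearW => k.
  rewrite integral0_eq// => x _.
  have -> : x + h k = x by apply/rowP => -[].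
  by rewrite subrr normr0.
have mf : measurable_fun setT f by apply/measurable_EFinP; exact: measurable_int fi.
have mnf : measurable_fun setT (fun x => `|f x|%:E).
  by apply/measurable_EFinP; exact: measurableT_comp.
have nfoo : (\int[lebesgue_rV R n.+1]_x `|f x|%:E < +oo)%E by case/integrableP : fi.
pose a k := h k ord0 ord0; pose b k : 'rV[R]_n := \row_i h k ord0 (lift ord0 i).
have hE k : h k = cons_rV (a k, 0) + cons_rV (0, b k).
  by rewrite -cons_rVD addr0 add0r -rV_consE.
have a0 : a @ \oo --> (0 : R) by exact: h0.
have b0 i : b k ord0 i @[k --> \oo] --> (0 : R).
  by under eq_fun do rewrite mxE; exact: h0.
pose A k := (\int[lebesgue_rV R n.+1]_x `|f (x + cons_rV (a k, 0)) - f x|%:E)%E.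
pose B k := (\int[lebesgue_rV R n.+1]_x `|f (x + cons_rV (0, b k)) - f x|%:E)%E.
have m2 (c : R) (w : 'rV[R]_n) := measurable_translation_diff (cons_rV (c, w)) mf.
have mcons := @measurable_cons_rV R n.
have cA : A @ \oo --> (0 : \bar R)%E.
  pose F k (p : measurableTypeR R * 'rV[R]_n) := `|f (cons_rV p + cons_rV (a k, 0)) - f
    (cons_rV p)|%:E.
  have mF k : measurable_fun setT (F k) by apply: (measurableT_comp (m2 _ _)).
  have AE k : A k = (\int[lebesgue_rV R n]_v \int[leb]_t F k (t, v))%E.
    rewrite /A ge0_integral_rVS//.
    exact: (@fubini_tonelli _ _ _ _ R leb (lebesgue_rV R n) (F k) (mF k) (fun p =>
      normr_ge0 _ : (0 <= _%:E)%E)).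
  rewrite (_ : A = fun k => \int[lebesgue_rV R n]_v \int[leb]_t F k (t, v))%E;
    last exact/funext.
  apply: (@ge0_dominated_cvg0 _ _ _ _ _ (fun v => 2%:E * \int[leb]_t `|f (cons_rV (t,
    v))|%:E)%E).
  - by move=> k; apply: (@measurable_fun_fubini_tonelli_G _ _ _ _ _ leb (F k)) => // p;
    rewrite lee_fin.
  - by move=> k v; apply: integral_ge0 => p _; rewrite lee_fin.
  - apply: emeasurable_funM => //.
    exact: (@measurable_fun_fubini_tonelli_G _ _ _ _ _ leb (fun p => `|f (cons_rV p)|%:E)
      (measurableT_comp mnf mcons) (fun p => normr_ge0 _ : (0 <= _%:E)%E)).
  - rewrite ge0_integralZl_EFin//; last 2 first.
    + by move=> v _; apply: integral_ge0 => p _; rewrite lee_fin.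
    + exact: (@measurable_fun_fubini_tonelli_G _ _ _ _ _ leb (fun p => `|f (cons_rV
      p)|%:E)
        (measurableT_comp mnf mcons) (fun p => normr_ge0 _ : (0 <= _%:E)%E)).
    rewrite lte_mul_pinfty//.
    rewrite -(@fubini_tonelli _ _ _ _ R leb (lebesgue_rV R n) (fun p => `|f (cons_rV
      p)|%:E))//.
      by rewrite -(ge0_integral_rVS mnf).
    exact: (measurableT_comp mnf mcons).
  - move=> k v; rewrite /F.
    have mfv : measurable_fun (setT : set (measurableTypeR R)) (fun t => f (cons_rV (t,
      v))).
      apply: (measurableT_comp mf); apply: (measurableT_comp mcons).
      exact: pair2_measurable.
    under eq_integral do rewrite -cons_rVD addr0.
    apply: integral_norm_diff_le => //.
      exact: (measurable_translation1 (f := fun t => f (cons_rV (t, v)))).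
    apply: (ge0_integral_translation1 (a k) (f := fun t => `|f (cons_rV (t, v))|%:E)) =>
      //.
    by apply/measurable_EFinP; exact: measurableT_comp.
  move=> v /mul2_lty voo.
  have mfv : measurable_fun (setT : set (measurableTypeR R)) (fun t => f (cons_rV (t,
    v))).
    apply: (measurableT_comp mf); apply: (measurableT_comp mcons).
    exact: pair2_measurable.
  have ifv : leb.-integrable setT (EFin \o (fun t => f (cons_rV (t, v)))).
    by apply/integrableP; split => //; exact/measurable_EFinP.
  have := translation_continuous1 ifv a0; apply: cvg_trans; apply: near_eq_cvg.
  apply: nearW => k; apply: eq_integral => t _.
  by rewrite /F -cons_rVD addr0.
have cB : B @ \oo --> (0 : \bar R)%E.
  pose F k (p : measurableTypeR R * 'rV[R]_n) := `|f (cons_rV p + cons_rV (0, b k)) - f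
    (cons_rV p)|%:E.
  have mF k : measurable_fun setT (F k) by apply: (measurableT_comp (m2 _ _)).
  rewrite (_ : B = fun k => \int[leb]_t \int[lebesgue_rV R n]_v F k (t, v))%E; last first.
    by apply/funext => k; rewrite /B ge0_integral_rVS.
  apply: (@ge0_dominated_cvg0 _ _ _ leb _ (fun t => 2%:E * \int[lebesgue_rV R n]_v `|f
    (cons_rV (t, v))|%:E)%E).
  - by move=> k; apply: (@measurable_fun_fubini_tonelli_F _ _ _ _ _ (lebesgue_rV R n) (F
    k)) => // p; rewrite lee_fin.
  - by move=> k v; apply: integral_ge0 => p _; rewrite lee_fin.
  - apply: emeasurable_funM => //;
    exact: (measurable_integral_cons mnf (fun p => normr_ge0 _ : (0 <= _%:E)%E)).
  - rewrite ge0_integralZl_EFin//; last 2 first.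
    + by move=> v _; apply: integral_ge0 => p _; rewrite lee_fin.
    + exact: (measurable_integral_cons mnf (fun p => normr_ge0 _ : (0 <= _%:E)%E)).
    by rewrite lte_mul_pinfty// -(ge0_integral_rVS mnf).
  - move=> k t; rewrite /F.
    have mft : measurable_fun setT (fun v => f (cons_rV (t, v))).
      apply: (measurableT_comp mf); apply: (measurableT_comp mcons).
      exact: pair1_measurable.
    under eq_integral do rewrite -cons_rVD addr0.
    apply: integral_norm_diff_le => //.
      exact: (measurable_translation (b k) mft).
    apply: (ge0_integral_translation (b k) (f := fun v => `|f (cons_rV (t, v))|%:E)) =>
      //.
    by apply/measurable_EFinP; exact: measurableT_comp.
  move=> t /mul2_lty too.
  have mft : measurable_fun setT (fun v => f (cons_rV (t, v))).
    apply: (measurableT_comp mf); apply: (measurableT_comp mcons).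
    exact: pair1_measurable.
  have ift : (lebesgue_rV R n).-integrable setT (EFin \o (fun v => f (cons_rV (t, v)))).
    by apply/integrableP; split => //; exact/measurable_EFinP.
  have := IH _ b ift b0; apply: cvg_trans; apply: near_eq_cvg.
  apply: nearW => k; apply: eq_integral => v _.
  by rewrite /F -cons_rVD addr0.
have ABk k : (\int[lebesgue_rV R n.+1]_x `|f (x + h k) - f x|%:E <= A k + B k)%E.
  pose c := cons_rV (0, b k).
  have mA : measurable_fun setT (fun x : 'rV[R]_n.+1 => `|f (x + c + cons_rV (a k, 0)) -
    f (x + c)|%:E).
    apply: (measurableT_comp (m2 (a k) 0) (measurable_rVD _ _)) => //.
  rewrite /A -(ge0_integral_translation c (m2 _ _))//.
  rewrite /B -/c -ge0_integralD//; last exact: m2.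
  apply: ge0_le_integral => //.
  - exact: measurable_translation_diff.
  - by apply: emeasurable_funD => //; exact: m2.
  move=> x _; rewrite -EFinD lee_fin.
  have -> : x + h k = x + c + cons_rV (a k, 0) by rewrite hE -addrA (addrC (cons_rV _)).
  by rewrite -[X in `|X|](subrKA (f (x + c))) ler_normD.
apply: (@squeeze_cvge _ _ _ _ (fun=> 0%E) _ (fun k => A k + B k)%E).
- by apply: nearW => k; rewrite ABk integral_ge0.
- exact: cvg_cst.
- by rewrite -[X in _ --> X](adde0 0%E); apply: cvgeD.
Qed.

(** Transfers continuity of translations from [L^1] to [L^2]: the signed square [f * |f|] is
    integrable when [f ^ 2] is. *)
Lemma sqr_diff_le (x y : R) : (x - y) ^+ 2 <= 2 * `|x * `|x| - y * `|y| |.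
Proof.
case: (ger0P x) => x0; case: (ger0P y) => y0.
- have -> : x * x - y * y = (x - y) * (x + y) by ring.
  rewrite normrM (ger0_norm (addr_ge0 x0 y0)) -[leLHS]real_normK ?num_real// expr2.
  have : `|x - y| <= x + y.
    by rewrite (le_trans (ler_normB _ _))// !ger0_norm.
  have := normr_ge0 (x - y); nra.
- have := sqr_ge0 (x + y); have := sqr_ge0 x; have := sqr_ge0 y;
  rewrite !expr2 => hx hy hxy.
  by rewrite ger0_norm; lra.
- have := sqr_ge0 (x + y); have := sqr_ge0 x; have := sqr_ge0 y;
  rewrite !expr2 => hx hy hxy.
  by rewrite ler0_norm; lra.
- have -> : x * - x - y * - y = - ((x - y) * (x + y)) by ring.
  rewrite normrN normrM -[leLHS]real_normK ?num_real// expr2.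
  have : `|x - y| <= `|x + y|.
    rewrite (le_trans (ler_normB _ _))// !ltr0_norm ?opprD//; lra.
  have := normr_ge0 (x - y); nra.
Qed.

(** By contradiction, the bound uniform in [h] becomes one along a sequence of shifts tending to
    [0]. *)
Lemma translation_continuous_L2 n (f : 'rV[R]_n -> R) (e : R) :
  measurable_fun setT f ->
  (lebesgue_rV R n).-integrable setT (EFin \o (fun x => f x ^+ 2)) -> 0 < e ->
  exists2 r : R, 0 < r & forall h : 'rV[R]_n, (forall i, `|h ord0 i| <= r) ->
    (\int[lebesgue_rV R n]_x ((f (x + h) - f x) ^+ 2)%:E <= e%:E)%E.
Proof.
move=> mf fi e0; apply: contrapT => H.
have /choice[h hP] : forall k : nat, exists h : 'rV[R]_n, (forall i, `|h ord0 i| <=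
  k.+1%:R^-1) /\
    (e%:E < \int[lebesgue_rV R n]_x ((f (x + h) - f x) ^+ 2)%:E)%E.
  move=> k; apply: contrapT => Hk; apply: H; exists k.+1%:R^-1; first by rewrite invr_gt0.
  move=> h hk; rewrite leNgt; apply/negP => eh; apply: Hk; exists h; split => //.
pose F x := f x * `|f x|.
have mF : measurable_fun setT F by apply: measurable_funM => //; exact: measurableT_comp.
have iF : (lebesgue_rV R n).-integrable setT (EFin \o F).
  apply: le_integrable fi => //; first exact/measurable_EFinP.
  by move=> x _; rewrite !abse_EFin lee_fin /F normrM normr_id -expr2 real_normK
    ?num_real// ger0_norm ?sqr_ge0.
have h0 i : h k ord0 i @[k --> \oo] --> (0 : R).
  apply/cvgrPdist_le => e' e'0; near=> k; rewrite sub0r normrN (le_trans ((hP k).1 i))//.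
  rewrite invf_ple ?posrE//; apply: (@le_trans _ _ (Num.truncn e'^-1).+1%:R);
    first exact/ltW/truncnS_gt.
  by rewrite ler_nat ltnS; near: k; exact: nbhs_infty_ge.
have Fe0 k : (0 <= \int[lebesgue_rV R n]_x `|F (x + h k) - F x|%:E)%E by apply:
  integral_ge0.
have e20 : 0 < e / 2 by rewrite divr_gt0.
have [k _ /(_ k (leqnn k))/= Fk] := (ge0_cvge0P Fe0).1 (translation_continuous_L1 iF h0)
  (e / 2) e20.
have := (hP k).2; rewrite ltNge => /negP; apply.
apply: (@le_trans _ _ (\int[lebesgue_rV R n]_x (2%:E * `|F (x + h k) - F x|%:E))%E).
  have mfh := measurable_translation (h k) mf.
  apply: ge0_le_integral => //.
  - by move=> x _; rewrite lee_fin sqr_ge0.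
  - by apply/measurable_EFinP; apply: measurable_funX; exact: measurable_funB.
  - by apply: emeasurable_funM => //; exact: measurable_translation_diff.
  by move=> x _; rewrite -EFinM lee_fin; exact: sqr_diff_le.
rewrite ge0_integralZl_EFin//; last exact: measurable_translation_diff.
have -> : e%:E = (2%:E * (e / 2)%:E)%E by rewrite -EFinM; congr EFin; field.
by rewrite lee_pmul2l// lte_fin.
Unshelve. all: by end_near. Qed.

End translation_rV.

(** * Mollification *)

Section smooth1.
Variable R : realType.
Implicit Types f g : R -> R.

Fixpoint smooth1 (k : nat) f : Prop :=
  if k is k'.+1 then
    exists f' : R -> R, (forall x : R, is_derive x 1 f (f' x)) /\ smooth1 k' f'
  else continuous f.

Lemma smooth1S k f : smooth1 k.+1 f -> smooth1 k f.
Proof.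
elim: k f => [|k IH] f [f' [df sf']].
  move=> x; apply: differentiable_continuous; apply/derivable1_diffP.
  exact: ex_derive.
by exists f'; split => //; exact: IH.
Qed.

Lemma smooth1_continuous k f : smooth1 k f -> continuous f.
Proof. by elim: k f => // k IH f /smooth1S; exact: IH. Qed.

Lemma smooth1D k f g : smooth1 k f -> smooth1 k g -> smooth1 k (fun x => f x + g x).
Proof.
elim: k f g => [|k IH] f g; first by move=> cf cg x; apply: cvgD; [exact: cf|exact: cg].
move=> [f' [df sf]] [g' [dg sg]]; exists (fun x => f' x + g' x); split; last exact: IH.
by move=> x; apply: is_derive_eq.
Qed.

Lemma smooth1M k f g : smooth1 k f -> smooth1 k g -> smooth1 k (fun x => f x * g x).
Proof.
elim: k f g => [|k IH] f g; first by move=> cf cg x; apply: cvgM; [exact: cf|exact: cg].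
move=> sf0 sg0; have sfk := smooth1S sf0; have sgk := smooth1S sg0.
move: sf0 sg0 => [f' [df sf]] [g' [dg sg]].
exists (fun x => f x * g' x + g x * f' x); split; last by apply: smooth1D; exact: IH.
by move=> x; apply: is_derive_eq; rewrite /GRing.scale/=.
Qed.

Lemma smooth1_cst k (c : R) : smooth1 k (fun=> c).
Proof.
elim: k c => [|k IH] c; first by move=> x; exact: cst_continuous.
by exists (fun=> 0); split => // x; exact: is_derive_cst.
Qed.

Lemma smooth1_affine k f (a b : R) : smooth1 k f -> smooth1 k (fun x => f (a * x + b)).
Proof.
have daff (x : R) : is_derive x 1 (fun x => a * x + b) a.
  by apply: is_derive_eq; rewrite /GRing.scale/= mulr1 addr0.
elim: k f => [|k IH] f.
  move=> cf x; apply: continuous_comp; last exact: cf.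
  apply: differentiable_continuous; apply/derivable1_diffP; exact: ex_derive.
move=> [f' [df sf]]; exists (fun x => a * f' (a * x + b)); split.
  move=> x; have := @is_derive1_comp R f (fun x => a * x + b) x _ _ (df _) (daff x).
  by rewrite mulrC.
apply: smooth1M; last exact: IH.
exact: smooth1_cst.
Qed.

(* A family of functions which are smooth up to [0] since it is stable under
   differentiation. *)
Definition flat (p : {poly R}) (x : R) : R :=
  if 0 < x then p.[x^-1] * expR (- x^-1) else 0.

Lemma horner_bound (p : {poly R}) (y : R) : 1 <= y ->
  `|p.[y]| <= (\sum_(i < size p) `|p`_i|) * y ^+ (size p).
Proof.
move=> y1; rewrite horner_coef mulr_suml (le_trans (ler_norm_sum _ _ _))//.
apply: ler_sum => i _; rewrite normrM ler_wpM2l// normrX ger0_norm ?(le_trans ler01)//.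
by rewrite ler_weXn2l// ltnW.
Qed.

(** The inequality [z <= exp z] at [z = y / M], raised to the power [M]. *)
Lemma pow_expR_bound (M : nat) (y : R) : 0 < y -> (0 < M)%N ->
  y ^+ M * expR (- y) <= M%:R ^+ M.
Proof.
move=> y0 M0; have M0' : 0 < (M%:R : R) by rewrite ltr0n.
have h : y / M%:R <= expR (y / M%:R).
  by rewrite (le_trans _ (expR_ge1Dx _))// lerDr.
have : (y / M%:R) ^+ M <= expR y.
  have -> : expR y = expR (y / M%:R) ^+ M.
    by rewrite -expRM_natl mulr_natl -mulr_natr divfK// gt_eqF.
  by rewrite ler_pXn2r// nnegrE ?expR_ge0// divr_ge0// ltW.
rewrite expRN -ler_pdivlMr ?invr_gt0 ?expR_gt0// invrK.
by rewrite expr_div_n ler_pdivrMr ?exprn_gt0// mulrC.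
Qed.

(** A quadratic bound is what differentiability at [0], with derivative [0], requires. *)
Lemma flat_near0 (p : {poly R}) : exists2 C : R, 0 < C &
  forall x, x <= 1 -> `|flat p x| <= C * x ^+ 2.
Proof.
(* The exponent exceeds the growth of [p] by [2], to leave the factor [x ^ 2]. *)
pose S := \sum_(i < size p) `|p`_i|; pose M := (size p).+2.
have S0 : 0 <= S by apply: sumr_ge0.
exists (S * M%:R ^+ M + 1); first by rewrite ltr_wpDl// mulr_ge0// exprn_ge0.
move=> x x1; rewrite /flat; case: ifPn => [x0|_]; last first.
  by rewrite normr0 mulr_ge0 ?sqr_ge0// addr_ge0// mulr_ge0// exprn_ge0.
have y1 : 1 <= x^-1 by rewrite invf_ge1.
have y0 : 0 < x^-1 by rewrite invr_gt0.
rewrite normrM (ger0_norm (expR_ge0 _)).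
apply: (@le_trans _ _ (S * (x^-1 ^+ size p * expR (- x^-1)))).
  by rewrite mulrA ler_wpM2r ?expR_ge0// horner_bound.
have -> : x^-1 ^+ size p * expR (- x^-1) = (x^-1 ^+ M * expR (- x^-1)) * x ^+ 2.
  rewrite /M 2!exprSr; set A := x^-1 ^+ size p; set E := expR _.
  by field; rewrite gt_eqF.
rewrite mulrA ler_wpM2r ?sqr_ge0// ler_wpDr// ler_wpM2l//.
exact: pow_expR_bound.
Qed.

Lemma flat_bounded (p : {poly R}) : exists2 C : R, 0 < C & forall x, `|flat p x| <= C.
Proof.
have [C C0 HC] := flat_near0 p.
exists (C + \sum_(i < size p) `|p`_i|); first by rewrite ltr_wpDr// sumr_ge0.
move=> x; have [x1|x1] := leP x 1.
  rewrite /flat; case: ifPn => [x0|_]; last first.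
    by rewrite normr0 addr_ge0 ?sumr_ge0// ltW.
  rewrite -[_ * _](_ : flat p x = _); last by rewrite /flat x0.
  rewrite ler_wpDr ?sumr_ge0// (le_trans (HC _ x1))// ler_piMr ?(ltW C0)//.
  by rewrite exprn_ile1// ltW.
have x0 : 0 < x by rewrite (lt_trans _ x1).
rewrite /flat x0 ler_wpDl ?(ltW C0)// normrM (ger0_norm (expR_ge0 _)).
rewrite -[leRHS]mulr1; apply: ler_pM => //.
  rewrite horner_coef (le_trans (ler_norm_sum _ _ _))//.
  apply: ler_sum => i _; rewrite normrM ler_piMr// normrX exprn_ile1//.
  by rewrite ger0_norm ?invr_ge0 ?ltW// invf_lt1.
by rewrite -expR0 ler_expR oppr_le0 invr_ge0 ltW.
Qed.

(** The derivative of [p(1/x) * exp(-1/x)] is [x^-2 * (p - p')(1/x) * exp(-1/x)], again of the same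
    form. *)
Definition flat_poly_derive (p : {poly R}) : {poly R} := 'X^2 * (p - p^`()).

Lemma is_derive_flat (p : {poly R}) (x : R) :
  is_derive x 1 (flat p) (flat (flat_poly_derive p) x).
Proof.
have [x0|x0|->] := ltgtP x 0.
- rewrite /flat ltNge (ltW x0)/=.
  have d0 : is_derive x 1 (fun _ : R => 0 : R) 0 by exact: is_derive_cst.
  apply: near_eq_is_derive d0.
  have := lt_nbhsl x0; apply: filterS => y y0.
  by rewrite ltNge (ltW y0).
- have xn : x != 0 by rewrite gt_eqF.
  have dV : is_derive x 1 (fun y : R => y^-1) (- x ^- 2).
    by have := is_deriveV xn (is_derive_id x (1 : R)); rewrite scaler1.
  have dp := is_derive1_comp (is_derive_poly p x^-1) dV.
  have dN := is_deriveN dV.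
  have de := @is_derive1_comp R expR (fun y : R => - y^-1) x _ _ (is_derive_expR (-
    x^-1)) dN.
  have dm := is_deriveM dp de.
  have d0 : is_derive x 1 (fun y => p.[y^-1] * expR (- y^-1)) (flat (flat_poly_derive p)
    x).
    apply: is_derive_eq.
    rewrite /flat x0 /flat_poly_derive /GRing.scale/= hornerM hornerXn hornerD hornerN.
    by field.
  apply: near_eq_is_derive d0.
  apply/nbhs_ballP; exists x => //= y; rewrite /ball/= => xy.
  rewrite /flat (_ : 0 < y)//.
  by have := le_lt_trans (ler_norm _) xy; lra.
- rewrite [X in is_derive _ _ _ X](_ : _ = 0); last by rewrite /flat ltxx.
  apply: is_derive_eps => e e0; have [C C0 HC] := flat_near0 p.
  exists (Num.min 1 (e / C)); first by rewrite lt_min ltr01 divr_gt0.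
  move=> h; rewrite lt_min => /andP[h1 h2].
  rewrite add0r {2}/flat ltxx subr0 mul0r subr0.
  rewrite (le_trans (HC _ _))//; first by rewrite (le_trans (ler_norm _))// ltW.
  rewrite -[h ^+ 2]real_normK ?num_real// expr2 mulrA ler_wpM2r//.
  by rewrite mulrC -ler_pdivlMr// ltW.
Qed.

Lemma smooth1_flat k (p : {poly R}) : smooth1 k (flat p).
Proof.
elim: k p => [|k IH] p.
  move=> x; apply: differentiable_continuous; apply/derivable1_diffP.
  by have := is_derive_flat p x => -[].
by exists (flat (flat_poly_derive p)); split => [x|]; [exact: is_derive_flat|exact: IH].
Qed.

Lemma flat1_ge0 x : 0 <= flat 1 x.
Proof. by rewrite /flat; case: ifP => // _; rewrite hornerC mul1r expR_ge0. Qed.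

Lemma flat1_gt0 x : 0 < x -> 0 < flat 1 x.
Proof. by rewrite /flat => ->; rewrite hornerC mul1r expR_gt0. Qed.

Lemma flat1_eq0 x : x <= 0 -> flat 1 x = 0.
Proof. by rewrite /flat ltNge => ->. Qed.

End smooth1.

(** * Bounded functions with a quadratic expansion *)

Section C11.
Variables (R : realType) (n : nat).
Implicit Types (x h z : 'rV[R]_n) (a b : 'rV[R]_n -> R) (Da Db : 'rV[R]_n -> 'rV[R]_n).

Definition l1norm h : R := \sum_i `|h ord0 i|.

Lemma l1norm_ge0 h : 0 <= l1norm h. Proof. by apply: sumr_ge0. Qed.

Lemma le_l1norm h i : `|h ord0 i| <= l1norm h.
Proof. by rewrite /l1norm (bigD1 i)//= lerDl sumr_ge0. Qed.

Lemma dotp_l1norm (M : R) (v h : 'rV[R]_n) : (forall i, `|v ord0 i| <= M) ->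
  `|dotp v h| <= M * l1norm h.
Proof.
move=> vM; rewrite /dotp mulr_sumr (le_trans (ler_norm_sum _ _ _))//.
by apply: ler_sum => i _; rewrite normrM ler_wpM2r.
Qed.

Lemma l1norm_delta (s : R) i : l1norm (s *: delta_mx ord0 i) = `|s|.
Proof.
rewrite /l1norm (bigD1 i)//= big1 ?addr0; first by rewrite !mxE !eqxx mulr1.
by move=> j ji; rewrite !mxE (negbTE ji) andbF mulr0 normr0.
Qed.

Lemma dotp_delta (s : R) (v : 'rV[R]_n) i :
  dotp v (s *: delta_mx ord0 i) = s * v ord0 i.
Proof.
rewrite dotpZr /dotp (bigD1 i)//= big1 ?addr0; first by rewrite !mxE !eqxx mulr1.
by move=> j ji; rewrite !mxE (negbTE ji) andbF mulr0.
Qed.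

(* [Da] plays the role of the gradient of [a]. *)
Definition C11 a Da := exists2 M : R, 0 <= M &
  [/\ forall x, `|a x| <= M, forall x i, `|Da x ord0 i| <= M &
      forall x h, `|a (x + h) - a x - dotp (Da x) h| <= M * l1norm h ^+ 2].

(** For steps of length at most [1] the quadratic remainder is below a linear one; for longer steps
    the bound on [a] is enough. *)
Lemma C11_lipschitz a Da : C11 a Da ->
  exists2 M : R, 0 <= M & forall x h, `|a (x + h) - a x| <= M * l1norm h.
Proof.
move=> [M M0 [aM DM aE]]; exists (2 * M); first by rewrite mulr_ge0.
move=> x h; have N0 := l1norm_ge0 h.
have [N1|N1] := leP (l1norm h) 1; last first.
  have : `|a (x + h) - a x| <= 2 * M.
    by rewrite (le_trans (ler_normB _ _))// mulr_natl mulr2n lerD.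
  by move=> /le_trans; apply; rewrite ler_peMr ?mulr_ge0// ltW.
have := aE x h; have := dotp_l1norm h (DM x) => h1 h2.
have -> : a (x + h) - a x = (a (x + h) - a x - dotp (Da x) h) + dotp (Da x) h by ring.
rewrite (le_trans (ler_normD _ _))// (_ : 2 * M * _ = M * l1norm h + M * l1norm h);
  last by ring.
by apply: lerD => //; rewrite (le_trans h2)// ler_wpM2l// expr2 ler_piMr.
Qed.

Lemma l1norm_lipschitz_continuous a (M : R) : 0 <= M ->
  (forall x h, `|a (x + h) - a x| <= M * l1norm h) -> continuous a.
Proof.
move=> M0 aL; apply/continuous_rVP => x e e0.
have d0 : 0 < M * n%:R + 1 by rewrite ltr_wpDl// mulr_ge0.
exists (e / (M * n%:R + 1)); first by rewrite divr_gt0.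
move=> y xy; have := aL x (y - x); rewrite addrCA subrr addr0 distrC => /le_lt_trans;
  apply.
apply: (@le_lt_trans _ _ (M * (n%:R * (e / (M * n%:R + 1))))).
  apply: ler_wpM2l => //; rewrite mulr_natl -[X in _ *+ X]card_ord -sumr_const.
  by apply: ler_sum => i _; rewrite !mxE distrC ltW.
by rewrite mulrA mulrCA gtr_pMr// ltr_pdivrMr// mul1r ltrDl.
Qed.

Lemma C11_continuous a Da : C11 a Da -> continuous a.
Proof. by move=> /C11_lipschitz[M M0]; exact: l1norm_lipschitz_continuous. Qed.

Lemma C11_cst (c : R) : C11 (fun=> c) (fun=> 0).
Proof.
exists `|c|; first by [].
split => // [x i|x h]; first by rewrite mxE normr0.
rewrite subrr sub0r /dotp big1 ?oppr0 ?normr0 ?mulr_ge0 ?exprn_ge0 ?l1norm_ge0// => i _.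
by rewrite mxE mul0r.
Qed.

Lemma C11M a Da b Db : C11 a Da -> C11 b Db ->
  C11 (fun x => a x * b x) (fun x => a x *: Db x + b x *: Da x).
Proof.
move=> ca cb; have [L L0 aL] := C11_lipschitz ca.
move: ca cb => [M M0 [aM DaM aE]] [N N0 [bN DbN bE]].
exists (2 * (M * N) + (2 * (M * N) + L * N)).
  by rewrite addr_ge0// ?addr_ge0 ?mulr_ge0.
split.
- move=> x; rewrite normrM (le_trans (ler_pM _ _ (aM x) (bN x)))//.
  have : 0 <= M * N by rewrite mulr_ge0.
  have : 0 <= L * N by rewrite mulr_ge0.
  lra.
- move=> x i; rewrite !mxE (le_trans (ler_normD _ _))// !normrM.
  have h1 := ler_pM (normr_ge0 _) (normr_ge0 _) (aM x) (DbN x i).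
  have h2 := ler_pM (normr_ge0 _) (normr_ge0 _) (bN x) (DaM x i).
  have : 0 <= M * N by rewrite mulr_ge0.
  have : 0 <= L * N by rewrite mulr_ge0.
  rewrite mulrC in h2; lra.
- move=> x h; rewrite dotpDl !dotpZl.
  have -> : a (x + h) * b (x + h) - a x * b x - (a x * dotp (Db x) h + b x * dotp (Da x)
    h) =
    a (x + h) * (b (x + h) - b x - dotp (Db x) h) + b x * (a (x + h) - a x - dotp (Da x)
      h) +
    (a (x + h) - a x) * dotp (Db x) h by ring.
  have h1 := ler_pM (normr_ge0 _) (normr_ge0 _) (aM (x + h)) (bE x h).
  have h2 := ler_pM (normr_ge0 _) (normr_ge0 _) (bN x) (aE x h).
  have h3 := ler_pM (normr_ge0 _) (normr_ge0 _) (aL x h) (dotp_l1norm h (DbN x)).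
  rewrite (le_trans (ler_normD _ _))//.
  have : `|a (x + h) * (b (x + h) - b x - dotp (Db x) h) + b x * (a (x + h) - a x - dotp
    (Da x) h)|
     <= M * (N * l1norm h ^+ 2) + N * (M * l1norm h ^+ 2).
    by rewrite (le_trans (ler_normD _ _))// !normrM lerD.
  rewrite [`|_ * dotp _ _|]normrM; move: h3; set k := l1norm h.
  have : 0 <= M * N * k ^+ 2 by rewrite mulr_ge0 ?sqr_ge0 ?mulr_ge0.
  have -> : L * k * (N * k) = L * N * k ^+ 2 by ring.
  have -> : (2 * (M * N) + (2 * (M * N) + L * N)) * k ^+ 2 = 4 * (M * N * k ^+ 2) + L * N
    * k ^+ 2 by ring.
  have -> : M * (N * k ^+ 2) + N * (M * k ^+ 2) = 2 * (M * N * k ^+ 2) by ring.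
  lra.
Qed.

Lemma C11_prod (I : Type) (s : seq I) (F : I -> 'rV[R]_n -> R) :
  (forall i, exists D, C11 (F i) D) -> exists D, C11 (fun x => \prod_(i <- s) F i x) D.
Proof.
move=> HF; elim: s => [|i s [D HD]].
  by exists (fun=> 0); under eq_fun do rewrite big_nil; exact: C11_cst.
have [E HE] := HF i.
exists (fun x => F i x *: D x + (\prod_(i <- s) F i x) *: E x).
by under eq_fun do rewrite big_cons; exact: C11M.
Qed.

Lemma C11_flat (p : {poly R}) (c e : R) (i : 'I_n) :
  C11 (fun x => flat p (c * x ord0 i + e))
    (fun x => (c * flat (flat_poly_derive p) (c * x ord0 i + e)) *: delta_mx ord0 i).
Proof.
have [M1 M10 HM1] := flat_bounded p.
have [M2 M20 HM2] := flat_bounded (flat_poly_derive p).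
have [M3 M30 HM3] := flat_bounded (flat_poly_derive (flat_poly_derive p)).
have c2 : 0 <= `|c| * M2 by apply: mulr_ge0 => //; exact: ltW.
have c3 : 0 <= c ^+ 2 * M3 by apply: mulr_ge0; [exact: sqr_ge0|exact: ltW].
exists (M1 + (`|c| * M2 + c ^+ 2 * M3)).
  by apply: addr_ge0; [exact: ltW|exact: addr_ge0].
split.
- by move=> x; rewrite (le_trans (HM1 _))// lerDl addr_ge0.
- move=> x j; rewrite !mxE eqxx/= normrM.
  have : `|c * flat (flat_poly_derive p) (c * x ord0 i + e)| <= `|c| * M2.
    by rewrite normrM ler_wpM2l.
  have : `|(j == i)%:R : R| <= 1 by case: eqP => _; rewrite ?normr1 ?normr0.
  move=> h1 h2; have := ler_pM (normr_ge0 _) (normr_ge0 _) h2 h1.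
  by rewrite mulr1 => /le_trans; apply; lra.
move=> x h; rewrite dotpC dotp_delta !mxE.
set t := c * x ord0 i + e; pose s := c * h ord0 i.
have -> : c * (x ord0 i + h ord0 i) + e = t + s by rewrite /t /s; ring.
have [c1 [hc1 _] E1] := mean_value t (t + s) (is_derive_flat p).
have [c4 [hc4 _] E2] := mean_value t c1 (is_derive_flat (flat_poly_derive p)).
have -> : flat p (t + s) - flat p t - c * flat (flat_poly_derive p) t * h ord0 i =
  flat (flat_poly_derive (flat_poly_derive p)) c4 * (c1 - t) * s by rewrite E1 -E2 /s;
    ring.
rewrite normrM [X in X * _]normrM.
have ts : `|c1 - t| <= `|s| by rewrite (le_trans hc1)// addrAC subrr add0r.
have h1 : `|flat (flat_poly_derive (flat_poly_derive p)) c4| * `|c1 - t| <= M3 * `|s| by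
  apply: ler_pM.
have h2 : M3 * `|s| * `|s| <= c ^+ 2 * M3 * l1norm h ^+ 2.
  rewrite -mulrA -expr2 real_normK ?num_real// /s exprMn mulrA [M3 * _]mulrC ler_wpM2l//.
  by rewrite -real_normK ?num_real// ler_pXn2r ?nnegrE ?l1norm_ge0// le_l1norm.
apply: (@le_trans _ _ (M3 * `|s| * `|s|)); first by rewrite ler_wpM2r.
apply: (le_trans h2); rewrite ler_wpM2r ?sqr_ge0//; lra.
Qed.

Lemma C11_shift a Da x : C11 a Da -> C11 (fun y => a (y - x)) (fun y => Da (y - x)).
Proof.
by move=> [M M0 [aM DM aE]]; exists M => //; split => [y|y i|y h] //;
  rewrite [y + h - x]addrAC.
Qed.

Lemma C11_partial a Da i x : C11 a Da ->
  derivable a x (delta_mx ord0 i) /\ partial i a x = Da x ord0 i.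
Proof.
move=> [M M0 [_ _ aE]].
have cv : h^-1 *: ((a \o shift x) (h *: delta_mx ord0 i) - a x) @[h --> 0^'] --> Da x
  ord0 i.
  apply/cvgrPdist_le => e e0.
  near=> h.
  have h0 : h != 0 by near: h; exact: nbhs_dnbhs_neq.
  have hlt : `|h| < e / (M + 1).
    by near: h; apply: dnbhs0_lt; rewrite divr_gt0// ltr_wpDl.
  rewrite /= /shift /= -(ler_pM2r (_ : 0 < `|h|)) ?normr_gt0// -normrM.
  rewrite mulrBl [_^-1 *: _]mulrC -mulrA mulVf// mulr1 distrC (addrC _ x).
  have := aE x (h *: delta_mx ord0 i); rewrite l1norm_delta dotp_delta mulrC => H.
  rewrite [Da _ _ _ * _]mulrC in H *; apply: (le_trans H).
  rewrite expr2 mulrA ler_wpM2r//.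
  move: hlt; rewrite ltr_pdivlMr ?ltr_wpDl// => /ltW; apply: le_trans.
  by rewrite mulrC ler_wpM2l// lerDl.
split; first by apply/cvg_ex; exists (Da x ord0 i).
exact: cvg_lim cv.
Unshelve. all: by end_near. Qed.

(** A zero of a nonnegative function is a minimum. For the mollifier it places the support of the
    gradient inside that of the function. *)
Lemma C11_gradient_at_zero a Da z : C11 a Da -> (forall x, 0 <= a x) ->
  a z = 0 -> Da z = 0.
Proof.
move=> [M M0 [_ _ aE]] a0 az; apply/rowP => i; rewrite mxE; apply/eqP/negPn/negP => D0.
set D := Da z ord0 i in D0.
have M1 : 0 < M + 1 by rewrite ltr_wpDl.
(* With [b = D / (M + 1)], the expansion bounds the value after this step by
   [- (M + 1) * b ^ 2 + M * b ^ 2], which is negative. *)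
have := aE z ((- (D / (M + 1))) *: delta_mx ord0 i).
rewrite l1norm_delta dotp_delta az subr0 -/D.
have := a0 (z + (- (D / (M + 1))) *: delta_mx ord0 i).
set A := a _ => A0; rewrite normrN real_normK ?num_real// => h.
have := le_trans (ler_norm _) h.
have D2 : 0 < (D / (M + 1)) ^+ 2.
  by rewrite exprn_even_gt0//= mulf_neq0// invr_neq0// gt_eqF.
have -> : - (D / (M + 1)) * D = - ((M + 1) * (D / (M + 1)) ^+ 2) by field; rewrite gt_eqF.
lra.
Qed.

End C11.

Section Ck.
Variables (R : realType) (n : nat).

Lemma derivable_of_line (f : 'rV[R]_n -> R) (v x : 'rV[R]_n) (l : R) :
  is_derive (0 : R) (1 : R) (fun c : R => f (x + c *: v)) l -> derivable f x v /\ 'D_v f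
    x = l.
Proof.
have E : (fun h : R => h^-1 *: (((fun c => f (x + c *: v)) \o shift 0) (h *: 1) - f (x +
  0 *: v))) =
         (fun h : R => h^-1 *: ((f \o shift x) (h *: v) - f x)).
  apply/funext => h; rewrite scale0r addr0; congr (_ *: (f _ - _)).
  by rewrite /shift/= [h *: 1]mulr1 addr0 addrC.
by move=> [d1 <-]; rewrite /derivable -E; split => //; rewrite /derive -E.
Qed.

Lemma continuous_prod (I : Type) (s : seq I) (F : I -> 'rV[R]_n -> R) :
  (forall i, continuous (F i)) -> continuous (fun x => \prod_(i <- s) F i x).
Proof.
move=> cF; elim: s => [|i s IH] x.
  by under eq_fun do rewrite big_nil; exact: cst_continuous.
under eq_fun do rewrite big_cons.
by apply: (@continuousM _ _ (F i)); [exact: cF|exact: IH].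
Qed.

(** A partial derivative of a product of functions of one coordinate replaces one factor by its
    derivative, so the class of such products is stable. *)
Lemma Ck_tensor k (c : 'I_n -> R -> R) (a : R) : (forall i, smooth1 k (c i)) ->
  Ck k (fun x => a * \prod_i c i (x ord0 i)).
Proof.
elim: k c => [|k IH] c sc; (have ccont : continuous (fun x : 'rV[R]_n => a * \prod_i c i
  (x ord0 i));
  first (move=> x; apply: (@continuousM _ _ (fun=> a)); first exact: cst_continuous;
    apply: continuous_prod => i y; apply: continuous_comp;
    [exact: coord_continuous|exact: (smooth1_continuous (sc i))])).
  by split.
split => // i; have [ci' [dci sci']] := sc i.
pose c' j := if j == i then ci' else c j.
have sc' j : smooth1 k (c' j) by rewrite /c'; case: eqP => // _; exact: smooth1S.
have H x : derivable (fun x : 'rV[R]_n => a * \prod_i c i (x ord0 i)) x (delta_mx ord0 i)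
  /\
    partial i (fun x : 'rV[R]_n => a * \prod_i c i (x ord0 i)) x = a * \prod_j c' j (x
      ord0 j).
  apply: derivable_of_line.
  pose A := a * \prod_(j | j != i) c j (x ord0 j).
  have -> : (fun t : R => a * \prod_j c j ((x + t *: delta_mx ord0 i) ord0 j)) =
      (fun t : R => A * c i (1 * t + x ord0 i)).
    apply/funext => t; rewrite (bigD1 i)//= !mxE !eqxx mulr1 mul1r (addrC t) /A.
    rewrite [RHS]mulrAC -mulrA; congr (_ * (_ * _)).
    apply: eq_bigr => j ji; rewrite !mxE (negbTE ji) andbF mulr0 addr0//.
  have -> : a * \prod_j c' j (x ord0 j) = A * ci' (x ord0 i).
    rewrite (bigD1 i)//= /c' eqxx /A [RHS]mulrAC -mulrA; congr (_ * (_ * _)).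
    by apply: eq_bigr => j ji; rewrite (negbTE ji).
  have daff : is_derive (0 : R) 1 (fun t : R => 1 * t + x ord0 i) 1.
    by apply: is_derive_eq; rewrite /GRing.scale/= mulr1 addr0.
  have di := dci (1 * 0 + x ord0 i).
  have := @is_derive1_comp R (c i) (fun t : R => 1 * t + x ord0 i) 0 _ _ di daff.
  rewrite mulr1 => dcomp.
  apply: is_derive_eq; by rewrite /GRing.scale/= mulr0 add0r.
split; first by move=> x; case: (H x).
rewrite (_ : partial i _ = fun x => a * \prod_j c' j (x ord0 j)); first exact: IH.
by apply/funext => x; case: (H x).
Qed.

End Ck.

Section cube.
Variables (R : realType) (n : nat).

Definition cube (e : R) : set 'rV[R]_n := [set x | forall i, `|x ord0 i| <= e].

Let cubeE (e : R) : cube e = [set x : 'rV[R]_n | forall i, `[- e, e]%classic (x ord0 i)].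
Proof. by apply/seteqP; split => x xe i; have := xe i; rewrite /= in_itv/= ler_norml. Qed.

Lemma measurable_cube e : measurable (cube e).
Proof. by rewrite cubeE; apply: (measurable_box (A := fun=> `[- e, e]%classic)). Qed.

Lemma lebesgue_cube (e : R) : 0 <= e ->
  (lebesgue_rV R n (cube e) = ((2 * e) ^+ n)%:E)%E.
Proof.
move=> e0; rewrite cubeE (lebesgue_rV_box (A := fun=> `[- e, e]%classic))//.
under eq_bigr do rewrite lebesgue_measure_itv/= lte_fin -EFinD.
have -> : (if - e < e then (e - - e)%:E else 0%R%:E) = (2 * e)%:E.
  rewrite opprK -mulr2n mulr_natl; case: ltP => // e1.
  have -> : e = 0 by lra.
  by rewrite mul0rn.
by rewrite prodEFin prodr_const card_ord.
Qed.

End cube.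

(** * A smooth bump supported in a cube *)

Section mollifier.
Variables (R : realType) (n : nat) (r : R).
Hypothesis r0 : 0 < r.

Let K (x : 'rV[R]_n) : R := \prod_i (flat 1 (1 * x ord0 i + r) * flat 1 (- 1 * x ord0 i +
  r)).

Let K_ge0 x : 0 <= K x.
Proof. by apply: prodr_ge0 => i _; rewrite mulr_ge0 ?flat1_ge0. Qed.

Let K_support x i : K x != 0 -> `|x ord0 i| < r.
Proof.
apply: contraR; rewrite -leNgt => xr; rewrite /K (bigD1 i)//= mulf_eq0; apply/orP; left.
rewrite mulf_eq0; case: (ger0P (x ord0 i)) xr => x0 xr; apply/orP; [right|left].
  by rewrite flat1_eq0//; lra.
by rewrite flat1_eq0//; lra.
Qed.

Let K_gt0 (x : 'rV[R]_n) : (forall i, `|x ord0 i| < r) -> 0 < K x.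
Proof.
move=> xr; apply: prodr_gt0 => i _; have := xr i; rewrite ltr_norml => /andP[h1 h2].
by rewrite mulr_gt0// flat1_gt0//; lra.
Qed.

Let K_C11 : exists D, C11 K D.
Proof.
apply: C11_prod => i; eexists; apply: C11M; exact: C11_flat.
Qed.

Let continuous_K : continuous K.
Proof.
have := @Ck_tensor R n 0 (fun i t => flat 1 (1 * t + r) * flat 1 (- 1 * t + r)) 1.
move=> /(_ _)[i|]; first by apply: smooth1M; apply: smooth1_affine; exact: smooth1_flat.
by under eq_fun do rewrite mul1r.
Qed.

Let mass_K : exists2 c : R, 0 < c & (\int[lebesgue_rV R n]_x (K x)%:E = c%:E)%E.
Proof.
have mK := continuous_measurable_rV continuous_K.
have mKE : measurable_fun setT (fun x => (K x)%:E) by exact/measurable_EFinP.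
have [D [M M0 [KM _ _]]] := K_C11.
have mB := @measurable_cube R n r; pose B := @cube R n r.
have lty : (\int[lebesgue_rV R n]_x (K x)%:E < +oo)%E.
  apply: (@le_lt_trans _ _ (\int[lebesgue_rV R n]_x (M%:E * (\1_B x)%:E))%E).
    apply: ge0_le_integral => //.
    - by move=> x _; rewrite lee_fin.
    - by apply: emeasurable_funM => //; apply/measurable_EFinP; exact: measurable_indic.
    move=> x _; rewrite -EFinM lee_fin.
    have [Kx|Kx] := eqVneq (K x) 0; first by rewrite Kx indicE; apply: mulr_ge0;
      [exact: M0|exact: ler0n].
    rewrite indicE mem_set; first by rewrite mulr1; exact: le_trans (ler_norm _) (KM x).
    by move=> i; apply: ltW; exact: K_support.
  rewrite ge0_integralZl_EFin//; last by apply/measurable_EFinP; exact: measurable_indic.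
  rewrite (integral_indic (lebesgue_rV R n) measurableT mB) setIT.
  rewrite [X in (_ * X)%E](_ : _ = ((2 * r) ^+ n)%:E) -?EFinM ?ltry//.
  exact: lebesgue_cube (ltW r0).
have : (0 < \int[lebesgue_rV R n]_x (K x)%:E)%E.
  rewrite lt_neqAle integral_ge0 ?andbT; last by move=> x _; rewrite lee_fin.
  apply/eqP => I0.
  have : (\int[lebesgue_rV R n]_x `|(K x)%:E| = 0)%E.
    by rewrite I0; apply: eq_integral => x _; rewrite abse_EFin ger0_norm.
  move=> /(ae_eq_integral_abs _ measurableT mKE)[N [mN N0 sub]].
  have : (lebesgue_rV R n (cube (r / 2)) <= 0)%E.
    rewrite -N0; apply: le_measure; rewrite ?inE//; first exact: measurable_cube.
    move=> x Bx; apply: sub => /= /(_ I)[] /eqP; rewrite gt_eqF// K_gt0// => i.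
    by apply: (le_lt_trans (Bx i)); rewrite ltr_pdivrMr// mulr_natr mulr2n ltrDl.
  by rewrite lebesgue_cube ?divr_ge0 ?(ltW r0)// lee_fin leNgt exprn_gt0// mulr_gt0//
    divr_gt0.
case: (\int[lebesgue_rV R n]_x _)%E lty => [c _|//|//]; rewrite lte_fin => c0.
by exists c.
Qed.

(** Two kinds of regularity are recorded: [C11] gives the estimates on convolutions, [test_function]
    the right to use the definition of the weak gradient. *)
Lemma mollifier_exists : exists (eta : 'rV[R]_n -> R) (D : 'rV[R]_n -> 'rV[R]_n),
  [/\ C11 eta D, forall x, 0 <= eta x,
      forall z, eta z != 0 -> cube r z,
      (\int[lebesgue_rV R n]_x (eta x)%:E = 1)%E &
      forall x, test_function (fun y => eta (y - x))].
Proof.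
have [c c0 Kc] := mass_K; have [D KD] := K_C11.
exists (fun x => c^-1 * K x), (fun x => c^-1 *: D x + K x *: 0).
have cV0 : 0 < c^-1 by rewrite invr_gt0.
split.
- exact: (C11M (C11_cst _ c^-1) KD).
- by move=> x; rewrite mulr_ge0// ltW.
- by move=> z; rewrite mulf_eq0 negb_or => /andP[_ Kz] i; rewrite ltW// K_support.
- under eq_integral do rewrite EFinM.
  rewrite ge0_integralZl_EFin ?(ltW cV0)//.
  + by rewrite Kc -EFinM mulVf// gt_eqF.
  + by move=> x _; rewrite lee_fin.
  + by apply/measurable_EFinP; exact: continuous_measurable_rV.
move=> x; split.
  move=> k; have := @Ck_tensor R n k (fun i t => flat 1 (1 * t + (r - x ord0 i)) * flat 1
    (- 1 * t + (r + x ord0 i))) c^-1.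
  move=> H; have := H (fun i => smooth1M (smooth1_affine _ _ (smooth1_flat _ _))
    (smooth1_affine _ _ (smooth1_flat _ _))).
  congr (Ck k); apply/funext => y; congr (_ * _); apply: eq_bigr => i _.
  by rewrite !mxE; congr (flat 1 _ * flat 1 _); ring.
apply: (@subclosed_compact _ _ [set y : 'rV[R]_n | forall i, `[x ord0 i - r, x ord0 i +
  r]%classic (y ord0 i)]).
- exact: closed_closure.
- apply: (rV_compact (A := fun i => `[x ord0 i - r, x ord0 i + r]%classic)) => i.
  exact: segment_compact.
move=> y cly i; rewrite /= in_itv/= -ler_distlC; rewrite leNgt; apply/negP => yi.
have [|z [/= + [_ zy]]] := cly (ball y (`|y ord0 i - x ord0 i| - r)).
  apply: nbhsx_ballx; rewrite subr_gt0 distrC//.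
rewrite mulf_eq0 negb_or => /andP[_ /(K_support i)]; rewrite !mxE => zx.
have := zy ord0 i; rewrite /ball/= => h.
have := ler_distD (z ord0 i) (y ord0 i) (x ord0 i); lra.
Qed.

End mollifier.

Lemma sqrB_le (R : realType) (x y : R) : (x - y) ^+ 2 <= 2 * x ^+ 2 + 2 * y ^+ 2.
Proof. by rewrite -subr_ge0 (_ : _ - _ = (x + y) ^+ 2) ?sqr_ge0//; ring. Qed.

Lemma le_sqrD1 (R : realType) (x : R) : x <= x ^+ 2 + 1.
Proof. have := sqr_ge0 (x - 2^-1); rewrite sqrrB; lra. Qed.

Lemma measurable_lt0 d (T : measurableType d) (R : realType) (f : T -> R) :
  measurable_fun setT f -> measurable [set x | f x < 0].
Proof.
move=> mf; have -> : [set x | f x < 0] = f @^-1` `]-oo, 0[%classic.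
  by apply/seteqP; split => x; rewrite /= in_itv.
by rewrite -[X in measurable X]setTI; exact: mf.
Qed.

Section pairing.
Context d (T : measurableType d) (R : realType) (mu : {measure set T -> \bar R}).
Variable f : T -> R.
Hypothesis mf : measurable_fun setT f.
Hypothesis fi : mu.-integrable setT (EFin \o (fun x => f x ^+ 2)).
Variables (w : T -> R) (M lam : R) (A : set T).
Hypothesis mw : measurable_fun setT w.
Hypothesis mA : measurable A.
Hypothesis Alam : (mu A <= lam%:E)%E.
Hypothesis M0 : 0 <= M.
Hypothesis wM : forall x, `|w x| <= M.
Hypothesis wA : forall x, w x != 0 -> A x.

Let indic_integrable : mu.-integrable setT (EFin \o (\1_A : T -> R)).
Proof.
apply/integrableP; split; first by apply/measurable_EFinP; exact: measurable_indic.
under eq_integral do rewrite abse_EFin ger0_norm ?indicE ?ler0n// -indicE.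
by rewrite integral_indic// setIT; exact: le_lt_trans Alam (ltry _).
Qed.

Let dominator : mu.-integrable setT (EFin \o (fun x => M * (f x ^+ 2 + \1_A x))).
Proof. by apply: integrable_EFinZ; exact: integrable_EFinD. Qed.

(** From [|f| <= f ^ 2 + 1] on [A]: this is how [L^2] functions are paired with bounded functions
    supported in a set of finite measure. *)
Let pairing_le x : `|f x * w x| <= M * (f x ^+ 2 + \1_A x).
Proof.
have [w0|w0] := eqVneq (w x) 0.
  by rewrite w0 mulr0 normr0 mulr_ge0// addr_ge0 ?sqr_ge0// indicE ler0n.
rewrite normrM mulrC indicE mem_set; last exact: wA.
rewrite ler_pM// -[f x ^+ 2]real_normK ?num_real//.
exact: le_sqrD1.
Qed.

Lemma integrable_pairing : mu.-integrable setT (EFin \o (fun x => f x * w x)).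
Proof.
apply: (le_integrable _ _ _ dominator) => //.
  by apply/measurable_EFinP; exact: measurable_funM.
by move=> x _; rewrite lee_fin; exact: le_trans (pairing_le x) (ler_norm _).
Qed.

Lemma norm_pairing_le :
  `|\int[mu]_x (f x * w x)| <= M * (\int[mu]_x (f x ^+ 2) + lam).
Proof.
rewrite (le_trans (le_normr_Rintegral _ integrable_pairing))//.
rewrite (@le_trans _ _ (\int[mu]_x (M * (f x ^+ 2 + \1_A x))))//.
  apply: le_Rintegral => //; first exact: (integrable_norm integrable_pairing).
rewrite RintegralZl//; last exact: integrable_EFinD.
rewrite ler_wpM2l// RintegralD// lerD2l.
by rewrite -lee_fin EFin_Rintegral// integral_indic// setIT.
Qed.

End pairing.

(** * Convolution with a mollifier *)

Section convolution.
Variables (R : realType) (n : nat).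
Notation leb := (lebesgue_rV R n).
Implicit Types (f w : 'rV[R]_n -> R) (x h z : 'rV[R]_n).

Lemma integral_translation h (f : 'rV[R]_n -> \bar R) : measurable_fun setT f ->
  (\int[leb]_x f (x + h)%R = \int[leb]_x f x)%E.
Proof.
move=> mf; rewrite integralE [RHS]integralE; congr (_ - _)%E.
  rewrite -(ge0_integral_translation h (measurable_funepos mf) (funepos_ge0 f)).
  by apply: eq_integral => x _; rewrite !funeposE.
rewrite -(ge0_integral_translation h (measurable_funeneg mf) (funeneg_ge0 f)).
by apply: eq_integral => x _; rewrite !funenegE.
Qed.

Lemma integrable_translation h f : measurable_fun setT f ->
  leb.-integrable setT (EFin \o f) -> leb.-integrable setT (EFin \o (fun x => f (x + h))).
Proof.
move=> mf /integrableP[_ flty]; apply/integrableP; split.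
  by apply/measurable_EFinP; exact: measurable_translation.
rewrite (ge0_integral_translation h (f := fun x => `|(f x)%:E|%E))//.
by apply: measurableT_comp => //; exact/measurable_EFinP.
Qed.

(** The argument of [w] is [y - x], so that for fixed [x] the kernel is a translate of [w], hence a
    test function in the variable of integration. *)
Definition conv f w x : R := \int[leb]_y (f y * w (y - x)).

Variable r : R.
Hypothesis r0 : 0 < r.

Let lam : R := (2 * r) ^+ n.
Let around x : set 'rV[R]_n := [set y | cube r (y - x)].

Let measurable_around x : measurable (around x).
Proof.
have mshift : measurable_fun setT (fun y : 'rV[R]_n => y - x) by exact: measurable_rVD.
by have := mshift measurableT _ (@measurable_cube R n r); rewrite setTI.
Qed.

Let around_measure x : (leb (around x) = lam%:E)%E.
Proof.
rewrite -(setIT (around x)) -integral_indic//.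
have -> : (\int[leb]_y (\1_(around x) y)%:E = \int[leb]_y (\1_(cube r) (y - x))%:E)%E.
  by apply: eq_integral => y _; rewrite !indicE; congr (_%:R%:E); congr (nat_of_bool _);
    apply/asbool_equiv_eq.
rewrite (ge0_integral_translation (- x) (f := fun y => (\1_(cube r) y)%:E))//.
  rewrite integral_indic ?setIT//; last exact: measurable_cube.
  exact: lebesgue_cube (ltW r0).
by apply/measurable_EFinP; apply: measurable_indic; exact: measurable_cube.
Qed.

Let around_le x : (leb (around x) <= lam%:E)%E.
Proof. by rewrite le_eqVlt; apply/orP; left; apply/eqP; exact: around_measure. Qed.

Let around2_le x y : (leb (around x `|` around y) <= (lam + lam)%:E)%E.
Proof.
apply: (le_trans (measureU2 _ _ _)) => //; rewrite EFinD.
by apply: leeD; exact: around_le.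
Qed.

Section with_f.
Variable f : 'rV[R]_n -> R.
Hypothesis mf : measurable_fun setT f.
Hypothesis fi : leb.-integrable setT (EFin \o (fun x => f x ^+ 2)).
Let S := \int[leb]_x (f x ^+ 2).
Variables (w : 'rV[R]_n -> R) (M : R).
Hypothesis mw : measurable_fun setT w.
Hypothesis M0 : 0 <= M.
Hypothesis wM : forall x, `|w x| <= M.
Hypothesis w_support : forall z, w z != 0 -> cube r z.

Lemma integrable_conv x : leb.-integrable setT (EFin \o (fun y => f y * w (y - x))).
Proof.
apply: (integrable_pairing mf fi (M := M) (lam := lam) (A := around x)) => //.
- exact: measurable_translation.
- exact: around_le.
- by move=> y; exact: w_support.
Qed.

Lemma conv_bounded x : `|conv f w x| <= M * (S + lam).
Proof.
apply: (norm_pairing_le mf fi (A := around x)) => //.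
- exact: measurable_translation.
- exact: around_le.
- by move=> y; exact: w_support.
Qed.

(** The difference of two translates of [w] is small and supported in the union of two cubes, which
    gives [lam + lam]. *)
Lemma conv_lipschitz (L : R) : 0 <= L ->
  (forall x h, `|w (x + h) - w x| <= L * l1norm h) ->
  forall x h, `|conv f w (x + h) - conv f w x| <= L * (S + (lam + lam)) * l1norm h.
Proof.
move=> L0 wL x h; rewrite /conv -RintegralB//; [|exact: integrable_conv..].
under eq_Rintegral do rewrite -mulrBr.
rewrite mulrAC.
apply: (norm_pairing_le mf fi (A := around (x + h) `|` around x)) => //.
- by apply: measurable_funB; exact: measurable_translation.
- exact: measurableU.
- exact: around2_le.
- by rewrite mulr_ge0// l1norm_ge0.
- move=> y; have -> : y - (x + h) = (y - x) + (- h) by rewrite opprD addrA.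
  rewrite (le_trans (wL _ _))// /l1norm; under eq_bigr do rewrite mxE normrN.
  by [].
- move=> y; apply: contraNP => /not_orP[h1 h2].
  have -> : w (y - (x + h)) = 0 by apply/eqP/negPn/negP => /w_support.
  have -> : w (y - x) = 0 by apply/eqP/negPn/negP => /w_support.
  by rewrite subrr.
Qed.

End with_f.

Variables (eta : 'rV[R]_n -> R) (D : 'rV[R]_n -> 'rV[R]_n).
Hypothesis etaD : C11 eta D.
Hypothesis eta0 : forall x, 0 <= eta x.
Hypothesis eta_support : forall z, eta z != 0 -> cube r z.
Hypothesis eta1 : (\int[leb]_x (eta x)%:E = 1)%E.
Hypothesis eta_test : forall x, test_function (fun y => eta (y - x)).

Let measurable_eta : measurable_fun setT eta.
Proof. by apply: continuous_measurable_rV; exact: C11_continuous etaD. Qed.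

Let partial_eta x i y : partial i (fun y => eta (y - x)) y = D (y - x) ord0 i.
Proof. by have [_] := C11_partial i y (C11_shift x etaD). Qed.

Let D_support z : D z != 0 -> cube r z.
Proof.
apply: contraNP => zr; apply/eqP; apply: (C11_gradient_at_zero etaD eta0).
by apply/eqP/negPn/negP => /eta_support.
Qed.

Let measurable_D i : measurable_fun setT (fun x => D x ord0 i).
Proof.
have [/(_ 1%N)[_ /(_ i)[_ [cD _]]] _] := eta_test 0.
have -> : (fun x => D x ord0 i) = partial i (fun y => eta (y - 0)).
  by apply/funext => y; rewrite partial_eta subr0.
exact: continuous_measurable_rV.
Qed.

Section L2_distance.
Variable f : 'rV[R]_n -> R.
Hypothesis mf : measurable_fun setT f.
Hypothesis fi : leb.-integrable setT (EFin \o (fun x => f x ^+ 2)).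

Let shifted x : (fun z => f (z + x) * eta z) = fun z => (fun y => f y * eta (y - x)) (z +
  x).
Proof. by apply/funext => z; rewrite addrK. Qed.

Let eta_bounded : exists2 M, 0 <= M & forall x, `|eta x| <= M.
Proof. by have [M M0 [etaM _ _]] := etaD; exists M. Qed.

Let integrable_shifted x : leb.-integrable setT (EFin \o (fun z => f (z + x) * eta z)).
Proof.
have [M M0 etaM] := eta_bounded.
rewrite shifted; apply: (@integrable_translation x (fun y => f y * eta (y - x))).
  by apply: measurable_funM => //; exact: measurable_translation.
exact: (integrable_conv mf fi measurable_eta M0 etaM eta_support).
Qed.

Let convE x : conv f eta x = \int[leb]_z (f (z + x) * eta z).
Proof.
rewrite shifted /conv /Rintegral; congr fine.
rewrite -(integral_translation x (f := fun y => (f y * eta (y - x))%:E))//.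
by apply/measurable_EFinP; apply: measurable_funM => //; exact: measurable_translation.
Qed.

Let integrable_eta : leb.-integrable setT (EFin \o eta).
Proof.
apply/integrableP; split; first exact/measurable_EFinP.
by under eq_integral do rewrite abse_EFin ger0_norm//; rewrite eta1 ltry.
Qed.

Let mean_eta : \int[leb]_x eta x = 1.
Proof. by rewrite /Rintegral eta1. Qed.

(** As [eta] has integral [1], [conv f eta x] is a mean of the values [f (z + x)]. *)
Let jensen x : (((conv f eta x - f x) ^+ 2)%:E <=
  \int[leb]_z ((f (z + x) - f x) ^+ 2 * eta z)%:E)%E.
Proof.
have [M M0 etaM] := eta_bounded.
pose F z := f (z + x) - f x.
have FE z : F z * eta z = f (z + x) * eta z - f x * eta z by rewrite mulrBl.
have Fi : leb.-integrable setT (EFin \o (fun z => F z * eta z)).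
  under eq_fun do rewrite FE.
  by apply: integrable_EFinB => //; exact: integrable_EFinZ.
have mF : measurable_fun setT F by apply: measurable_funB => //;
  exact: measurable_translation.
have F2i : leb.-integrable setT (EFin \o (fun z => F z ^+ 2 * eta z)).
  apply: (@le_integrable _ _ _ _ _ _ _
      (EFin \o (fun z => 2 * M * (fun y => f y ^+ 2) (z + x) + 2 * f x ^+ 2 * eta z))) =>
        //.
  - by apply/measurable_EFinP; apply: measurable_funM => //; exact: measurable_funX.
  - move=> z _; rewrite /= lee_fin.
    rewrite [leLHS]ger0_norm; last by apply: mulr_ge0 => //; exact: sqr_ge0.
    apply: le_trans (ler_norm _).
    have ez : eta z <= M by rewrite (le_trans (ler_norm _)).
    apply: (le_trans (ler_wpM2r (eta0 z) (sqrB_le (f (z + x)) (f x)))).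
    by rewrite mulrDl lerD2r mulrAC ler_wpM2r ?sqr_ge0// ler_wpM2l.
  - apply: integrable_EFinD; apply: integrable_EFinZ => //.
    by apply: (@integrable_translation x (fun y => f y ^+ 2)) => //;
      exact: measurable_funX.
rewrite -EFin_Rintegral// lee_fin.
have -> : conv f eta x - f x = \int[leb]_z (F z * eta z).
  under [RHS]eq_Rintegral do rewrite FE.
  rewrite RintegralB//; last exact: integrable_EFinZ.
  by rewrite RintegralZl// mean_eta mulr1 convE.
set m := \int[leb]_z _.
(* Jensen's inequality for the square is the nonnegativity of [(F z - m) ^ 2 * eta z],
   integrated. *)
have : \int[leb]_z (2 * m * (F z * eta z) - m ^+ 2 * eta z) <= \int[leb]_z (F z ^+ 2 *
  eta z).
  apply: le_Rintegral => //; first by apply: integrable_EFinB; exact: integrable_EFinZ.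
  move=> z _; rewrite -subr_ge0 (_ : _ - _ = (F z - m) ^+ 2 * eta z); last by ring.
  by apply: mulr_ge0 => //; exact: sqr_ge0.
rewrite RintegralB//; [|exact: integrable_EFinZ..].
rewrite !RintegralZl// mean_eta -/m mulr1; apply: le_trans.
by have -> : 2 * m * m - m ^+ 2 = m ^+ 2 by ring.
Qed.

Lemma measurable_conv : measurable_fun setT (conv f eta).
Proof.
have [M M0 etaM] := eta_bounded; have [L L0 etaL] := C11_lipschitz etaD.
apply: continuous_measurable_rV; apply: (@l1norm_lipschitz_continuous _ _ _
  (L * (\int[leb]_x (f x ^+ 2) + (lam + lam)))).
  rewrite mulr_ge0// addr_ge0// ?addr_ge0 ?exprn_ge0 ?mulr_ge0 ?(ltW r0)//.
  by apply: Rintegral_ge0 => x _; exact: sqr_ge0.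
exact: (conv_lipschitz mf fi measurable_eta M0 etaM eta_support L0 etaL).
Qed.

(** By Tonelli, the integrated Jensen inequality is an average, over shifts in the cube, of squared
    translation differences. *)
Lemma conv_L2 (e : R) : 0 <= e ->
  (forall z, cube r z -> \int[leb]_x ((f (x + z) - f x) ^+ 2)%:E <= e%:E)%E ->
  (\int[leb]_x ((conv f eta x - f x) ^+ 2)%:E <= e%:E)%E.
Proof.
move=> e0 fe.
pose k (p : 'rV[R]_n * 'rV[R]_n) := ((f (p.2 + p.1) - f p.1) ^+ 2 * eta p.2)%:E.
have k0 p : (0 <= k p)%E by rewrite lee_fin mulr_ge0// sqr_ge0.
have m1 : measurable_fun setT (fun p : 'rV[R]_n * 'rV[R]_n => f p.1).
  exact: (measurableT_comp mf).
have m2 : measurable_fun setT (fun p : 'rV[R]_n * 'rV[R]_n => eta p.2).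
  exact: (measurableT_comp measurable_eta).
have m12 : measurable_fun setT (fun p : 'rV[R]_n * 'rV[R]_n => f (p.2 + p.1)).
  by apply: (measurableT_comp mf); apply: measurable_rVD.
have mk : measurable_fun setT k.
  apply/measurable_EFinP; apply: measurable_funM => //; apply: measurable_funX.
  exact: measurable_funB.
apply: (@le_trans _ _ (\int[leb]_x \int[leb]_z k (x, z))%E).
  apply: ge0_le_integral => //.
  - by move=> x _; rewrite lee_fin sqr_ge0.
  - apply/measurable_EFinP; apply: measurable_funX; apply: measurable_funB => //.
    exact: measurable_conv.
  - exact: (@measurable_fun_fubini_tonelli_F _ _ _ _ _ leb k).
rewrite (@fubini_tonelli _ _ _ _ R leb leb k)//.
rewrite -[leRHS]mule1 -eta1 -ge0_integralZl//; last 2 first.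
- exact/measurable_EFinP.
- by move=> z _; rewrite lee_fin.
apply: ge0_le_integral => //.
- by move=> z _; apply: integral_ge0.
- exact: (@measurable_fun_fubini_tonelli_G _ _ _ _ _ leb k).
- by apply: emeasurable_funM => //; exact/measurable_EFinP.
move=> z _; have [ez|ez] := eqVneq (eta z) 0.
  rewrite ez mule0 (eq_integral (cst 0%E)) ?integral0// => x _.
  by rewrite /k /= ez mulr0.
rewrite /k /=; under eq_integral do rewrite mulrC EFinM.
rewrite ge0_integralZl//; last 3 first.
- apply/measurable_EFinP; apply: measurable_funX; apply: measurable_funB => //.
  by apply: (measurableT_comp mf); apply: measurable_rVD.
- by move=> x _; rewrite lee_fin sqr_ge0.
- by rewrite lee_fin.
rewrite [leRHS]muleC; apply: lee_wpmul2l; first by rewrite lee_fin.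
under eq_integral do rewrite [z + _]addrC.
exact/fe/eta_support.
Qed.

Lemma conv_ge0 x : leb [set y | f y < 0] = 0%E -> 0 <= conv f eta x.
Proof.
move=> f0; have mfx : measurable_fun setT (fun y => f y * eta (y - x)).
  by apply: measurable_funM => //; exact: measurable_translation.
have mafx : measurable_fun setT (fun y => `|f y| * eta (y - x)).
  by apply: measurable_funM; [exact: measurableT_comp|exact: measurable_translation].
have -> : conv f eta x = \int[leb]_y (`|f y| * eta (y - x)).
  congr fine; apply: ae_eq_integral => //; [exact/measurable_EFinP..|].
  exists [set y | f y < 0]; split => //.
    exact: measurable_lt0.
  move=> y /=; apply: contra_notP => /negP; rewrite -leNgt => fy _.
  by rewrite ger0_norm.
by apply: Rintegral_ge0 => y _; rewrite mulr_ge0.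
Qed.

End L2_distance.

Variables (f : 'rV[R]_n -> R) (G : 'rV[R]_n -> 'rV[R]_n).
Hypothesis fG : H1_with_gradient f G.

Let mf : measurable_fun setT f.
Proof. by case: fG => + _; rewrite /square_integrable inE => /andP[]; rewrite inE. Qed.

Let fi : leb.-integrable setT (EFin \o (fun x => f x ^+ 2)).
Proof. by case: fG => + _; exact: Lfun2_integrable_sqr. Qed.

Let mG i : measurable_fun setT (fun x => G x ord0 i).
Proof.
by case: fG => _ /(_ i)[+ _]; rewrite /square_integrable inE => /andP[]; rewrite inE.
Qed.

Let Gi i : leb.-integrable setT (EFin \o (fun x => G x ord0 i ^+ 2)).
Proof. by case: fG => _ /(_ i)[+ _]; exact: Lfun2_integrable_sqr. Qed.

Let H x : 'rV[R]_n := \row_i conv (fun y => G y ord0 i) eta x.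

Let conv_partial x i : \int[leb]_y (f y * D (y - x) ord0 i) = - H x ord0 i.
Proof.
rewrite mxE; have [_ /(_ i)[_ /(_ _ (eta_test x)) <-]] := fG.
by apply: eq_Rintegral => y _; rewrite partial_eta.
Qed.

Let integrable_D x i : leb.-integrable setT (EFin \o (fun y => f y * D (y - x) ord0 i)).
Proof.
have [M M0 [_ DM _]] := etaD.
apply: (integrable_conv mf fi (w := fun z => D z ord0 i) (M := M)) => // z;
  apply: contraNP => zr; apply/eqP.
have [->|/D_support//] := eqVneq (D z) 0; by rewrite mxE.
Qed.

(** The definition of the weak gradient, applied to translates of [eta], moves the derivative from
    the kernel to [f]. *)
Let conv_gradient x h :
  \int[leb]_y (f y * dotp (D (y - x)) h) = - dotp (H x) h.
Proof.
have E y : f y * dotp (D (y - x)) h = \sum_i (h ord0 i * (f y * D (y - x) ord0 i)).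
  by rewrite /dotp mulr_sumr; apply: eq_bigr => i _; ring.
under eq_Rintegral do rewrite E.
rewrite /Rintegral; under eq_integral do rewrite -sumEFin.
rewrite integral_sum//; last by move=> i; exact: (integrable_EFinZ _ (integrable_D x i)).
rewrite /dotp -sumrN.
have -> : (\sum_i \int[leb]_y (h ord0 i * (f y * D (y - x) ord0 i))%:E =
  (\sum_i - (H x ord0 i * h ord0 i))%:E)%E.
  rewrite -sumEFin; apply: eq_bigr => i _.
  rewrite -EFin_Rintegral; last exact: (integrable_EFinZ _ (integrable_D x i)).
  by rewrite RintegralZl// conv_partial mulrN mulrC.
by [].
Qed.

Let integrable_gradient x h :
  leb.-integrable setT (EFin \o (fun y => f y * dotp (D (y - x)) h)).
Proof.
have -> : EFin \o (fun y => f y * dotp (D (y - x)) h) =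
    (fun y => \sum_i (h ord0 i * (f y * D (y - x) ord0 i))%:E)%E.
  apply/funext => y; rewrite /= sumEFin /dotp mulr_sumr; congr EFin.
  by apply: eq_bigr => i _; ring.
by apply: integrable_sum => // i _; exact: (integrable_EFinZ _ (integrable_D x i)).
Qed.

(** The expansion of [eta] is integrated against [f]. The constant [K] dominates the integrals of
    [f ^ 2] and of all squared components of [G], so that one bound serves the values, the gradient
    and the remainder. *)
Lemma C11_conv : C11 (conv f eta) H.
Proof.
have [M M0 [etaM DM etaE]] := etaD.
have [L L0 etaL] := C11_lipschitz etaD.
have lam0 : 0 <= lam by rewrite /lam exprn_ge0// mulr_ge0// ltW.
pose S (g : 'rV[R]_n -> R) := \int[leb]_x (g x ^+ 2) + (lam + lam).
have S0 g : 0 <= S g by rewrite addr_ge0 ?addr_ge0// Rintegral_ge0// => x _;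
  exact: sqr_ge0.
pose K := S f + \sum_i S (fun y => G y ord0 i).
have fK : S f <= K by rewrite lerDl sumr_ge0.
have GK i : S (fun y => G y ord0 i) <= K.
  by rewrite /K (bigD1 i)//= addrCA lerDl addr_ge0 ?S0// sumr_ge0.
have MS g : M * (\int[leb]_x (g x ^+ 2) + lam) <= M * S g.
  by rewrite ler_wpM2l// lerD2l lerDl.
exists (M * K); first by rewrite mulr_ge0// (le_trans _ fK).
split.
- move=> x; rewrite (le_trans (conv_bounded mf fi measurable_eta M0 etaM eta_support
  x))//.
  by rewrite (le_trans (MS _))// ler_wpM2l.
- move=> x i; rewrite mxE.
  rewrite (le_trans (conv_bounded (mG i) (Gi i) measurable_eta M0 etaM eta_support x))//.
  by rewrite (le_trans (MS _))// ler_wpM2l.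
(* Once the gradient term is written with [D], the remainder is [f] paired with the expansion error
   of [eta] at [y - x] for the step [- h]. *)
move=> x h; rewrite -[dotp _ _]opprK -conv_gradient opprK.
rewrite /conv -RintegralB//; [|exact: (integrable_conv mf fi measurable_eta M0 etaM
  eta_support)..].
rewrite -RintegralD//; last first.
  by apply: integrable_EFinB; exact: (integrable_conv mf fi measurable_eta M0 etaM
    eta_support).
under eq_Rintegral do rewrite -mulrBr -mulrDr.
apply: (@le_trans _ _ (M * l1norm h ^+ 2 * S f)); last first.
  by rewrite mulrAC ler_wpM2r ?sqr_ge0// ler_wpM2l.
apply: (norm_pairing_le mf fi (A := around (x + h) `|` around x)) => //.
- apply: measurable_funD; first by apply: measurable_funB; exact: measurable_translation.
  apply: measurable_dotp => //.
  by apply: measurable_fun_rVP => i;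
    exact: (measurable_translation (- x) (measurable_D i)).
- exact: measurableU.
- exact: around2_le.
- by rewrite mulr_ge0// sqr_ge0.
- move=> y; have -> : y - (x + h) = (y - x) + (- h) by rewrite opprD addrA.
  have := etaE (y - x) (- h); rewrite dotpNr opprK /l1norm.
  by under eq_bigr do rewrite mxE normrN.
move=> y; apply: contraNP => /not_orP[h1 h2].
have -> : eta (y - (x + h)) = 0 by apply/eqP/negPn/negP => /eta_support.
have -> : eta (y - x) = 0 by apply/eqP/negPn/negP => /eta_support.
have -> : D (y - x) = 0 by apply/eqP/negPn/negP => /D_support.
rewrite subrr add0r /dotp big1// => i _; by rewrite mxE mul0r.
Qed.

End convolution.

Section H1_approximation.
Variables (R : realType) (n : nat).
Notation leb := (lebesgue_rV R n).

Lemma square_integrableP (f : 'rV[R]_n -> R) : square_integrable f ->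
  measurable_fun setT f /\ leb.-integrable setT (EFin \o (fun x => f x ^+ 2)).
Proof.
move=> f2; split; last exact: Lfun2_integrable_sqr.
by move: f2; rewrite /square_integrable inE => /andP[]; rewrite inE.
Qed.

(** The same radius of mollification has to serve [f] and all components of [G]; this is possible as
    these are finitely many. *)
Lemma H1_approximation (f : 'rV[R]_n -> R) (G : 'rV[R]_n -> 'rV[R]_n) (e : R) :
  H1_with_gradient f G -> leb [set x | f x < 0] = 0%E -> 0 < e ->
  exists F H, [/\ C11 F H, forall x, 0 <= F x,
    forall i, measurable_fun setT (fun x => H x ord0 i),
    (\int[leb]_x ((F x - f x) ^+ 2)%:E <= e%:E)%E &
    forall i, (\int[leb]_x ((H x ord0 i - G x ord0 i) ^+ 2)%:E <= e%:E)%E].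
Proof.
move=> fG f0 e0; have [/square_integrableP[mf fi] Gi] := fG.
have near_translation (g : 'rV[R]_n -> R) : square_integrable g ->
    \forall r \near (0 : R)^'+, forall z : 'rV[R]_n, cube r z ->
      (\int[leb]_x ((g (x + z) - g x) ^+ 2)%:E <= e%:E)%E.
  move=> /square_integrableP[mg gi]; have [r r0 H] := translation_continuous_L2 mg gi e0.
  near=> s => z zs; apply: H => i; rewrite (le_trans (zs i))//.
  by near: s; exact: nbhs_right_le.
have near_all : \forall r \near (0 : R)^'+, forall i, forall z : 'rV[R]_n, cube r z ->
      (\int[leb]_x ((G (x + z) ord0 i - G x ord0 i) ^+ 2)%:E <= e%:E)%E.
  apply: filter_forall => i; apply: (near_translation (fun x => G x ord0 i)).
  by case: (Gi i).
have [r [r0 [fr Gr]]] : exists r : R, 0 < r /\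
   ((forall z : 'rV[R]_n, cube r z ->
      (\int[leb]_x ((f (x + z) - f x) ^+ 2)%:E <= e%:E)%E) /\
   (forall i, forall z : 'rV[R]_n, cube r z ->
      (\int[leb]_x ((G (x + z) ord0 i - G x ord0 i) ^+ 2)%:E <= e%:E)%E)).
  near (0 : R)^'+ => r; exists r; split; first by [].
  split; first by near: r; apply: near_translation; case: fG.
  by near: r.
have [eta [D [etaD eta0 eta_supp eta1 eta_test]]] := mollifier_exists n r0.
exists (conv f eta), (fun x => \row_i conv (fun y => G y ord0 i) eta x).
have meta : measurable_fun setT eta by apply: continuous_measurable_rV;
  exact: C11_continuous etaD.
split.
- exact: (C11_conv r0 etaD eta0 eta_supp eta_test fG).
- by move=> x; exact: (conv_ge0 etaD eta0 mf).
- move=> i; under eq_fun do rewrite mxE.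
  have [/square_integrableP[mGi Gii] _] := Gi i.
  exact: (measurable_conv r0 etaD eta_supp mGi Gii).
- exact: (conv_L2 r0 etaD eta0 eta_supp eta1 mf fi (ltW e0) fr).
move=> i; under eq_integral do rewrite mxE.
have [/square_integrableP[mGi Gii] _] := Gi i.
exact: (conv_L2 r0 etaD eta0 eta_supp eta1 mGi Gii (ltW e0) (Gr i)).
Unshelve. all: by end_near. Qed.

End H1_approximation.

Lemma ln_le_subr1 (R : realType) (x : R) : 0 < x -> ln x <= x - 1.
Proof.
by move=> x0; have := @le_ln1Dx R (x - 1); rewrite addrCA subrr addr0 ltrBrDl subrr;
  exact.
Qed.

(** * Extension to H^1 *)

Section regularization.
Variables (R : realType) (s : R).
Hypothesis s0 : 0 < s.
Implicit Types x y : R.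

Definition phi x : R := x + s ^+ 2 / (x + s).
Definition dphi x : R := 1 - s ^+ 2 / (x + s) ^+ 2.
(** The factor of [|grad F| ^ 2] in the Fisher information [|grad (phi F)| ^ 2 / phi F]. *)
Definition fisher_weight x : R := dphi x ^+ 2 / phi x.

Let gt0 x : 0 <= x -> 0 < x + s. Proof. by move=> x0; rewrite ltr_wpDl. Qed.

Lemma phi_ge x : 0 <= x -> s <= phi x.
Proof.
move=> x0; have xs := gt0 x0; rewrite -subr_ge0.
have -> : phi x - s = x ^+ 2 / (x + s) by rewrite /phi; field; rewrite gt_eqF.
by rewrite divr_ge0 ?sqr_ge0// ltW.
Qed.

Lemma le_phi x : 0 <= x -> x <= phi x.
Proof. by move=> x0; rewrite lerDl divr_ge0 ?sqr_ge0 ?(ltW (gt0 x0)). Qed.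

Lemma phi_le x : 0 <= x -> phi x <= x + s.
Proof.
move=> x0; rewrite lerD2l ler_pdivrMr ?gt0// expr2 ler_pM2l//.
by rewrite lerDr.
Qed.

Lemma phi_gt0 x : 0 <= x -> 0 < phi x.
Proof. by move=> x0; exact: lt_le_trans s0 (phi_ge x0). Qed.

Let ratio_le1 x : 0 <= x -> s / (x + s) <= 1.
Proof. by move=> x0; rewrite ler_pdivrMr ?gt0// mul1r lerDr. Qed.

Let ratio_ge0 x : 0 <= x -> 0 <= s / (x + s).
Proof. by move=> x0; rewrite divr_ge0 ?ltW// gt0. Qed.

Let dphiE x : dphi x = 1 - (s / (x + s)) ^+ 2.
Proof. by rewrite /dphi exprMn exprVn. Qed.

Lemma dphi_ge0 x : 0 <= x -> 0 <= dphi x.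
Proof. by move=> x0; rewrite dphiE subr_ge0 exprn_ile1 ?ratio_ge0 ?ratio_le1. Qed.

Lemma dphi_le1 x : dphi x <= 1.
Proof. by rewrite dphiE gerBl sqr_ge0. Qed.

Lemma phi_expansion x y : 0 <= x -> 0 <= y ->
  phi y <= phi x + dphi x * (y - x) + (y - x) ^+ 2 / s.
Proof.
move=> x0 y0; have xs := gt0 x0; have ys := gt0 y0; rewrite -subr_ge0.
have -> : phi x + dphi x * (y - x) + (y - x) ^+ 2 / s - phi y =
    (y - x) ^+ 2 / s * (1 - s / (y + s) * (s / (x + s)) ^+ 2).
  by rewrite /phi /dphi; field; rewrite !gt_eqF.
rewrite mulr_ge0// ?divr_ge0 ?sqr_ge0 ?(ltW s0)// subr_ge0.
by rewrite mulr_ile1 ?ratio_ge0 ?ratio_le1 ?sqr_ge0// exprn_ile1 ?ratio_ge0 ?ratio_le1.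
Qed.

Let unit_lip (c x y : R) : 0 <= c <= 1 -> `|c * (x - y)| <= `|x - y|.
Proof. by move=> /andP[c0 c1]; rewrite normrM ger0_norm// ler_piMl. Qed.

Lemma phi_lipschitz x y : 0 <= x -> 0 <= y -> `|phi x - phi y| <= `|x - y|.
Proof.
move=> x0 y0; have xs := gt0 x0; have ys := gt0 y0.
have -> : phi x - phi y = (1 - s / (y + s) * (s / (x + s))) * (x - y).
  by rewrite /phi; field; rewrite !gt_eqF.
apply: unit_lip; rewrite subr_ge0 gerBl.
by rewrite mulr_ile1 ?ratio_ge0 ?ratio_le1//; apply: mulr_ge0; exact: ratio_ge0.
Qed.

Lemma dphi_lipschitz x y : 0 <= x -> 0 <= y -> `|dphi x - dphi y| <= 2 / s * `|x - y|.
Proof.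
move=> x0 y0; have xs := gt0 x0; have ys := gt0 y0.
set p := s / (x + s); set q := s / (y + s).
have -> : dphi x - dphi y = s^-1 * (p * q * (p + q)) * (x - y).
  by rewrite /dphi /p /q; field; rewrite !gt_eqF.
have [p0 p1] : 0 <= p /\ p <= 1 by rewrite ratio_ge0// ratio_le1.
have [q0 q1] : 0 <= q /\ q <= 1 by rewrite ratio_ge0// ratio_le1.
rewrite normrM ler_wpM2r// ger0_norm; last by rewrite !mulr_ge0 ?invr_ge0 ?addr_ge0// ltW.
rewrite [leRHS]mulrC ler_wpM2l ?invr_ge0 ?(ltW s0)//.
have pq : p * q <= 1 by rewrite mulr_ile1.
have := ler_pM (mulr_ge0 p0 q0) (addr_ge0 p0 q0) pq (lerD p1 q1).
by rewrite mul1r.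
Qed.

Lemma fisher_weight_ge0 x : 0 <= x -> 0 <= fisher_weight x.
Proof. by move=> x0; rewrite divr_ge0 ?sqr_ge0// ltW// phi_gt0. Qed.

Lemma fisher_weight_le x : 0 <= x -> fisher_weight x <= s^-1.
Proof.
move=> x0; rewrite /fisher_weight ler_pdivrMr ?phi_gt0//.
rewrite (@le_trans _ _ 1)//; first by rewrite exprn_ile1 ?dphi_ge0 ?dphi_le1.
by rewrite ler_pdivlMl// mulr1 phi_ge.
Qed.

(** At [x = 0] the right side is [0] by convention, and the bound says that the weight vanishes
    there. *)
Lemma fisher_weight_le_inv x : 0 <= x -> fisher_weight x <= 4 / x.
Proof.
move=> x0; have [->|xn0] := eqVneq x 0.
  by rewrite /fisher_weight /dphi add0r divff ?subrr ?expr0n ?mul0r ?invr0 ?mulr0//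
    expf_neq0// gt_eqF.
have x1 : 0 < x by rewrite lt_neqAle eq_sym xn0.
have xs := gt0 x0; have d0 : 0 < x ^+ 2 + x * s + s ^+ 2.
  by rewrite addr_gt0 ?exprn_gt0// addr_gt0 ?exprn_gt0 ?mulr_gt0.
rewrite -subr_ge0.
have -> : 4 / x - fisher_weight x =
    (4 * (x + s) ^+ 3 * (x ^+ 2 + x * s + s ^+ 2) - x ^+ 3 * (x + 2 * s) ^+ 2) /
    (x * (x + s) ^+ 3 * (x ^+ 2 + x * s + s ^+ 2)).
  rewrite /fisher_weight /dphi /phi; field; rewrite !gt_eqF//=.
apply: divr_ge0; last by rewrite !mulr_ge0 ?exprn_ge0// ltW.
rewrite (_ : _ - _ = 4 * (x ^+ 2 + x * s + s ^+ 2) * (s * (3 * x ^+ 2 + 3 * x * s + s ^+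
  2)) +
  3 * x ^+ 5); last by ring.
have xs' : 0 <= x * s by rewrite mulr_ge0// ltW.
by rewrite addr_ge0 ?mulr_ge0 ?addr_ge0 ?mulr_ge0 ?exprn_ge0 ?(ltW s0).
Qed.

(** Of the constant [5], the variation of [dphi] contributes [4] and that of [phi] in the
    denominator [1]. *)
Lemma fisher_weight_lipschitz x y : 0 <= x -> 0 <= y ->
  `|fisher_weight x - fisher_weight y| <= 5 / s ^+ 2 * `|x - y|.
Proof.
move=> x0 y0; have px := phi_gt0 x0; have py := phi_gt0 y0.
have -> : fisher_weight x - fisher_weight y =
    (phi x)^-1 * ((dphi x + dphi y) * (dphi x - dphi y)) +
    (phi x)^-1 * (phi y)^-1 * (dphi y ^+ 2 * (phi y - phi x)).
  by rewrite /fisher_weight; field; rewrite !gt_eqF.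
have inv_le z : 0 <= z -> (phi z)^-1 <= s^-1.
  by move=> z0; rewrite lef_pV2 ?posrE ?phi_gt0// phi_ge.
have d2 : dphi x + dphi y <= 2 by rewrite (_ : 2 = 1 + 1)// lerD// dphi_le1.
have dd : `|(dphi x + dphi y) * (dphi x - dphi y)| <= 2 * (2 / s * `|x - y|).
  rewrite normrM; apply: ler_pM => //; last exact: dphi_lipschitz.
  by rewrite ger0_norm// addr_ge0// dphi_ge0.
have dp : `|dphi y ^+ 2 * (phi y - phi x)| <= 1 * `|x - y|.
  rewrite normrM; apply: ler_pM => //; last by rewrite distrC; exact: phi_lipschitz.
  by rewrite ger0_norm ?sqr_ge0// exprn_ile1 ?dphi_ge0 ?dphi_le1.
rewrite (le_trans (ler_normD _ _))// normrM [X in _ + X]normrM.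
rewrite [`|(phi x)^-1|]ger0_norm ?invr_ge0 ?(ltW px)//.
rewrite [`|(phi x)^-1 * _|]ger0_norm ?mulr_ge0 ?invr_ge0 ?(ltW px) ?(ltW py)//.
have h1 := ler_pM (ltW (_ : 0 < (phi x)^-1)) (normr_ge0 _) (inv_le _ x0) dd.
have h2 := ler_pM (mulr_ge0 (ltW (_ : 0 < (phi x)^-1)) (ltW (_ : 0 < (phi y)^-1)))
  (normr_ge0 _)
  (ler_pM (ltW (_ : 0 < (phi x)^-1)) (ltW (_ : 0 < (phi y)^-1)) (inv_le _ x0) (inv_le _
    y0)) dp.
have ix : 0 < (phi x)^-1 by rewrite invr_gt0.
have iy : 0 < (phi y)^-1 by rewrite invr_gt0.
apply: (le_trans (lerD (h1 ix) (h2 ix iy ix iy))).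
by rewrite le_eqVlt; apply/orP; left; apply/eqP; field; rewrite gt_eqF.
Qed.

Lemma entropy_tangent x y : 0 < x -> 0 < y ->
  y * ln y + (1 + ln y) * (x - y) <= x * ln x.
Proof.
move=> x0 y0; have yx : 0 < y / x by rewrite divr_gt0.
have := ler_wpM2l (ltW x0) (ln_le_subr1 yx); rewrite ln_div ?posrE//.
rewrite !mulrBr mulr1 mulrCA divff ?gt_eqF// mulr1; lra.
Qed.

(** Concavity of the logarithm reduces the claim to [phi_expansion]. The result is the one-sided
    quadratic expansion under which the log-Sobolev inequality is available for [exp g] with
    [g = ln (phi F)]. *)
Lemma ln_phi_expansion x y : 0 <= x -> 0 <= y ->
  ln (phi y) - ln (phi x) <= (phi x)^-1 * (dphi x * (y - x)) + (y - x) ^+ 2 / s ^+ 2.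
Proof.
move=> x0 y0; have px := phi_gt0 x0; have py := phi_gt0 y0.
have := entropy_tangent px py; have := phi_expansion x0 y0 => h1 h2.
have h3 : ln (phi y) - ln (phi x) <= (phi x)^-1 * (phi y - phi x).
  rewrite -(ler_pM2l px) mulrA divff ?gt_eqF// mul1r; lra.
apply: (le_trans h3).
have h4 : phi y - phi x <= dphi x * (y - x) + (y - x) ^+ 2 / s by lra.
rewrite (le_trans (ler_wpM2l (ltW (_ : 0 < (phi x)^-1)) h4)) ?invr_gt0//.
rewrite mulrDr lerD2l -exprVn [s^-1 ^+ 2]expr2 mulrCA ler_wpM2l ?sqr_ge0//.
by rewrite ler_pM2r ?invr_gt0// lef_pV2 ?posrE// phi_ge.
Qed.

Lemma ln_norm_le x : s <= x -> `|ln x| <= x + s^-1.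
Proof.
move=> sx; have x0 := lt_le_trans s0 sx; have ix : x^-1 <= s^-1 by rewrite lef_pV2 ?posrE.
have si : 0 < s^-1 by rewrite invr_gt0.
have l1 (z : R) : 0 < z -> ln z <= z by move=> z0; have := ln_le_subr1 z0; lra.
have xV : 0 < x^-1 by rewrite invr_gt0.
rewrite ler_norml; apply/andP; split; last by have := l1 _ x0; lra.
have := l1 _ xV; rewrite lnV ?posrE//; lra.
Qed.

End regularization.

Section entropy_bounds.
Variable R : realType.
Implicit Types x b c q : R.

Lemma xlnx_norm_le x : 0 <= x -> `|x * ln x| <= x ^+ 2 + 1.
Proof.
move=> x0; have [->|xn0] := eqVneq x 0; first by rewrite mul0r normr0 addr_ge0// sqr_ge0.
have x1 : 0 < x by rewrite lt_neqAle eq_sym xn0.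
have h1 := entropy_tangent x1 (@ltr01 R); rewrite ln1 mulr0 in h1.
have h2 : x * ln x <= x * (x - 1).
  rewrite ler_pM2l//.
  exact: ln_le_subr1.
rewrite ler_norml expr2; apply/andP; split; [have := mulr_ge0 x0 x0|]; lra.
Qed.

(** Here [c - b] is at most [q ^ 2], while [ln c >= 2 * ln q >= - 2 / q]; a negative logarithm thus
    costs at most [2 * q]. *)
Lemma xlnx_perturb b c q : 0 < q -> 0 <= b -> b <= c -> q ^+ 2 <= c -> c <= b + q ^+ 2 ->
  b * ln b <= c * ln c + 2 * q.
Proof.
move=> q0 b0 bc qc cb; have q20 : 0 < q ^+ 2 by rewrite exprn_gt0.
have c0 := lt_le_trans q20 qc.
have h1 : b * ln b <= b * ln c.
  have [->|bn0] := eqVneq b 0; first by rewrite !mul0r.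
  by rewrite ler_wpM2l// ler_ln// posrE lt_neqAle eq_sym bn0.
have h2 : ln (q ^+ 2) <= ln c by rewrite ler_ln// posrE.
have h3 : - q^-1 <= ln q.
  have qV : 0 < q^-1 by rewrite invr_gt0.
  have := ln_le_subr1 qV; rewrite lnV ?posrE//; lra.
rewrite lnXn// -mulr_natl in h2.
have h4 : - (2 * q^-1) <= ln c by lra.
have h5 : (c - b) * - (2 * q^-1) <= (c - b) * ln c by rewrite ler_wpM2l// subr_ge0.
have h6 : (c - b) * (2 * q^-1) <= q ^+ 2 * (2 * q^-1).
  by rewrite ler_wpM2r ?mulr_ge0 ?invr_ge0 ?(ltW q0)//; lra.
have h7 : q ^+ 2 * (2 * q^-1) = 2 * q by field; rewrite gt_eqF.
lra.
Qed.

Lemma le_of_vanishing_error x b c : 0 <= c ->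
  (forall t, 0 < t -> t <= 1 -> x <= b + t * c) -> x <= b.
Proof.
move=> c0 H; apply/ler_addgt0Pr => e e0.
pose t := Num.min 1 (e / (c + 1)).
have c1 : 0 < c + 1 by rewrite ltr_wpDl.
have t0 : 0 < t by rewrite lt_min ltr01 divr_gt0.
have t1 : t <= 1 by rewrite ge_min lexx.
apply: (le_trans (H t t0 t1)); rewrite lerD2l.
have te : t <= e / (c + 1) by rewrite ge_min lexx orbT.
apply: (le_trans (ler_wpM2r c0 te)); rewrite mulrAC ler_pdivrMr// ler_pM2l//.
by rewrite lerDl.
Qed.

End entropy_bounds.

Section measurable_phi.
Context d (T : measurableType d) (R : realType).

Lemma measurable_invr_pos (f : T -> R) : measurable_fun setT f -> (forall x, 0 < f x) ->
  measurable_fun setT (fun x => (f x)^-1).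
Proof.
move=> mf f0; have -> : (fun x => (f x)^-1) = (fun x => expR (- ln (f x))).
  by apply/funext => x; rewrite expRN lnK// posrE.
apply: (measurableT_comp (@measurable_expR R)); apply: measurable_funN.
exact: (measurableT_comp (@measurable_ln R)).
Qed.

Variables (s : R) (a : T -> R).
Hypothesis s0 : 0 < s.
Hypothesis ma : measurable_fun setT a.
Hypothesis a0 : forall x, 0 <= a x.

Let measurable_inv : measurable_fun setT (fun x => (a x + s)^-1).
Proof.
apply: measurable_invr_pos; last by move=> x; rewrite ltr_wpDl.
exact: measurable_funD.
Qed.

Lemma measurable_phi : measurable_fun setT (fun x => phi s (a x)).
Proof. by apply: measurable_funD => //; apply: measurable_funM. Qed.

Lemma measurable_dphi : measurable_fun setT (fun x => dphi s (a x)).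
Proof.
apply: measurable_funB => //; apply: measurable_funM => //.
by under eq_fun do rewrite -exprVn; exact: measurable_funX.
Qed.

Lemma measurable_fisher_weight : measurable_fun setT (fun x => fisher_weight s (a x)).
Proof.
apply: measurable_funM; first by apply: measurable_funX; exact: measurable_dphi.
by apply: measurable_invr_pos; [exact: measurable_phi|move=> x; exact: phi_gt0].
Qed.

End measurable_phi.

(** * From smooth functions to regularised ones *)

Section lsi_smooth.
Variables (R : realType) (n : nat) (P : probability 'rV[R]_n R).
Implicit Types (x z h : 'rV[R]_n).

(** The constant [C] is fixed before [L], [M] and [B], which may therefore degenerate in the
    approximation. *)
Definition lsi_smooth (C : R) := forall (g : 'rV[R]_n -> R) (G : 'rV[R]_n -> 'rV[R]_n) (L
  M B : R),
  0 <= L -> measurable_fun setT g -> measurable_fun setT G ->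
  (forall x, `|g x| <= M) -> (forall x, dotp (G x) (G x) <= B) ->
  (forall z h, g (z + h) <= g z + dotp (G z) h + L * dotp h h) ->
  \int[P]_x (expR (g x) * g x) - (\int[P]_x expR (g x)) * ln (\int[P]_x expR (g x)) <=
  C * \int[P]_x (expR (g x) * dotp (G x) (G x)).

Lemma l1norm_sqr_le h : l1norm h ^+ 2 <= n%:R * dotp h h.
Proof.
pose u : 'rV[R]_n := const_mx 1; pose v : 'rV[R]_n := \row_i `|h ord0 i|.
have -> : l1norm h = dotp u v by apply: eq_bigr => i _; rewrite !mxE mul1r.
have <- : dotp u u = n%:R.
  rewrite /dotp; under eq_bigr do rewrite mxE mulr1.
  by rewrite sumr_const card_ord.
have <- : dotp v v = dotp h h.
  by apply: eq_bigr => i _; rewrite !mxE -expr2 real_normK ?num_real// expr2.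
rewrite -!sqr_enorm -exprMn -real_normK ?num_real//.
by rewrite ler_pXn2r ?nnegrE ?mulr_ge0 ?enorm_ge0// dotp_cauchy.
Qed.

(** The inequality is applied to [g = ln (phi F)], for which [exp g * |G| ^ 2] is
    [fisher_weight F * |H| ^ 2]. *)
Lemma lsi_smooth_C11 (C s : R) F H : lsi_smooth C -> 0 < s -> C11 F H ->
  (forall x, 0 <= F x) -> (forall i, measurable_fun setT (fun x => H x ord0 i)) ->
  let m := \int[P]_x phi s (F x) in
  \int[P]_x (phi s (F x) * ln (phi s (F x))) - m * ln m <=
  C * \int[P]_x (fisher_weight s (F x) * dotp (H x) (H x)).
Proof.
move=> lsi s0 FH F0 mH.
have mF : measurable_fun setT F by apply: continuous_measurable_rV;
  exact: C11_continuous FH.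
have [L L0 FL] := C11_lipschitz FH.
have [M M0 [FM HM FE]] := FH.
pose g x := ln (phi s (F x)); pose G x := (dphi s (F x) / phi s (F x)) *: H x.
have phi0 x : 0 < phi s (F x) by exact: phi_gt0.
have sV : 0 < s^-1 by rewrite invr_gt0.
have pV x : 0 < (phi s (F x))^-1 by rewrite invr_gt0.
have pVs x : (phi s (F x))^-1 <= s^-1 by rewrite lef_pV2 ?posrE// phi_ge.
have eg x : expR (g x) = phi s (F x) by rewrite /g lnK// posrE.
have eG x : expR (g x) * dotp (G x) (G x) = fisher_weight s (F x) * dotp (H x) (H x).
  by rewrite eg /G dotpZl dotpZr /fisher_weight; field; rewrite gt_eqF.
have FleM x : F x <= M by rewrite (le_trans (ler_norm _)).
(* The dimension enters through the comparison of the sum norm of [C11] with the Euclidean norm, in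
   [L] and [B] and not in [C]. *)
have := lsi g G (n%:R * (s^-1 * M + L ^+ 2 / s ^+ 2)) (M + s + s^-1) (s^-1 ^+ 2 * (n%:R *
  M ^+ 2)).
under eq_Rintegral do rewrite eg.
under [in X in _ - X * _]eq_Rintegral do rewrite eg.
under [in X in ln X]eq_Rintegral do rewrite eg.
under [in X in C * X]eq_Rintegral do rewrite eG.
apply.
- by rewrite mulr_ge0// addr_ge0// ?mulr_ge0 ?invr_ge0 ?sqr_ge0// ltW.
- by apply: (measurableT_comp (@measurable_ln R)); exact: measurable_phi.
- apply: measurable_fun_rVP => i; rewrite /rV_coord/=.
  rewrite (_ : _ \o _ = fun x => dphi s (F x) / phi s (F x) * H x ord0 i).
    apply: measurable_funM => //; apply: measurable_funM; first exact: measurable_dphi.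
    by apply: measurable_invr_pos => //; exact: measurable_phi.
  by apply/funext => x; rewrite /= !mxE.
- move=> x; rewrite (le_trans (ln_norm_le s0 (phi_ge s0 (F0 x))))// lerD2r.
  by rewrite (le_trans (phi_le s0 (F0 x)))// lerD2r.
- move=> x; rewrite /G dotpZl dotpZr mulrA -expr2.
  have d0 := dphi_ge0 s0 (F0 x); have d1 := dphi_le1 s (F x).
  apply: ler_pM; [exact: sqr_ge0|exact: dotp_ge0| |].
    rewrite ler_pXn2r ?nnegrE ?(ltW sV)//; last by rewrite mulr_ge0// ltW.
    by rewrite -[leRHS]mul1r ler_pM// ltW.
  rewrite mulr_natl -[X in _ *+ X]card_ord -sumr_const; apply: ler_sum => i _.
  by rewrite -expr2 -real_normK ?num_real// ler_pXn2r ?nnegrE.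
move=> z h; have N2 : 0 <= l1norm h ^+ 2 by exact: sqr_ge0.
have dF : F (z + h) - F z <= dotp (H z) h + M * l1norm h ^+ 2.
  by have := FE z h; rewrite ler_norml => /andP[_]; rewrite lerBlDl.
have dF2 : (F (z + h) - F z) ^+ 2 <= L ^+ 2 * l1norm h ^+ 2.
  rewrite -real_normK ?num_real// -exprMn ler_pXn2r ?nnegrE//.
  by rewrite mulr_ge0 ?l1norm_ge0.
rewrite /G dotpZl -lerBlDl opprD addrA [_ - _ - _ <= _]lerBlDl.
have -> : dphi s (F z) / phi s (F z) * dotp (H z) h = (phi s (F z))^-1 * (dphi s (F z) *
  dotp (H z) h).
  by ring.
apply: (le_trans (ln_phi_expansion s0 (F0 z) (F0 (z + h)))).
have d0 := dphi_ge0 s0 (F0 z); have d1 := dphi_le1 s (F z).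
apply: (@le_trans _ _ ((phi s (F z))^-1 * (dphi s (F z) * dotp (H z) h) +
    (s^-1 * M + L ^+ 2 / s ^+ 2) * l1norm h ^+ 2)); last first.
  have c0 : 0 <= s^-1 * M + L ^+ 2 / s ^+ 2.
    by rewrite addr_ge0// ?mulr_ge0 ?invr_ge0 ?sqr_ge0// ltW.
  have := ler_wpM2l c0 (l1norm_sqr_le h).
  by rewrite lerD2l [_ * (n%:R * _)]mulrA [_ * n%:R]mulrC.
rewrite [(s^-1 * M + _) * _]mulrDl addrA; apply: lerD; last first.
  by rewrite [leRHS]mulrAC; apply: ler_wpM2r => //; rewrite invr_ge0 sqr_ge0.
apply: (@le_trans _ _ ((phi s (F z))^-1 * (dphi s (F z) * (dotp (H z) h + M * l1norm h ^+
  2)))).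
  by apply: ler_wpM2l; [exact: ltW|exact: ler_wpM2l].
have MN : 0 <= M * l1norm h ^+ 2 by exact: mulr_ge0.
rewrite [dphi _ _ * (_ + _)]mulrDr [_ * (_ + _)]mulrDr lerD2l -[leRHS]mulrA.
apply: ler_pM => //; first exact: ltW.
  exact: mulr_ge0.
by rewrite -[leRHS]mul1r; apply: ler_wpM2r.
Qed.


End lsi_smooth.

Lemma norm_mul_young (R : realType) (t w v : R) : 0 < t ->
  `|w * v| <= t * w ^+ 2 + t^-1 * v ^+ 2.
Proof.
move=> t0; have tV : 0 < t^-1 by rewrite invr_gt0.
have E (e : R) : t * w ^+ 2 + t^-1 * v ^+ 2 - 2 * (e * (w * v)) = t * (w - e * (t^-1 *
  v)) ^+ 2 + (1 - e ^+ 2) * (t^-1 * v ^+ 2).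
  by field; rewrite gt_eqF.
have p1 : 0 <= t * w ^+ 2 by rewrite mulr_ge0 ?sqr_ge0// ltW.
have p2 : 0 <= t^-1 * v ^+ 2 by rewrite mulr_ge0 ?sqr_ge0// ltW.
have E1 := E 1; have E2 := E (-1).
have q1 : 0 <= t * (w - 1 * (t^-1 * v)) ^+ 2 by rewrite mulr_ge0 ?sqr_ge0// ltW.
have q2 : 0 <= t * (w - -1 * (t^-1 * v)) ^+ 2 by rewrite mulr_ge0 ?sqr_ge0// ltW.
rewrite sqrrN expr1n subrr mul0r addr0 in E2; rewrite expr1n subrr mul0r addr0 in E1.
by rewrite ler_norml; apply/andP; split; lra.
Qed.

Section L2_lemmas.
Context d (T : measurableType d) (R : realType) (P : probability T R).
Implicit Types (h k v w : T -> R).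

Lemma dominated_integrable h k : measurable_fun setT h ->
  P.-integrable setT (EFin \o k) -> (forall x, `|h x| <= k x) ->
  P.-integrable setT (EFin \o h).
Proof.
move=> mh ki hk; apply: (le_integrable _ _ _ ki) => //; first exact/measurable_EFinP.
by move=> x _; rewrite lee_fin; exact: le_trans (hk x) (ler_norm _).
Qed.

Lemma cst_integrable (c : R) : P.-integrable setT (EFin \o (fun=> c)).
Proof. exact: (bounded_integrable P (M := `|c|)). Qed.

Lemma sqr_integrable v : measurable_fun setT v ->
  P.-integrable setT (EFin \o (fun x => v x ^+ 2)) -> P.-integrable setT (EFin \o v).
Proof.
move=> mv vi; apply: (dominated_integrable (k := fun x => v x ^+ 2 + 1)) => //.
  by apply: integrable_EFinD => //; exact: cst_integrable.
by move=> x; rewrite -[v x ^+ 2]real_normK ?num_real// le_sqrD1.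
Qed.

(** When [v] has squared norm of order [t ^ 2], Young's inequality with weight [t] makes both of its
    terms of order [t]. *)
Lemma young_integral v w (t K : R) : 0 < t -> measurable_fun setT v -> measurable_fun
  setT w ->
  P.-integrable setT (EFin \o (fun x => v x ^+ 2)) ->
  P.-integrable setT (EFin \o (fun x => w x ^+ 2)) ->
  \int[P]_x (v x ^+ 2) <= K * t ^+ 2 ->
  P.-integrable setT (EFin \o (fun x => w x * v x)) /\
  `|\int[P]_x (w x * v x)| <= t * (\int[P]_x (w x ^+ 2) + K).
Proof.
move=> t0 mv mw vi wi vK.
have di : P.-integrable setT (EFin \o (fun x => t * w x ^+ 2 + t^-1 * v x ^+ 2)).
  by apply: integrable_EFinD; exact: integrable_EFinZ.
have wvi : P.-integrable setT (EFin \o (fun x => w x * v x)).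
  apply: (dominated_integrable (k := fun x => t * w x ^+ 2 + t^-1 * v x ^+ 2)) => //.
    exact: measurable_funM.
  by move=> x; exact: norm_mul_young.
split => //; apply: (le_trans (le_normr_Rintegral _ wvi)) => //.
apply: (@le_trans _ _ (\int[P]_x (t * w x ^+ 2 + t^-1 * v x ^+ 2))).
  apply: le_Rintegral => //; first exact: (integrable_norm wvi).
  by move=> x _; exact: norm_mul_young.
rewrite RintegralD//; [|exact: integrable_EFinZ..].
rewrite !RintegralZl// mulrDr lerD2l.
have tV : 0 <= t^-1 by rewrite invr_ge0 ltW.
apply: (le_trans (ler_wpM2l tV vK)).
by rewrite le_eqVlt; apply/orP; left; apply/eqP; field; rewrite gt_eqF.
Qed.

Lemma truncation_vanishes w (e : R) : measurable_fun setT w -> (forall x, 0 <= w x) ->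
  P.-integrable setT (EFin \o w) -> 0 < e ->
  exists2 N : R, 0 <= N & \int[P]_x Num.max (w x - N) 0 <= e.
Proof.
move=> mw w0 wi e0.
have mk (N : R) : measurable_fun setT (fun x => Num.max (w x - N) 0).
  by apply: measurable_maxr => //; exact: measurable_funB.
have cv : (\int[P]_x (Num.max (w x - i%:R) 0)%:E)%E @[i --> \oo] --> (0 : \bar R)%E.
  apply: (@ge0_dominated_cvg0 _ _ _ P (fun i x => (Num.max (w x - i%:R) 0)%:E) (fun x =>
    (w x)%:E)).
  - by move=> i; apply/measurable_EFinP; exact: mk.
  - by move=> i x; rewrite lee_fin le_max lexx orbT.
  - exact/measurable_EFinP.
  - case/integrableP : wi => _; apply: le_lt_trans; apply: ge0_le_integral => //.
    + by move=> x _; rewrite lee_fin.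
    + exact/measurable_EFinP.
    + by apply: measurableT_comp => //; exact/measurable_EFinP.
    + by move=> x _; rewrite lee_fin ler_norm.
  - by move=> i x; rewrite lee_fin ge_max w0 andbT gerBl.
  move=> x _; apply: cvg_near_cst.
  near=> i; congr EFin; apply/eqP.
  rewrite eq_le le_max lexx orbT andbT ge_max lexx andbT subr_le0.
  by near: i; exact: nbhs_infty_ger.
move/fine_cvgP : cv => [_ /cvgrPdist_le/(_ _ e0)[i _ /(_ i (leqnn i))]] /=.
rewrite sub0r normrN => /(le_trans (ler_norm _)) H.
by exists i%:R.
Unshelve. all: by end_near. Qed.

End L2_lemmas.

Section dotp_perturb.
Variables (R : realType) (n : nat).
Implicit Types g h : 'rV[R]_n.

Lemma dotp_perturb (t : R) g h : 0 < t ->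
  dotp h h <= (1 + t) * dotp g g + (1 + t^-1) * \sum_i (h ord0 i - g ord0 i) ^+ 2.
Proof.
move=> t0; rewrite /dotp !mulr_sumr -big_split/=; apply: ler_sum => i _.
move: (h ord0 i) (g ord0 i) => {g h} y x; rewrite -subr_ge0.
rewrite (_ : _ - _ = t^-1 * (t * x - (y - x)) ^+ 2); last by field; rewrite gt_eqF.
by rewrite mulr_ge0 ?sqr_ge0// invr_ge0 ltW.
Qed.

(** The difference of the weights is controlled by [|b - a|], but it multiplies the unbounded
    [dotp g g]. That quantity is cut at [N]: below, the Lipschitz bound applies; the excess only
    meets the uniform bound [s^-1] of the weight. *)
Lemma fisher_perturb (s t N a b : R) g h : 0 < s -> 0 < t -> 0 <= N -> 0 <= a -> 0 <= b ->
  fisher_weight s b * dotp h h <= fisher_weight s a * dotp g g +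
    (5 / s ^+ 2 * N * `|b - a| + (s^-1 * Num.max (dotp g g - N) 0 +
    (t / s * dotp g g + (1 + t^-1) / s * \sum_i (h ord0 i - g ord0 i) ^+ 2))).
Proof.
move=> s0 t0 N0 a0 b0; have := dotp_perturb g h t0.
set q := \sum_i _; set H := dotp h h; have := dotp_ge0 g; set G := dotp g g => G0 Hle.
have q0 : 0 <= q by apply: sumr_ge0 => i _; exact: sqr_ge0.
have wb0 := fisher_weight_ge0 s0 b0; have wbs := fisher_weight_le s0 b0.
have wa0 := fisher_weight_ge0 s0 a0.
have wl := fisher_weight_lipschitz s0 b0 a0.
move: wb0 wbs wa0 wl; set wb := fisher_weight s b;
  set wa := fisher_weight s a => wb0 wbs wa0 wl.
have h1 := ler_wpM2l wb0 Hle.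
have p1 : 0 <= t * G by rewrite mulr_ge0// ltW.
have p2 : 0 <= (1 + t^-1) * q by rewrite mulr_ge0// addr_ge0// invr_ge0 ltW.
have h2 := ler_wpM2r p1 wbs; have h3 := ler_wpM2r p2 wbs.
have h4 : wb * G <= wa * G + 5 / s ^+ 2 * N * `|b - a| + s^-1 * Num.max (G - N) 0.
  have wd : wb - wa <= 5 / s ^+ 2 * `|b - a| by exact: le_trans (ler_norm _) wl.
  have c0 : 0 <= 5 / s ^+ 2 * `|b - a|.
    by rewrite mulr_ge0// mulr_ge0// invr_ge0 sqr_ge0.
  rewrite [5 / s ^+ 2 * N * _]mulrAC; move: wd c0; set c := 5 / s ^+ 2 * _ => wd c0.
  case: (leP (G - N) 0) => GN.
    have : (wb - wa) * G <= c * N.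
      apply: (le_trans (ler_wpM2r G0 wd)); apply: ler_wpM2l => //; lra.
    rewrite mulr0; lra.
  have k1 := ler_wpM2r N0 wd.
  have k2 : (wb - wa) * (G - N) <= s^-1 * (G - N).
    by rewrite ler_wpM2r ?(ltW GN)//; lra.
  lra.
rewrite (_ : t / s * G = s^-1 * (t * G)); last by ring.
rewrite (_ : (1 + t^-1) / s * q = s^-1 * ((1 + t^-1) * q)); last by ring.
lra.
Qed.

End dotp_perturb.

Lemma sqr_homo (R : realType) (x y : R) : 0 <= x -> x <= y -> x ^+ 2 <= y ^+ 2.
Proof. by move=> x0 xy; rewrite !expr2; exact: ler_pM. Qed.

Lemma young_integral1 d (T : measurableType d) (R : realType) (P : probability T R)
    (v : T -> R) (t K : R) : 0 < t -> measurable_fun setT v ->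
  P.-integrable setT (EFin \o (fun x => v x ^+ 2)) ->
  \int[P]_x (v x ^+ 2) <= K * t ^+ 2 -> `|\int[P]_x v x| <= t * (1 + K).
Proof.
move=> t0 mv vi vK.
have one2 : P.-integrable setT (EFin \o (fun _ : T => (1 : R) ^+ 2)) by exact:
  cst_integrable.
have [_] := young_integral t0 mv (@measurable_cst _ _ _ _ setT (1 : R)) vi one2 vK.
have -> : \int[P]_x (cst (1 : R) x ^+ 2) = 1
  by exact: (etrans (Rintegral_prob_cst P ((1 : R) ^+ 2)) (expr1n _ _)).
by have -> : \int[P]_x (cst (1 : R) x * v x) = \int[P]_x v x
  by apply: eq_Rintegral => x _; rewrite mul1r.
Qed.

Section bounded_density.
Variables (R : realType) (n : nat) (P : probability 'rV[R]_n R).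
Notation leb := (lebesgue_rV R n).
Variables (rho : 'rV[R]_n -> R) (kap : R).
Hypothesis mrho : measurable_fun setT rho.
Hypothesis rho0 : forall x, 0 <= rho x.
Hypothesis rhok : forall x, rho x <= kap.
Hypothesis PE : forall A, measurable A -> (P A = \int[leb]_(x in A) (rho x)%:E)%E.

Let kap0 : 0 <= kap. Proof. exact: le_trans (rho0 0) (rhok 0). Qed.

Lemma bounded_density_integral_le (h : 'rV[R]_n -> R) (c : R) : measurable_fun setT h ->
  (forall x, 0 <= h x) -> (\int[leb]_x (h x)%:E <= c%:E)%E ->
  P.-integrable setT (EFin \o h) /\ \int[P]_x h x <= kap * c.
Proof.
move=> mh h0 hc.
have mh' : measurable_fun setT (fun x => (h x)%:E) by exact/measurable_EFinP.
have mrho' : measurable_fun setT (fun x => (rho x)%:E) by exact/measurable_EFinP.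
have hP : (\int[P]_x (h x)%:E <= (kap * c)%:E)%E.
  rewrite (@integral_density _ _ _ P leb (fun x => (rho x)%:E) (fun x => (h x)%:E))//.
  apply: (@le_trans _ _ (\int[leb]_x (kap%:E * (h x)%:E))%E).
    apply: ge0_le_integral => //.
    - by move=> x _; rewrite -EFinM lee_fin mulr_ge0.
    - exact: emeasurable_funM.
    - exact: emeasurable_funM.
    - by move=> x _; rewrite -!EFinM lee_fin mulrC ler_wpM2r.
  rewrite ge0_integralZl_EFin//; last by move=> x _; rewrite lee_fin.
  by rewrite EFinM; apply: lee_wpmul2l => //; rewrite lee_fin.
have hi : P.-integrable setT (EFin \o h).
  apply/integrableP; split => //=.
  under eq_integral do rewrite ger0_norm//.
  exact: le_lt_trans hP (ltry _).
by split => //; rewrite -lee_fin EFin_Rintegral.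
Qed.

Lemma bounded_density_integrable_sqr (h : 'rV[R]_n -> R) : measurable_fun setT h ->
  leb.-integrable setT (EFin \o (fun x => h x ^+ 2)) ->
  P.-integrable setT (EFin \o (fun x => h x ^+ 2)).
Proof.
move=> mh hi; have [] := @bounded_density_integral_le (fun x => h x ^+ 2) (\int[leb]_x (h
  x ^+ 2)) => //.
- exact: measurable_funX.
- by move=> x; exact: sqr_ge0.
- by rewrite EFin_Rintegral.
Qed.

Variable C : R.
Hypothesis lsi : lsi_smooth P C.
Hypothesis C0 : 0 <= C.

Section regularized_entropy.
Variables (s : R) (a : 'rV[R]_n -> R) (G : 'rV[R]_n -> 'rV[R]_n).
Hypothesis s0 : 0 < s.
Hypothesis ma : measurable_fun setT a.
Hypothesis a0 : forall x, 0 <= a x.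
Hypothesis ai : leb.-integrable setT (EFin \o (fun x => a x ^+ 2)).
Hypothesis mG : forall i, measurable_fun setT (fun x => G x ord0 i).
Hypothesis Gi : forall i, leb.-integrable setT (EFin \o (fun x => G x ord0 i ^+ 2)).
Hypothesis approx : forall e : R, 0 < e -> exists F H, [/\ C11 F H, forall x, 0 <= F x,
    forall i, measurable_fun setT (fun x => H x ord0 i),
    (\int[leb]_x ((F x - a x) ^+ 2)%:E <= e%:E)%E &
    forall i, (\int[leb]_x ((H x ord0 i - G x ord0 i) ^+ 2)%:E <= e%:E)%E].

Let Y x := phi s (a x).
Let g2 x := dotp (G x) (G x).
Let m := \int[P]_x Y x.
Let w x := 1 + ln (Y x).
Let W := \int[P]_x (w x ^+ 2).
Let J := \int[P]_x (fisher_weight s (a x) * g2 x).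
Let tau (N : R) := \int[P]_x Num.max (g2 x - N) 0.

Let mY : measurable_fun setT Y. Proof. exact: measurable_phi. Qed.
Let mlnY : measurable_fun setT (fun x => ln (Y x)).
Proof. exact: (measurableT_comp (@measurable_ln R)). Qed.
Let mw : measurable_fun setT w. Proof. exact: measurable_funD. Qed.
Let mg2 : measurable_fun setT g2.
Proof. by apply: measurable_dotp; exact: measurable_fun_rVP. Qed.
Let g20 x : 0 <= g2 x. Proof. exact: dotp_ge0. Qed.
Let Y0 x : 0 < Y x. Proof. exact: phi_gt0. Qed.
Let Ys x : s <= Y x. Proof. exact: phi_ge. Qed.

Let aPi : P.-integrable setT (EFin \o (fun x => a x ^+ 2)).
Proof. exact: bounded_density_integrable_sqr. Qed.

Let g2i : P.-integrable setT (EFin \o g2).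
Proof.
have -> : EFin \o g2 = (fun x => \sum_i (G x ord0 i ^+ 2)%:E)%E.
  by apply/funext => x; rewrite /= sumEFin; congr EFin; apply: eq_bigr => i _;
    rewrite expr2.
apply: integrable_sum => // i _.
exact: (bounded_density_integrable_sqr (mG i) (Gi i)).
Qed.

Let Y2i : P.-integrable setT (EFin \o (fun x => Y x ^+ 2)).
Proof.
apply: (dominated_integrable (k := fun x => 2 * a x ^+ 2 + 2 * s ^+ 2)).
- exact: measurable_funX.
- by apply: integrable_EFinD; [exact: integrable_EFinZ|exact: cst_integrable].
move=> x; rewrite ger0_norm ?sqr_ge0//.
have := sqrB_le (a x) (- s); rewrite opprK sqrrN; apply: le_trans.
by apply: sqr_homo; [exact: ltW|exact: phi_le].
Qed.

Let Yi : P.-integrable setT (EFin \o Y).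
Proof. exact: sqr_integrable. Qed.

Let w2i : P.-integrable setT (EFin \o (fun x => w x ^+ 2)).
Proof.
apply: (dominated_integrable (k := fun x => 2 * Y x ^+ 2 + 2 * (1 + s^-1) ^+ 2)).
- exact: measurable_funX.
- by apply: integrable_EFinD; [exact: integrable_EFinZ|exact: cst_integrable].
move=> x; rewrite ger0_norm ?sqr_ge0//.
have := sqrB_le (Y x) (- (1 + s^-1)); rewrite opprK sqrrN; apply: le_trans.
have c0 : 0 <= 1 + s^-1 by rewrite addr_ge0// invr_ge0 ltW.
rewrite -[w x ^+ 2]real_normK ?num_real//; apply: sqr_homo => //.
by rewrite (le_trans (ler_normD _ _))// normr1 addrCA lerD2l; exact: ln_norm_le.
Qed.

Let YlnYi : P.-integrable setT (EFin \o (fun x => Y x * ln (Y x))).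
Proof.
apply: (dominated_integrable (k := fun x => Y x ^+ 2 + 1)).
- exact: measurable_funM.
- by apply: integrable_EFinD => //; exact: cst_integrable.
by move=> x; apply: xlnx_norm_le; exact: ltW.
Qed.

Let Ji : P.-integrable setT (EFin \o (fun x => fisher_weight s (a x) * g2 x)).
Proof.
apply: (dominated_integrable (k := fun x => s^-1 * g2 x)).
- by apply: measurable_funM => //; exact: measurable_fisher_weight.
- exact: integrable_EFinZ.
move=> x; rewrite ger0_norm; last by apply: mulr_ge0 => //; exact: fisher_weight_ge0.
by apply: ler_wpM2r => //; exact: fisher_weight_le.
Qed.

Let taui N : 0 <= N -> P.-integrable setT (EFin \o (fun x => Num.max (g2 x - N) 0)).
Proof.
move=> N0; apply: (dominated_integrable (k := g2)) => //.
  by apply: measurable_maxr => //; exact: measurable_funB.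
by move=> x; rewrite ger0_norm ?le_max ?lexx ?orbT// ge_max g20 andbT gerBl.
Qed.

Let m0 : 0 <= m. Proof. by apply: Rintegral_ge0 => x _; exact: ltW. Qed.

Let error (N : R) := C * (5 / s ^+ 2 * N * (1 + kap) + (s^-1 * \int[P]_x g2 x + 2 * (n%:R
  * kap) / s)) +
  (W + kap) + (1 + kap) * (3 + m + kap + s^-1).

Let error_ge0 N : 0 <= N -> 0 <= error N.
Proof.
move=> N0; have sV : 0 <= s^-1 by rewrite invr_ge0 ltW.
have W0 : 0 <= W by apply: Rintegral_ge0 => x _; exact: sqr_ge0.
have g0 : 0 <= \int[P]_x g2 x by apply: Rintegral_ge0.
have s2 : 0 <= (s ^+ 2)^-1 by rewrite invr_ge0 sqr_ge0.
by rewrite /error; repeat (apply: addr_ge0 || apply: mulr_ge0 || exact: kap0 || exact: C0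
  ||
  exact: m0 || exact: ler01 || exact: s2).
Qed.

(* Mollifying up to an error [t ^ 2] in [L^2] and using Young's inequality with
   weight [t] makes all errors of order [t], except for the tail [tau N] of
   [|G|^2], which is not affected by the mollification. *)
Let regularized_entropy_error t N : 0 < t -> t <= 1 -> 0 <= N ->
  \int[P]_x (Y x * ln (Y x)) - m * ln m <= C * J + C * (s^-1 * tau N) + t * error N.
Proof.
move=> t0 t1 N0; have t20 : 0 < t ^+ 2 by rewrite exprn_gt0.
have [F [H [FH F0 mH Fa HG]]] := approx t20.
have mF : measurable_fun setT F by apply: continuous_measurable_rV;
  exact: C11_continuous FH.
have md : measurable_fun setT (fun x => F x - a x) by exact: measurable_funB.
have [d2i d2] : P.-integrable setT (EFin \o (fun x => (F x - a x) ^+ 2)) /\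
    \int[P]_x ((F x - a x) ^+ 2) <= kap * t ^+ 2.
  apply: bounded_density_integral_le => //; first exact: measurable_funX.
  by move=> x; exact: sqr_ge0.
pose X x := phi s (F x); pose v x := X x - Y x.
have mX : measurable_fun setT X by exact: measurable_phi.
have mv : measurable_fun setT v by exact: measurable_funB.
have X0 x : 0 < X x by exact: phi_gt0.
have vd x : `|v x| <= `|F x - a x| by exact: phi_lipschitz.
have v2d x : v x ^+ 2 <= (F x - a x) ^+ 2.
  by rewrite -[v x ^+ 2]real_normK ?num_real// -[leRHS]real_normK ?num_real//;
    exact: sqr_homo.
have v2i : P.-integrable setT (EFin \o (fun x => v x ^+ 2)).
  apply: (dominated_integrable _ d2i) => [|x]; first exact: measurable_funX.
  by rewrite ger0_norm ?sqr_ge0.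
have v2 : \int[P]_x (v x ^+ 2) <= kap * t ^+ 2 by apply: (le_trans _ d2);
  exact: le_Rintegral.
have [wvi wv] := young_integral t0 mv mw v2i w2i v2.
have vi := sqr_integrable mv v2i.
have v1 := young_integral1 t0 mv v2i v2.
have mad : measurable_fun setT (fun x => `|F x - a x|) by exact: measurableT_comp.
have d2i' : P.-integrable setT (EFin \o (fun x => `|F x - a x| ^+ 2)).
  by under eq_fun do rewrite real_normK ?num_real//.
have d2' : \int[P]_x (`|F x - a x| ^+ 2) <= kap * t ^+ 2.
  by under eq_Rintegral do rewrite real_normK ?num_real//.
have adi := sqr_integrable mad d2i'.
have d1 := young_integral1 t0 mad d2i' d2'.
have {}d1 := le_trans (ler_norm _) d1.
have Xi : P.-integrable setT (EFin \o X).
  have -> : X = fun x => v x + Y x by apply/funext => x; rewrite subrK.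
  exact: integrable_EFinD.
have mXE : \int[P]_x X x = m + \int[P]_x v x.
  by rewrite -RintegralD//; apply: eq_Rintegral => x _; rewrite addrC subrK.
have XlnXi : P.-integrable setT (EFin \o (fun x => X x * ln (X x))).
  have [M M0 [FM _ _]] := FH.
  apply: (dominated_integrable (k := fun=> (M + s) ^+ 2 + 1)).
  - by apply: measurable_funM => //; exact: (measurableT_comp (@measurable_ln R)).
  - exact: cst_integrable.
  move=> x; rewrite (le_trans (xlnx_norm_le (ltW (X0 x))))// lerD2r.
  apply: sqr_homo; first exact: ltW.
  by apply: (le_trans (phi_le s0 (F0 x))); rewrite lerD2r (le_trans (ler_norm _)).
(* Convexity of [x * ln x]: the tangent at [Y] is linear in the increment [v], whose pairing with
   the slope [w] has order [t]. *)
have lower : \int[P]_x (Y x * ln (Y x)) + \int[P]_x (w x * v x) <= \int[P]_x (X x * ln (X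
  x)).
  rewrite -RintegralD//; apply: le_Rintegral => //; first exact: integrable_EFinD.
  by move=> x _; exact: entropy_tangent.
have ms : s <= m.
  by rewrite -[leLHS](Rintegral_prob_cst P); apply: le_Rintegral => //;
    exact: cst_integrable.
have mXs : s <= m + \int[P]_x v x.
  rewrite -mXE -[leLHS](Rintegral_prob_cst P); apply: le_Rintegral => //;
    first exact: cst_integrable.
  by move=> x _; exact: phi_ge.
have upper := lsi_smooth_C11 lsi s0 FH F0 mH.
rewrite /= -/X mXE in upper.
have q2 i : P.-integrable setT (EFin \o (fun x => (H x ord0 i - G x ord0 i) ^+ 2)) /\
    \int[P]_x ((H x ord0 i - G x ord0 i) ^+ 2) <= kap * t ^+ 2.
  apply: bounded_density_integral_le => //.
    by apply: measurable_funX; exact: measurable_funB.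
  by move=> x; exact: sqr_ge0.
have qi : P.-integrable setT (EFin \o (fun x => \sum_i (H x ord0 i - G x ord0 i) ^+ 2)).
  have -> : EFin \o (fun x => \sum_i (H x ord0 i - G x ord0 i) ^+ 2) =
      (fun x => \sum_i ((H x ord0 i - G x ord0 i) ^+ 2)%:E)%E.
    by apply/funext => x; rewrite /= sumEFin.
  by apply: integrable_sum => // i _; case: (q2 i).
have q1 : \int[P]_x (\sum_i (H x ord0 i - G x ord0 i) ^+ 2) <= n%:R * kap * t ^+ 2.
  rewrite -lee_fin EFin_Rintegral//; under eq_integral do rewrite -sumEFin.
  rewrite integral_sum//; last by move=> i; case: (q2 i).
  apply: (@le_trans _ _ (\sum_(i < n) (kap * t ^+ 2)%:E)%E).
    by apply: lee_sum => i _; case: (q2 i) => ii ib; rewrite -EFin_Rintegral// lee_fin.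
  by rewrite sumEFin lee_fin sumr_const card_ord -mulrA mulr_natl lexx.
have fisher : \int[P]_x (fisher_weight s (F x) * dotp (H x) (H x)) <=
    J + (5 / s ^+ 2 * N * (t * (1 + kap)) + (s^-1 * tau N + (t / s * \int[P]_x g2 x +
      (1 + t^-1) / s * (n%:R * kap * t ^+ 2)))).
  have Ii := integrable_EFinZ (5 / s ^+ 2 * N) adi.
  have Iii := integrable_EFinZ s^-1 (taui N0).
  have Iiii := integrable_EFinZ (t / s) g2i.
  have Iv := integrable_EFinZ ((1 + t^-1) / s) qi.
  have I3 := integrable_EFinD Iiii Iv; have I2 := integrable_EFinD Iii I3.
  have I1 := integrable_EFinD Ii I2; have I0 := integrable_EFinD Ji I1.
  have pert x := fisher_perturb (G x) (H x) s0 t0 N0 (a0 x) (F0 x).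
  apply: (@le_trans _ _ _ _ _ (le_Rintegral measurableT _ I0 (fun x _ => pert x))).
    apply: (dominated_integrable _ I0) => [|x].
      apply: measurable_funM; first exact: measurable_fisher_weight.
      by apply: measurable_dotp; exact: measurable_fun_rVP.
    rewrite ger0_norm//; apply: mulr_ge0; [exact: fisher_weight_ge0|exact: dotp_ge0].
  rewrite (RintegralD measurableT Ji I1) (RintegralD measurableT Ii I2).
  rewrite (RintegralD measurableT Iii I3) (RintegralD measurableT Iiii Iv).
  rewrite !RintegralZl//; last exact: taui.
  have k1 : 0 <= 5 / s ^+ 2 * N by rewrite !mulr_ge0// invr_ge0 sqr_ge0.
  have k2 : 0 <= (1 + t^-1) / s by rewrite divr_ge0 ?addr_ge0 ?invr_ge0// ltW.
  by rewrite lerD2l; apply: lerD; rewrite ?lerD2l; apply: ler_wpM2l.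
(* The subtracted term needs the opposite bound, so the tangent is taken at the perturbed mean,
   which stays above [s]. *)
have tang : (m + \int[P]_x v x) * ln (m + \int[P]_x v x) - m * ln m <=
    t * ((1 + kap) * (3 + m + kap + s^-1)).
  have mX0 := lt_le_trans s0 mXs; have := entropy_tangent (lt_le_trans s0 ms) mX0.
  set mu := m + \int[P]_x v x => tg.
  have vE : mu - m = \int[P]_x v x by rewrite /mu addrAC subrr add0r.
  have l1 : `|1 + ln mu| <= 3 + m + kap + s^-1.
    rewrite (le_trans (ler_normD _ _))// normr1.
    have := ln_norm_le s0 mXs; have : mu - m <= 1 + kap.
      rewrite vE (le_trans (ler_norm _))// (le_trans v1)// ler_piMl// addr_ge0//.
    rewrite -/mu; lra.
  have := ler_pM (normr_ge0 _) (normr_ge0 _) l1 v1; rewrite -normrM -vE.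
  have := ler_norm ((1 + ln mu) * (mu - m)); lra.
have upperJ := le_trans upper (ler_wpM2l C0 fisher).
have lowerb : - (t * (W + kap)) <= \int[P]_x (w x * v x) by move: wv;
  rewrite ler_norml => /andP[].
have sV : 0 < s^-1 by rewrite invr_gt0.
(* The factor [t^-1] from [dotp_perturb] is beaten by the mollification error:
   [(1 + t^-1) * t ^ 2 = t + t ^ 2 <= 2 * t]. *)
have t2 : (1 + t^-1) / s * (n%:R * kap * t ^+ 2) <= t * (2 * (n%:R * kap) / s).
  have nk : 0 <= n%:R * kap / s by rewrite divr_ge0 ?mulr_ge0// ltW.
  rewrite [leLHS](_ : _ = t * (n%:R * kap / s) + t ^+ 2 * (n%:R * kap / s)); last first.
    by field; rewrite !gt_eqF.
  have : t ^+ 2 * (n%:R * kap / s) <= t * (n%:R * kap / s).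
    by apply: ler_wpM2r => //; rewrite expr2 ler_piMl// ltW.
  have -> : t * (2 * (n%:R * kap) / s) = 2 * (t * (n%:R * kap / s)) by ring.
  lra.
have cost : C * (J + (5 / s ^+ 2 * N * (t * (1 + kap)) + (s^-1 * tau N + (t / s *
  \int[P]_x g2 x +
      (1 + t^-1) / s * (n%:R * kap * t ^+ 2))))) <= C * J + C * (s^-1 * tau N) +
      t * (C * (5 / s ^+ 2 * N * (1 + kap) + (s^-1 * \int[P]_x g2 x + 2 * (n%:R * kap) /
        s))).
  apply: (@le_trans _ _ (C * (J + s^-1 * tau N + t * (5 / s ^+ 2 * N * (1 + kap) +
      (s^-1 * \int[P]_x g2 x + 2 * (n%:R * kap) / s))))); last first.
    by rewrite le_eqVlt; apply/orP; left; apply/eqP; ring.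
  apply: ler_wpM2l => //.
  rewrite (_ : t / s * _ = t * (s^-1 * \int[P]_x g2 x)); last by rewrite mulrA.
  rewrite (_ : _ * (t * (1 + kap)) = t * (5 / s ^+ 2 * N * (1 + kap)));
    last by rewrite mulrCA.
  lra.
rewrite /error; lra.
Qed.

(** The order of the limits matters: [error N] depends on [N], so [N] is fixed first to make the
    tail small, and then [t] tends to [0]. *)
Lemma regularized_entropy_le :
  \int[P]_x (phi s (a x) * ln (phi s (a x))) -
    (\int[P]_x phi s (a x)) * ln (\int[P]_x phi s (a x)) <=
  C * \int[P]_x (fisher_weight s (a x) * dotp (G x) (G x)).
Proof.
have sV : 0 < s^-1 by rewrite invr_gt0.
apply/ler_addgt0Pr => e e0; pose c := C * s^-1 + 1.
have c0 : 0 < c by rewrite ltr_wpDl// mulr_ge0// ltW.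
have [N N0 Ne] := truncation_vanishes mg2 g20 g2i (divr_gt0 e0 c0).
have /le_trans : \int[P]_x (Y x * ln (Y x)) - m * ln m <= C * J + C * (s^-1 * tau N).
  apply: (@le_of_vanishing_error _ _ _ (error N)); first exact: error_ge0.
  by move=> t t0 t1; exact: regularized_entropy_error.
apply; rewrite lerD2l mulrA.
have cs : 0 <= C * s^-1 by rewrite mulr_ge0// ltW.
apply: (le_trans (ler_wpM2l cs Ne)); rewrite mulrCA ler_piMr ?(ltW e0)//.
by rewrite ler_pdivrMr// mul1r lerDl.
Qed.

End regularized_entropy.
End bounded_density.

Lemma null_set_of_integral0 d (T : measurableType d) (R : realType)
    (mu : {measure set T -> \bar R}) (N : set T) (g : T -> R) :
  measurable N -> measurable_fun setT g -> (forall x, N x -> 0 < g x) ->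
  (\int[mu]_(x in N) (g x)%:E)%E = 0%E -> mu N = 0%E.
Proof.
move=> mN mg g0 I0.
have mgN : measurable_fun N (EFin \o g).
  by apply: (@measurable_funS _ _ _ _ setT) => //; exact/measurable_EFinP.
have : (\int[mu]_(x in N) `|(EFin \o g) x| = 0)%E.
  rewrite -I0; apply: eq_integral => x; rewrite inE => Nx.
  by rewrite /= ger0_norm// ltW// g0.
move=> /(ae_eq_integral_abs _ mN mgN) H.
apply: measure_negligible => //; apply: negligibleS H => x Nx /= /(_ Nx) [] /eqP.
by rewrite gt_eqF// g0.
Qed.

Lemma dist_norm_le (R : realType) (y x : R) : 0 <= y -> (y - `|x|) ^+ 2 <= (y - x) ^+ 2.
Proof.
move=> y0; rewrite -[leRHS]real_normK ?num_real// -[leLHS]real_normK ?num_real//.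
by apply: sqr_homo => //; rewrite -{1}(ger0_norm y0); exact: ler_dist_dist.
Qed.

(** * Removal of the regularisation *)

Section lsi_H1.
Variables (R : realType) (n : nat) (P : probability 'rV[R]_n R).
Notation leb := (lebesgue_rV R n).
Variables (rho : 'rV[R]_n -> R) (kap : R).
Hypothesis mrho : measurable_fun setT rho.
Hypothesis rho0 : forall x, 0 < rho x.
Hypothesis rhok : forall x, rho x <= kap.
Hypothesis PE : forall A, measurable A -> (P A = \int[leb]_(x in A) (rho x)%:E)%E.
Variable C : R.
Hypothesis lsi : lsi_smooth P C.
Hypothesis C0 : 0 < C.
Variables (Q : probability 'rV[R]_n R) (f : 'rV[R]_n -> R) (G : 'rV[R]_n -> 'rV[R]_n).
Hypothesis QE : forall A, measurable A -> (Q A = \int[P]_(x in A) (f x)%:E)%E.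
Hypothesis fG : H1_with_gradient f G.

Let rho_ge0 x : 0 <= rho x. Proof. exact: ltW. Qed.

Let mf : measurable_fun setT f.
Proof. by case: fG => /square_integrableP[]. Qed.

Let fi : leb.-integrable setT (EFin \o (fun x => f x ^+ 2)).
Proof. by case: fG => /square_integrableP[]. Qed.

Let mG i : measurable_fun setT (fun x => G x ord0 i).
Proof. by case: fG => _ /(_ i)[/square_integrableP[]]. Qed.

Let Gi i : leb.-integrable setT (EFin \o (fun x => G x ord0 i ^+ 2)).
Proof. by case: fG => _ /(_ i)[/square_integrableP[]]. Qed.

Let N := [set x | f x < 0].

Let mN : measurable N. Proof. exact: measurable_lt0. Qed.

(** The integral of [f] over [N] is [Q N], which is nonnegative, while [f] is negative on [N]. *)
Let PN : P N = 0%E.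
Proof.
apply: (@null_set_of_integral0 _ _ _ _ _ (fun x => - f x)) => //.
- exact: measurable_funN.
- by move=> x; rewrite /N /= oppr_gt0.
apply/eqP; rewrite eq_le integral_ge0 ?andbT; last first.
  by move=> x; rewrite /N /= lee_fin oppr_ge0 => /ltW.
rewrite -leeN2 oppe0 -integral_ge0N; last first.
  by move=> x; rewrite /N /= lee_fin oppr_ge0 => /ltW.
under eq_integral do rewrite EFinN oppeK.
by rewrite -QE.
Qed.

(** Positivity of [rho] turns [P]-null into Lebesgue-null; mollifications of [f] are therefore
    nonnegative everywhere. *)
Let lebN : leb N = 0%E.
Proof.
apply: (@null_set_of_integral0 _ _ _ _ _ rho) => //.
by rewrite -PE// PN.
Qed.

Let ae_norm (h : 'rV[R]_n -> R -> R) : measurable_fun setT (fun x => h x (f x)) ->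
  measurable_fun setT (fun x => h x `|f x|) ->
  (\int[P]_x (h x (f x))%:E = \int[P]_x (h x `|f x|)%:E)%E.
Proof.
move=> m1 m2; apply: ae_eq_integral => //; [exact/measurable_EFinP..|].
exists N; split => //; move=> x; rewrite /N /=; apply: contra_notP => /negP.
by rewrite -leNgt => fx _; rewrite ger0_norm.
Qed.

Let a x := `|f x|.

Let ma : measurable_fun setT a. Proof. exact: measurableT_comp. Qed.
Let a0 x : 0 <= a x. Proof. exact: normr_ge0. Qed.

Let ai : leb.-integrable setT (EFin \o (fun x => a x ^+ 2)).
Proof. by under eq_fun do rewrite /a real_normK ?num_real//. Qed.

Let aPi : P.-integrable setT (EFin \o (fun x => a x ^+ 2)).
Proof. exact: (bounded_density_integrable_sqr mrho rho_ge0 rhok PE ma ai). Qed.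

Let ai1 : P.-integrable setT (EFin \o a).
Proof. exact: sqr_integrable. Qed.

Let mass_a : \int[P]_x a x = 1.
Proof.
apply: EFin_inj; rewrite EFin_Rintegral// -(@ae_norm (fun _ y => y))//.
by rewrite -QE// probability_setT.
Qed.

(** Approximants of [f] serve for [|f|] as well: they are nonnegative, and the absolute value is a
    contraction. *)
Let approx (e : R) : 0 < e -> exists F H, [/\ C11 F H, forall x, 0 <= F x,
    forall i, measurable_fun setT (fun x => H x ord0 i),
    (\int[leb]_x ((F x - a x) ^+ 2)%:E <= e%:E)%E &
    forall i, (\int[leb]_x ((H x ord0 i - G x ord0 i) ^+ 2)%:E <= e%:E)%E].
Proof.
move=> /(H1_approximation fG lebN)[F [H [FH F0 mH Ff HG]]].
have mF : measurable_fun setT F by apply: continuous_measurable_rV;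
  exact: C11_continuous FH.
exists F, H; split => //; apply: le_trans Ff; apply: ge0_le_integral => //.
- by move=> x _; rewrite lee_fin sqr_ge0.
- by apply/measurable_EFinP; apply: measurable_funX; exact: measurable_funB.
- by apply/measurable_EFinP; apply: measurable_funX; exact: measurable_funB.
- by move=> x _; rewrite lee_fin; exact: dist_norm_le.
Qed.

Let mlna : measurable_fun setT (fun x => a x * ln (a x)).
Proof. by apply: measurable_funM => //; exact: (measurableT_comp (@measurable_ln R)). Qed.

Let alnai : P.-integrable setT (EFin \o (fun x => a x * ln (a x))).
Proof.
apply: (dominated_integrable (k := fun x => a x ^+ 2 + 1)) => //.
- by apply: integrable_EFinD => //; exact: cst_integrable.
by move=> x; exact: xlnx_norm_le.
Qed.

Let measurable_inv_norm : measurable_fun setT (fun x => (a x)^-1).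
Proof.
have -> : (fun x => (a x)^-1) = (fun x => if a x == 0 then 0 else expR (- ln (a x))).
  apply/funext => x; case: eqVneq => [->|ax]; first by rewrite invr0.
  by rewrite expRN lnK// posrE lt_neqAle eq_sym ax a0.
apply: measurable_fun_ifT => //.
  exact: (@measurable_fun_eqr _ _ _ setT a (cst 0)).
apply: (measurableT_comp (@measurable_expR R)); apply: measurable_funN.
exact: (measurableT_comp (@measurable_ln R)).
Qed.

Let g2 x := dotp (G x) (G x).
Let mg2 : measurable_fun setT g2.
Proof. by apply: measurable_dotp; exact: measurable_fun_rVP. Qed.

(** The regularisation parameter is [q ^ 2], so that every error is linear in [q]: [2 * q] from
    [xlnx_perturb], and [2 * q] from [m * ln m], the mass [m] of [Y] being between [1] and [1 + q].
    The Fisher term has no error, since its bound is uniform in [q]. *)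
Let entropy_le : P.-integrable setT (EFin \o (fun x => g2 x / a x)) ->
  \int[P]_x (a x * ln (a x)) <= 4 * C * \int[P]_x (g2 x / a x).
Proof.
move=> Di; apply: (@le_of_vanishing_error _ _ _ 4) => // q q0 q1.
have s0 : 0 < q ^+ 2 by rewrite exprn_gt0.
have sq : q ^+ 2 <= q by rewrite expr2 ler_piMr// ltW.
have reg := regularized_entropy_le mrho rho_ge0 rhok PE lsi (ltW C0) s0 ma a0 ai mG Gi
  approx.
set Y := fun x => phi (q ^+ 2) (a x).
have mY : measurable_fun setT Y by exact: measurable_phi.
have Yge x : q ^+ 2 <= Y x by exact: phi_ge.
have Y0 x : 0 < Y x by exact: lt_le_trans (Yge x).
have aY x : a x <= Y x by exact: le_phi.
have Ya x : Y x <= a x + q ^+ 2 by exact: phi_le.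
have Y2i : P.-integrable setT (EFin \o (fun x => Y x ^+ 2)).
  apply: (dominated_integrable (k := fun x => 2 * a x ^+ 2 + 2 * (q ^+ 2) ^+ 2)).
  - exact: measurable_funX.
  - by apply: integrable_EFinD; [exact: integrable_EFinZ|exact: cst_integrable].
  move=> x; rewrite ger0_norm ?sqr_ge0//.
  have := sqrB_le (a x) (- q ^+ 2); rewrite opprK sqrrN; apply: le_trans.
  by apply: sqr_homo; first exact: ltW.
have Yi := sqr_integrable mY Y2i.
have YlnYi : P.-integrable setT (EFin \o (fun x => Y x * ln (Y x))).
  apply: (dominated_integrable (k := fun x => Y x ^+ 2 + 1)).
  - by apply: measurable_funM => //; exact: (measurableT_comp (@measurable_ln R)).
  - by apply: integrable_EFinD => //; exact: cst_integrable.
  by move=> x; apply: xlnx_norm_le; exact: ltW.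
have E1 : \int[P]_x (a x * ln (a x)) <= \int[P]_x (Y x * ln (Y x)) + 2 * q.
  have ci := cst_integrable P (2 * q).
  rewrite -[X in _ + X](Rintegral_prob_cst P) -RintegralD//.
  apply: le_Rintegral => //; first exact: integrable_EFinD.
  by move=> x _; exact: xlnx_perturb.
have m1 : 1 <= \int[P]_x Y x by rewrite -mass_a; apply: le_Rintegral.
have m2 : \int[P]_x Y x <= 1 + q.
  have ci := cst_integrable P (q ^+ 2).
  apply: (@le_trans _ _ (\int[P]_x (a x + q ^+ 2))).
    by apply: le_Rintegral => //; exact: integrable_EFinD.
  by rewrite RintegralD// mass_a Rintegral_prob_cst lerD2l.
have E2 : (\int[P]_x Y x) * ln (\int[P]_x Y x) <= 2 * q.
  move: m1 m2; set m := \int[P]_x _ => m1 m2.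
  have l0 : 0 <= ln m by rewrite ln_ge0.
  have l1 : ln m <= q by have := ln_le_subr1 (lt_le_trans ltr01 m1); lra.
  by apply: ler_pM => //; lra.
have E3 : \int[P]_x (fisher_weight (q ^+ 2) (a x) * g2 x) <= 4 * \int[P]_x (g2 x / a x).
  have D4 := integrable_EFinZ 4 Di.
  have le4 x : fisher_weight (q ^+ 2) (a x) * g2 x <= 4 * (g2 x / a x).
    rewrite mulrCA [leRHS]mulrC; apply: ler_wpM2r; first exact: dotp_ge0.
    exact: fisher_weight_le_inv.
  rewrite -RintegralZl//; apply: le_Rintegral => //.
  apply: (dominated_integrable _ D4) => [|x].
    by apply: measurable_funM => //; exact: measurable_fisher_weight.
  by rewrite ger0_norm//; apply: mulr_ge0; [exact: fisher_weight_ge0|exact: dotp_ge0].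
have E4 := ler_wpM2l (ltW C0) E3.
move: reg; rewrite -/Y; lra.
Qed.

Lemma lsi_H1 (k : R) : 0 < k -> (\int[P]_x (f x * ln (f x))%:E <=
  (4 * C / k)%:E * \int[P]_x (k * dotp (G x) (G x) / f x)%:E)%E.
Proof.
move=> k0.
(* [f] may still be negative on a null set; [1 / f] is seen to be measurable as a sign times
   [1 / |f|]. *)
have msgn : measurable_fun setT (fun x => if f x < 0 then (- 1 : R) else 1).
  by apply: measurable_fun_ifT => //; exact: (@measurable_fun_ltr _ _ _ setT f (cst 0)).
have fE x : f x = (if f x < 0 then - 1 else 1) * a x.
  rewrite /a; case: ltP => fx; first by rewrite ltr0_norm// mulN1r opprK.
  by rewrite mul1r ger0_norm.
have mlnf : measurable_fun setT (fun x => f x * ln (f x)).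
  by apply: measurable_funM => //; exact: (measurableT_comp (@measurable_ln R)).
have mgf : measurable_fun setT (fun x => k * g2 x / f x).
  apply: measurable_funM; first exact: measurable_funM.
  have -> : (fun x => (f x)^-1) = (fun x => (if f x < 0 then - 1 else 1) * (a x)^-1).
    apply/funext => x; rewrite {1}fE invfM; case: ltP => _; rewrite ?invr1 ?invrN1//.
  exact: measurable_funM.
have mga : measurable_fun setT (fun x => g2 x / a x) by exact: measurable_funM.
rewrite (ae_norm (h := fun _ y => y * ln y))//.
rewrite (ae_norm (h := fun x y => k * g2 x / y))//; last first.
  by apply: measurable_funM => //; exact: measurable_funM.
have ga0 x : 0 <= g2 x / a x by rewrite divr_ge0// dotp_ge0.
have -> : (\int[P]_x (k * g2 x / `|f x|)%:E = k%:E * \int[P]_x (g2 x / a x)%:E)%E.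
  under eq_integral do rewrite -mulrA EFinM.
  rewrite ge0_integralZl_EFin ?(ltW k0)//; last exact/measurable_EFinP.
  by move=> x _; rewrite lee_fin.
rewrite muleA -EFinM divfK ?gt_eqF// -/a.
(* If the Fisher information is infinite, so is the right side, its constant being positive. *)
have [Dlty|] := ltP (\int[P]_x (g2 x / a x)%:E)%E +oo%E; last first.
  rewrite leye_eq => /eqP ->; rewrite gt0_muley ?leey//.
  by rewrite lte_fin mulr_gt0.
have Di : P.-integrable setT (EFin \o (fun x => g2 x / a x)).
  apply/integrableP; split; first exact/measurable_EFinP.
  by under eq_integral do rewrite abse_EFin ger0_norm//.
by rewrite -!EFin_Rintegral// -EFinM lee_fin; exact: entropy_le.
Qed.

End lsi_H1.

Unset Implicit Arguments.

Theorem theorem5p3 (R : realType) (L' l' c1 c2 c3 r l : R)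
    (hL' : 0 < L') (hl' : 0 < l')
    (hc1 : 0 < c1) (hc2 : 0 < c2) (hc3 : 0 < c3)
    (hl : 0 < l) (hlr : l < 2 * r) :
  exists A B : R, [/\ 0 < A, 0 < B &
    forall (d : nat) (hd : (0 < d)%N) (u : 'rV[R]_d -> R),
      Ck 2 u ->
      (forall x y, enorm (grad u x - grad u y) <=
        L' * (1 + enorm x + enorm y) `^ l' * enorm (x - y)) ->
      (forall x y, dotp (grad u x - grad u y) (x - y) >=
        (c1 * (enorm x `^ (2 * r) + enorm y `^ (2 * r))
         - c2 * (enorm x `^ l + enorm y `^ l) - c3) * enorm (x - y) ^+ 2) ->
      forall (beta : R) (hbeta : 0 < beta),
        exists P : probability 'rV[R]_d R,
          is_gibbs beta u P /\
          log_sobolev beta P (A * expR (- (B * beta)))].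
Proof.
have [a [lam [a0 lam0 rad]]] := radial_correction hc1 hc2 hc3 hl hlr.
have B0 : 0 < a / (2 * lam) by rewrite divr_gt0// mulr_gt0.
(* [a / (2 * lam)] is the depth of the well. With [C = exp (beta * B) / beta] and [k = beta^-1], the
   constant [4 * C / k] of [lsi_H1] is [4 * exp (beta * B)], which is [(2 * alpha)^-1] for
   [alpha = exp (- B * beta) / 8]. *)
exists 8^-1, (a / (2 * lam)); split => // d hd u u2 _ mon beta beta0.
set B := a / (2 * lam).
have mu : measurable_fun setT u by apply: continuous_measurable_rV; exact: continuous_u.
pose U x := beta * u x; pose V := convexified u a lam beta.
have mU : measurable_fun setT U by exact: measurable_funM.
have mV : measurable_fun setT V.
  by apply: measurable_funM => //; apply: measurable_funD => //;
    exact: measurable_radial_well.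
have cV : strongly_convex beta V := strongly_convex_convexified u2 lam0 beta0 rad mon.
have VU x : V x <= U x <= V x + beta * B.
  have /andP[w1 w2] := radial_well_bounds x a0 lam0.
  rewrite /V /convexified /U mulrDr gerDl -addrA lerDl -mulrDr.
  apply/andP; split; first by rewrite mulr_ge0_le0// ltW.
  by rewrite mulr_ge0 ?(ltW beta0)// -lerBlDr sub0r.
(* The bound passes from [V] to [U] because the well is nonpositive; it yields both the finite
   normaliser and the bounded density that [lsi_H1] needs. *)
have [b [c [c0 Vlow]]] := convexified_lower_bound u2 lam0 beta0 rad mon.
have Ulow x : b + c * dotp x x <= U x by have /andP[VUx _] := VU x;
  exact: le_trans (Vlow x) VUx.
have [Z Z0 ZE] := partition_function_finite mU c0 Ulow.
have [Z' Z'0 Z'E] := partition_function_finite mV c0 Vlow.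
pose rho x := expR (- U x) / Z.
have mrho : measurable_fun setT rho.
  apply: measurable_funM => //; apply: (measurableT_comp (@measurable_expR R)).
  exact: measurable_funN.
have rho0 x : 0 < rho x by rewrite divr_gt0// expR_gt0.
have rho_ge0 x : 0 <= rho x by exact: ltW.
have rhok x : rho x <= expR (- b) / Z.
  rewrite ler_pM2r ?invr_gt0// ler_expR lerN2; apply: le_trans (Ulow x).
  by rewrite lerDl mulr_ge0 ?(ltW c0)// dotp_ge0.
have rho1 : (\int[lebesgue_rV R d]_x (rho x)%:E = 1)%E.
  have ZV0 : 0 <= Z^-1 by rewrite invr_ge0 ltW.
  rewrite /rho; under eq_integral do rewrite mulrC EFinM.
  rewrite ge0_integralZl_EFin//; first by rewrite ZE -EFinM mulVf// gt_eqF.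
  apply/measurable_EFinP; apply: (measurableT_comp (@measurable_expR R));
    exact: measurable_funN.
pose P := density_probability mrho rho_ge0 rho1.
have PE A : measurable A -> (P A = \int[lebesgue_rV R d]_(x in A) (rho x)%:E)%E by [].
exists P; split.
  rewrite /is_gibbs => A mA; rewrite PE//.
  have -> : (\int[lebesgue_rV R d]_y (expR (- beta * u y))%:E = Z%:E)%E.
    by rewrite -ZE; apply: eq_integral => x _; rewrite mulNr.
  by apply: eq_integral => x _; rewrite /rho mulNr.
have lsi : lsi_smooth P (expR (beta * B) / beta).
  move=> g G L M K L0 mg mG gM GK gG.
  exact: (lsi_perturbed beta0 L0 Z0 Z'0 mU mV cV Z'E PE VU mg mG gM GK gG).
have C0 : 0 < expR (beta * B) / beta by rewrite divr_gt0// expR_gt0.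
split; first by rewrite mulr_gt0 ?invr_gt0// expR_gt0.
move=> Q f G _ QE fG.
have bV : 0 < beta^-1 by rewrite invr_gt0.
apply: (le_trans (lsi_H1 mrho rho0 rhok PE lsi C0 QE fG bV)).
rewrite le_eqVlt; apply/orP; left; apply/eqP; congr (_%:E * _)%E.
by rewrite expRN -/B [B * beta]mulrC; field; rewrite !gt_eqF// expR_gt0.
Qed.
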